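(* Let $T>0$, $\beta>\tfrac12$, $\Omega=(0,\pi)$, and consider the final value problem $$u_t+(-\Delta)^\beta u=F(u)+g(x,t)\ \text{ in }\Omega\times(0,T),\qquad u_x=0\ \text{ on }\partial\Omega,\qquad u(x,T)=u_T(x).$$ Assume: (i) $F\in L^\infty(\mathbb R)$ and there is $K>0$ with $|F(\xi_1)-F(\xi_2)|\le K|\xi_1-\xi_2|$ for all $\xi_1,\xi_2\in\mathbb R$; (ii) there are $\gamma>1$ and $\widetilde E_2>0$ with $\sup_{0\le t\le T}\sum_{p=0}^\infty p^{2\gamma}\langle g(\cdot,t),\phi_p\rangle^2\le\widetilde E_2$; (iii) the integers $M_n$ satisfy $0<M_n<n$, and $\frac{(M_n+1)e^{2TM_n^{2\beta}}}{n}$ stays bounded as $n\to\infty$. Assume the problem has a unique solution $u\in C([0,T];L^2(\Omega))$. Let $\overline U_{M_n,n}\in C([0,T];L^2(\Omega))$ be the regularized solution, i.e. the function defined by the nonlinear integral equation $$\overline U_{M_n,n}(x,t)=\Phi_{M_n,n}(\widetilde u_T)(x,t)-\widetilde\Phi_{M_n,n}(\widetilde g)(x,t)-\sum_{p=0}^{M_n}\Big[\int_t^Te^{(s-t)p^{2\beta}}F_p(\overline U_{M_n,n})(s)\,ds\Big]\phi_p(x).$$ Then there is a constant $C_3>0$, independent of $n$ and $t$ (depending only on $V_{\max},\vartheta,T,\beta,\gamma,\widetilde E_2,F,u$), such that the following hold for $t\in[0,T]$. (a) If there exists $\widetilde P_1$ such that $\sup_{0\le t\le T}\sum_{p=1}^\infty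 e^{2p^{2\beta}t}|\langle u(\cdot,t),\phi_p\rangle|^2\le\widetilde P_1$, then $$\mathbf E\|\overline U_{M_n,n}(\cdot,t)-u(\cdot,t)\|_{L^2(\Omega)}^2\le 6e^{-2M_n^{2\beta}t}\Big[C_3\frac{(M_n+1)e^{2TM_n^{2\beta}}}{n}+\widetilde P_1\Big]e^{6K(T-t)}.$$ (b) If there exist $\alpha>0$ and $\widetilde P_2$ such that $\sup_{0\le t\le T}\sum_{p=1}^\infty p^{2\beta\alpha}e^{2p^{2\beta}t}|\langle u(\cdot,t),\phi_p\rangle|^2\le\widetilde P_2$, then $$\mathbf E\|\overline U_{M_n,n}(\cdot,t)-u(\cdot,t)\|_{L^2(\Omega)}^2\le 6e^{-2M_n^{2\beta}t}\Big[C_3\frac{(M_n+1)e^{2TM_n^{2\beta}}}{n}+M_n^{-2\beta\alpha}\widetilde P_2\Big]e^{6K(T-t)}.$$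
   Context: $\langle\cdot,\cdot\rangle$ is the inner product of $L^2(\Omega)$, $\Omega=(0,\pi)$. The Neumann eigenfunctions are $\phi_p(x)=\sqrt{2/\pi}\cos(px)$ for $p\ge1$ and $\phi_0=1/\sqrt\pi$; they form an orthonormal basis of $L^2(\Omega)$. The fractional Laplacian is defined spectrally: $(-\Delta)^\beta f=\sum_{p=1}^\infty p^{2\beta}\langle f,\phi_p\rangle\phi_p$. Write $F_p(w)(t)=\langle F(w(\cdot,t)),\phi_p\rangle$ and $g_p(t)=\langle g(\cdot,t),\phi_p\rangle$. A solution $u$ is understood through its Fourier coefficients $u_p(t)=\langle u(\cdot,t),\phi_p\rangle$: for every $p\ge0$, $u_p'(t)+p^{2\beta}u_p(t)=F_p(u)(t)+g_p(t)$ on $(0,T)$ and $u_p(T)=\langle u_T,\phi_p\rangle$. Data model: $x_k=\pi\frac{2k-1}{2n}$, $k=1,\dots,n$. The observations are $$\widetilde u_T(x_k)=u_T(x_k)+\sigma_k\epsilon_k,\qquad \widetilde g(x_k,t)=\widetilde g_k(t)=g(x_k,t)+\vartheta\xi_k(t),$$ where $\epsilon_k\sim\mathcal N(0,1)$, $0\le\sigma_k<V_{\max}$ for a constant $V_{\max}>0$, $\vartheta$ is a constant, the $\xi_k$ are standard Brownian motions on $[0,T]$, and all the $\epsilon_k,\xi_k$ are mutually independent. Point values of $u_T$ and $g(\cdot,t)$ refer to their continuous representatives. Operators (depending only on values at the points $x_k$): for $f$ depending on $x$ only, $$\Phi_{M_n,n}(f)(x,t)=\frac1n\sum_{k=1}^nf(x_k)+\sum_{p=1}^{M_n}e^{(T-t)p^{2\beta}}\Big[\frac\pi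 n\sum_{k=1}^nf(x_k)\phi_p(x_k)\Big]\phi_p(x),$$ and for $f$ depending on $(x,t)$, $$\widetilde\Phi_{M_n,n}(f)(x,t)=\int_t^T\frac1n\sum_{k=1}^nf(x_k,s)\,ds+\sum_{p=1}^{M_n}\Big[\int_t^Te^{(s-t)p^{2\beta}}\Big(\frac\pi n\sum_{k=1}^nf(x_k,s)\phi_p(x_k)\Big)ds\Big]\phi_p(x).$$ *)

(* Defs.v *)
From mathcomp Require Import all_boot all_order all_algebra.
From mathcomp Require Import all_classical all_reals all_analysis.
Import Order.TTheory GRing.Theory Num.Theory numFieldNormedType.Exports.

Set Implicit Arguments.
Unset Strict Implicit.
Unset Printing Implicit Defensive.

Local Open Scope classical_set_scope.
Local Open Scope ring_scope.

(* Functions on (0, pi) and on (0, pi) x [0, T] are represented by total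
   functions R -> R and (time first) R -> R -> R; values outside the domain
   play no role, which is why L^2 objects go through the restriction
   [f \_ Omega].  Elements of L^2 are compared up to [ae_eq]. *)

Section L2.
Context {R : realType}.

Definition Omega : set R := `]0, pi[.

Definition L2Omega (f : R -> R) : Prop :=
  (f \_ Omega) \in Lfun lebesgue_measure 2%:E.

Definition normL2 (f : R -> R) : \bar R :=
  'N[lebesgue_measure]_2%:E[EFin \o (f \_ Omega)]%E.

Definition innerL2 (f h : R -> R) : R :=
  \int[lebesgue_measure]_(x in Omega) (f x * h x).

Definition C0L2 (T : R) (v : R -> R -> R) : Prop :=
  (forall t : R, t \in `[0, T] -> L2Omega (v t)) /\
  (forall t0 : R, t0 \in `[0, T] ->
     normL2 (v t \- v t0) @[t --> within `[0, T] (nbhs t0)] --> 0%E).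

Definition phi (p : nat) (x : R) : R :=
  if p == 0%N then (Num.sqrt pi)^-1 else Num.sqrt (2 / pi) * cos (p%:R * x).

Definition coef (p : nat) (f : R -> R) : R := innerL2 f (phi p).

(* eigenvalue p ^ (2 beta) of the fractional Neumann Laplacian; it is 0 for
   p = 0 since beta != 0 *)
Definition lam (beta : R) (p : nat) : R := p%:R `^ (2 * beta).

End L2.

Section FinalValueProblem.
Context {R : realType}.
Variables (T beta : R) (F : R -> R) (g : R -> R -> R) (uT : R -> R).

Definition is_solution (u : R -> R -> R) : Prop :=
  C0L2 T u /\
  forall p : nat,
    (forall t : R, t \in `]0, T[ ->
       derivable (fun s : R => coef p (u s)) t 1 /\
       derive1 (fun s : R => coef p (u s)) t + lam beta p * coef p (u t)
         = coef p (F \o u t) + coef p (g t)) /\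
    coef p (u T) = coef p uT.

Definition is_unique_solution (u : R -> R -> R) : Prop :=
  is_solution u /\
  forall v, is_solution v ->
    forall t : R, t \in `[0, T] -> ae_eq lebesgue_measure Omega (v t) (u t).

End FinalValueProblem.

Section Regularization.
Context {R : realType}.
Variables (T beta : R) (M n : nat).

(* x_k = pi (2 k - 1) / (2 n) for k = 1 .. n, with the index shifted to 0 .. n - 1 *)
Definition node (k : 'I_n) : R := pi * (2 * k + 1)%:R / (2 * n)%:R.

(* The two operators take the values of their argument at the nodes. *)
Definition Phi (f : 'I_n -> R) (t x : R) : R :=
  n%:R^-1 * (\sum_(k < n) f k) +
  \sum_(1 <= p < M.+1)
     expR ((T - t) * lam beta p) *
     (pi / n%:R * \sum_(k < n) f k * phi p (node k)) * phi p x.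

Definition Phit (f : 'I_n -> R -> R) (t x : R) : R :=
  \int[lebesgue_measure]_(s in `[t, T]) (n%:R^-1 * \sum_(k < n) f k s) +
  \sum_(1 <= p < M.+1)
     (\int[lebesgue_measure]_(s in `[t, T])
        (expR ((s - t) * lam beta p) *
         (pi / n%:R * \sum_(k < n) f k s * phi p (node k)))) * phi p x.

Definition is_regularized (F : R -> R) (uTobs : 'I_n -> R)
    (gobs : 'I_n -> R -> R) (U : R -> R -> R) : Prop :=
  C0L2 T U /\
  forall t : R, t \in `[0, T] ->
    ae_eq lebesgue_measure Omega (U t)
      (fun x => Phi uTobs t x - Phit gobs t x -
         \sum_(0 <= p < M.+1)
           (\int[lebesgue_measure]_(s in `[t, T])
              (expR ((s - t) * lam beta p) * coef p (F \o U s))) * phi p x).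

End Regularization.

Section Probability.
Context {R : realType} {d : measure_display} {W : measurableType d}.
Variable P : probability W R.

Definition mutually_independent (I : finType) (G : I -> set (set W)) : Prop :=
  forall (J : {set I}) (E : I -> set W), (forall i, G i (E i)) ->
    P (\bigcap_(i in [set i | i \in J]) E i) = (\prod_(i in J) P (E i))%E.

Definition sigma_rv (X : W -> R) : set (set W) :=
  preimage_set_system setT X measurable.

Definition sigma_process (T : R) (X : R -> W -> R) : set (set W) :=
  <<s \bigcup_(t in `[0, T]) sigma_rv (X t) >>.

Definition std_normal (X : {RV P >-> R}) : Prop :=
  forall A : set R, measurable A -> distribution P X A = normal_prob 0 1 A.

Definition std_brownian (T : R) (X : R -> {RV P >-> R}) : Prop :=
  [/\ {ae P, forall w, X 0 w = 0},
      forall s t : R, 0 <= s -> s < t -> t <= T ->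
        forall A : set R, measurable A ->
          pushforward P (X t \- X s) A
            = normal_prob 0 (Num.sqrt (t - s)) A,
      forall (m : nat) (t : nat -> R),
        (forall i, t i \in `[0, T]) -> {homo t : i j / (i <= j)%N >-> i <= j} ->
        mutually_independent
          (fun i : 'I_m => sigma_rv (fun w => X (t i.+1) w - X (t i) w)) &
      {ae P, forall w, {within `[0, T], continuous (fun t : R => X t w)}}].

End Probability.

(* Main.v *)
(* Fix a path of the noise.  Both the Fourier coefficients of u (Duhamel's formula)
   and those of U up to order M are given by backward integral formulas, so for
   p <= M the difference e_p solves a backward integral equation whose data are
   the sampling errors of u_T and g, the projected noise, and F_p(U) - F_p(u).
   Discrete orthogonality of the cosines at the midpoint nodes turns the sampling
   error of a function f into aliased coefficients, hence into O(S / n) for its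
   square, where S bounds the sum of q^2 f_q^2; for u_T this sum is controlled by
   the exponentially weighted one at t = T since q^2 T^2 <= exp(2 T q^(2 beta)).
   Testing against e / |e| and using Bessel's inequality and the Lipschitz
   condition, y(t) = exp(M^(2 beta) t) |U(t) - u(t)| satisfies
   y(t) <= A + K int_t^T y, and comparison with exp(3 K (T - t)) yields
   y <= (3/2) A exp(3 K (T - t)).  Finally E A^2 is estimated from the second
   moments of the Gaussian noise, which are sums over k by independence and
   symmetry. *)
From HB Require Import structures.
Require Import Defs.
From mathcomp Require Import all_boot all_order all_algebra.
From mathcomp Require Import all_classical all_reals all_analysis measurable_realfun.
From mathcomp Require Import ring lra zify.
Import Order.TTheory GRing.Theory Num.Theory numFieldNormedType.Exports.

Set Implicit Arguments.
Unset Strict Implicit.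
Unset Printing Implicit Defensive.

Local Open Scope classical_set_scope.
Local Open Scope ring_scope.

(** Three obstacles shape the proof. The constant is chosen from [u] before [g], [uT], [K] and the
    source bounds are given, so it can only use a bound on the exponentially weighted sums of [u]
    itself; if no such bound exists, both source conditions fail and any positive constant serves.
    The solution is known only through differential equations for its coefficients on the open time
    interval, whose right-hand sides need not be continuous, so Duhamel's formula rests on a
    fundamental theorem of calculus for a merely integrable derivative. Finally [U] is not assumed
    measurable in the noise, and the integral of the squared error is a supremum over simple
    functions below it; the error is therefore bounded path by path by a measurable expression in
    the noise, and only that expression is integrated. The sampling estimate and the passage from
    coefficients to the norm need completeness of the cosines, proved from Borel sets upward. As to
    constants, exp(3 K (T - t)) is the square root of the required exponential, and (3/2)^2 times 2
    times 4 equals 6 times 3. *)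

Section IntegrableReal.
Context d (X : measurableType d) (R : realType) (m : {measure set X -> \bar R}).
Variables (D : set X) (mD : measurable D).
Implicit Types f h : X -> R.

Lemma int_add f h : m.-integrable D (EFin \o f) -> m.-integrable D (EFin \o h) ->
  m.-integrable D (EFin \o (fun x => f x + h x)).
Proof. exact: integrableD. Qed.

Lemma int_opp f : m.-integrable D (EFin \o f) ->
  m.-integrable D (EFin \o (fun x => - f x)).
Proof. exact: integrableN. Qed.

Lemma int_sub f h : m.-integrable D (EFin \o f) -> m.-integrable D (EFin \o h) ->
  m.-integrable D (EFin \o (fun x => f x - h x)).
Proof. exact: integrableB. Qed.

Lemma int_mull a f : m.-integrable D (EFin \o f) ->
  m.-integrable D (EFin \o (fun x => a * f x)).
Proof. exact: integrableZl. Qed.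

Lemma int_mulr a f : m.-integrable D (EFin \o f) ->
  m.-integrable D (EFin \o (fun x => f x * a)).
Proof. exact: integrableZr. Qed.

Lemma int_sum I (s : seq I) (P : pred I) (f : I -> X -> R) :
  (forall i, P i -> m.-integrable D (EFin \o f i)) ->
  m.-integrable D (EFin \o (fun x => \sum_(i <- s | P i) f i x)).
Proof.
move=> fi; have := @integrable_sum _ _ _ m D mD I s P (fun i => EFin \o f i) fi.
by apply: eq_integrable => // x _ /=; rewrite sumEFin.
Qed.

Lemma int_meas f : m.-integrable D (EFin \o f) -> measurable_fun D f.
Proof. by move/measurable_int/measurable_EFinP. Qed.

Lemma int_le f h : measurable_fun D f -> m.-integrable D (EFin \o h) ->
  (forall x, D x -> `|f x| <= h x) -> m.-integrable D (EFin \o f).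
Proof.
move=> mf hi fh; apply: (le_integrable mD _ _ hi) => [|x Dx /=].
  exact/measurable_EFinP.
by rewrite lee_fin (le_trans (fh x Dx))// ler_norm.
Qed.

Lemma Rintegral_sum I (s : seq I) (P : pred I) (f : I -> X -> R) :
  (forall i, P i -> m.-integrable D (EFin \o f i)) ->
  \int[m]_(x in D) (\sum_(i <- s | P i) f i x) =
  \sum_(i <- s | P i) \int[m]_(x in D) f i x.
Proof.
move=> fi; elim: s => [|i s ih].
  under eq_Rintegral do rewrite big_nil.
  by rewrite big_nil /Rintegral integral0.
rewrite big_cons; case: ifPn => Pi; last first.
  by rewrite -ih; apply: eq_Rintegral => x _; rewrite big_cons (negbTE Pi).
rewrite -ih -RintegralD//; [|exact: fi|exact: int_sum].
by apply: eq_Rintegral => x _; rewrite big_cons Pi.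
Qed.

Lemma ae_eq_Rintegral f h : measurable_fun D f -> measurable_fun D h ->
  ae_eq m D f h -> \int[m]_(x in D) f x = \int[m]_(x in D) h x.
Proof.
move=> mf mh fh; congr fine; apply: ae_eq_integral => //; try exact/measurable_EFinP.
by apply: filterS fh => x /[apply] /= ->.
Qed.

End IntegrableReal.

(** * The inner product space L^2(0, pi) *)

(** A real-valued norm, so that ordered-field reasoning applies; [normL2E] identifies it with
    [normL2] on L^2. Locking keeps unification from unfolding it to the root of an integral. *)
HB.lock Definition nrmL2 {R : realType} (f : R -> R) : R := Num.sqrt (innerL2 f f).

Section SquareIntegrable.
Context {R : realType}.
Notation mu := (@lebesgue_measure R).
Implicit Types (f h k : R -> R) (c K : R).

Lemma measurable_Omega : measurable (Omega : set (measurableTypeR R)).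
Proof. exact: measurable_itv. Qed.
#[local] Hint Resolve measurable_Omega : core.

Lemma lebesgue_measure_Omega : mu (Omega : set R) = (pi : R)%:E.
Proof.
rewrite lebesgue_measure_itv/= lte_fin pi_gt0.
by rewrite oppr0 adde0.
Qed.

(** Extension by zero commutes with squaring, so membership is decided by the values on [Omega]
    alone. The closure properties of L^2 below go through this form. *)
Lemma L2OmegaP f : L2Omega f <->
  measurable_fun Omega f /\ mu.-integrable Omega (EFin \o (fun x => f x ^+ 2)).
Proof.
rewrite /L2Omega; split=> [fL|[mf fi]].
- have mf : measurable_fun Omega f.
    move: fL; rewrite inE => /andP[]; rewrite inE/= => + _.
    by move/(measurable_restrictT _ measurable_Omega).
  split=> //; have := Lfun2_integrable_sqr fL.
  have -> : (EFin \o (fun x => (f \_ Omega) x ^+ 2)) =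
      ((EFin \o (fun x => f x ^+ 2)) \_ Omega).
    by apply/funext => x; rewrite /= /patch; case: ifPn => // _; rewrite expr0n.
  by move=> h; apply/(integrable_mkcond _ measurable_Omega).
- rewrite inE; apply/andP; split; rewrite inE/=.
    exact/(measurable_restrictT _ measurable_Omega).
  rewrite /finite_norm unlock; apply: poweR_lty.
  have /integrable_lty : mu.-integrable setT ((EFin \o (fun x => f x ^+ 2)) \_ Omega).
    by apply/(integrable_mkcond _ measurable_Omega).
  move=> /(_ measurableT); apply: le_lt_trans.
  rewrite le_eqVlt; apply/orP; left; apply/eqP; apply: eq_integral => x _ /=.
  rewrite /patch; case: ifPn => _ /=; rewrite ?normr0 ?powR0//.
  by rewrite powR_mulrn// real_normK// num_real.
Qed.

Lemma L2Omega_measurable f : L2Omega f -> measurable_fun Omega f.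
Proof. by case/L2OmegaP. Qed.

Lemma L2Omega_mul_integrable f h : L2Omega f -> L2Omega h ->
  mu.-integrable Omega (EFin \o (fun x => f x * h x)).
Proof.
move=> /L2OmegaP[mf fi] /L2OmegaP[mh hi].
apply: (int_le _ _ (int_add _ fi hi)) => //; first exact: measurable_funM.
move=> x _; rewrite normrM -(real_normK (num_real (f x))) -(real_normK (num_real (h x))).
have := sqr_ge0 (`|f x| - `|h x|); have := normr_ge0 (f x); have := normr_ge0 (h x).
by nra.
Qed.

Lemma L2OmegaZ a f : L2Omega f -> L2Omega (fun x => a * f x).
Proof.
move=> /L2OmegaP[mf fi]; apply/L2OmegaP; split; first exact: measurable_funM.
have := int_mull measurable_Omega (a ^+ 2) fi.
by apply: eq_integrable => // x _ /=; rewrite exprMn.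
Qed.

Lemma L2OmegaD f h : L2Omega f -> L2Omega h -> L2Omega (fun x => f x + h x).
Proof.
move=> Lf Lh; have /L2OmegaP[mf fi] := Lf; have /L2OmegaP[mh hi] := Lh.
apply/L2OmegaP; split; first exact: measurable_funD.
have := int_add measurable_Omega (int_add measurable_Omega fi hi)
  (int_mull measurable_Omega 2 (L2Omega_mul_integrable Lf Lh)).
by apply: eq_integrable => // x _ /=; congr EFin; ring.
Qed.

Lemma L2OmegaB f h : L2Omega f -> L2Omega h -> L2Omega (fun x => f x - h x).
Proof.
move=> Lf Lh; have := L2OmegaD Lf (L2OmegaZ (-1) Lh).
by congr L2Omega; apply/funext => x; rewrite mulN1r.
Qed.

Lemma L2Omega_bounded f c : measurable_fun Omega f ->
  (forall x, Omega x -> `|f x| <= c) -> L2Omega f.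
Proof.
move=> mf fc; apply/L2OmegaP; split => //.
have : mu.-integrable Omega (EFin \o cst (c ^+ 2)).
  apply/integrableP; split; first by apply/measurable_EFinP.
  have -> : (fun x : R => `|(EFin \o cst (c ^+ 2)%R) x|)%E = cst (`|c ^+ 2|%R%:E) by [].
  rewrite integral_cst//.
  by rewrite [X in (_ * X)%E]lebesgue_measure_Omega -EFinM ltry.
move=> /int_le; apply => //; first exact: measurable_funX.
move=> x Ox /=; have := fc x Ox; rewrite normrX; have := normr_ge0 (f x).
by move=> ? ?; rewrite lerXn2r// nnegrE; lra.
Qed.

Lemma L2Omega0 : L2Omega (fun _ : R => 0 : R).
Proof. by apply: (@L2Omega_bounded _ 0) => // x _; rewrite normr0. Qed.

Lemma L2Omega_cst (c : R) : L2Omega (fun _ : R => c).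
Proof. by apply: (@L2Omega_bounded _ `|c|). Qed.

Lemma L2Omega_sum I (s : seq I) (P : pred I) (f : I -> R -> R) :
  (forall i, L2Omega (f i)) ->
  L2Omega (fun x => \sum_(i <- s | P i) f i x).
Proof.
move=> Lf; elim: s => [|i s ih].
  by under eq_fun do rewrite big_nil; exact: L2Omega0.
under eq_fun do rewrite big_cons; case: (P i) => //.
exact: L2OmegaD.
Qed.

Lemma lip_continuous (F : R -> R) K :
  (forall y z, `|F y - F z| <= K * `|y - z|) -> continuous F.
Proof.
move=> FK x; apply/cvgrPdist_le => e e0; near=> z.
have : `|x - z| <= e / (`|K| + 1).
  near: z; apply: (@cvgr_dist_le _ _ _ _ _ id x) => //.
  by rewrite divr_gt0// ltr_wpDl.
rewrite ler_pdivlMr ?ltr_wpDl// => h.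
have := FK x z; have := normr_ge0 (x - z); have := ler_norm K; nra.
Unshelve. all: by end_near. Qed.

Lemma L2Omega_lip (F : R -> R) K f :
  (forall y z, `|F y - F z| <= K * `|y - z|) -> L2Omega f -> L2Omega (F \o f).
Proof.
move=> FK Lf; have cF := lip_continuous FK.
have K0 : 0 <= K.
  by have := FK 1 0; rewrite subr0 normr1 mulr1; exact: le_trans.
have mFf : measurable_fun Omega (F \o f).
  by apply: measurableT_comp; [exact: continuous_measurable_fun|exact: L2Omega_measurable].
(* A Lipschitz function grows at most linearly, so this L^2 function dominates [F \o f]. *)
pose h x := `|F 0| + K * `|f x|.
have Lh : L2Omega h.
  apply: L2OmegaD; first exact: L2Omega_cst.
  apply: L2OmegaZ; case/L2OmegaP : Lf => mf fi; apply/L2OmegaP; split.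
    exact: measurableT_comp.
  by apply: eq_integrable fi => // x _ /=; rewrite real_normK// num_real.
apply/L2OmegaP; split=> //; case/L2OmegaP : Lh => mh hi.
apply: (int_le _ _ hi) => //; first exact: measurable_funX.
move=> x _; rewrite /= normrX lerXn2r ?nnegrE ?normr_ge0// /h.
  by rewrite addr_ge0// mulr_ge0.
have := FK (f x) 0; rewrite subr0.
have := ler_normB (F (f x) - F 0) (- F 0); rewrite opprK subrK normrN; lra.
Qed.

Lemma innerL2C f h : innerL2 f h = innerL2 h f.
Proof. by apply: eq_Rintegral => x _; rewrite mulrC. Qed.

Lemma innerL2Dl f h k : L2Omega f -> L2Omega h -> L2Omega k ->
  innerL2 (fun x => f x + h x) k = innerL2 f k + innerL2 h k.
Proof.
move=> Lf Lh Lk; rewrite /innerL2 -RintegralD//; try exact: L2Omega_mul_integrable.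
by apply: eq_Rintegral => x _; rewrite mulrDl.
Qed.

Lemma innerL2Zl a f k : L2Omega f -> L2Omega k ->
  innerL2 (fun x => a * f x) k = a * innerL2 f k.
Proof.
move=> Lf Lk; rewrite /innerL2 -RintegralZl//; last exact: L2Omega_mul_integrable.
by apply: eq_Rintegral => x _; rewrite mulrA.
Qed.

Lemma innerL2Bl f h k : L2Omega f -> L2Omega h -> L2Omega k ->
  innerL2 (fun x => f x - h x) k = innerL2 f k - innerL2 h k.
Proof.
move=> Lf Lh Lk; rewrite /innerL2 -RintegralB//; try exact: L2Omega_mul_integrable.
by apply: eq_Rintegral => x _; rewrite mulrBl.
Qed.

Lemma innerL2Dr f h k : L2Omega f -> L2Omega h -> L2Omega k ->
  innerL2 k (fun x => f x + h x) = innerL2 k f + innerL2 k h.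
Proof. by move=> *; rewrite innerL2C innerL2Dl// !(innerL2C k). Qed.

Lemma innerL2Zr a f k : L2Omega f -> L2Omega k ->
  innerL2 k (fun x => a * f x) = a * innerL2 k f.
Proof. by move=> *; rewrite innerL2C innerL2Zl// !(innerL2C k). Qed.

Lemma innerL2Br f h k : L2Omega f -> L2Omega h -> L2Omega k ->
  innerL2 k (fun x => f x - h x) = innerL2 k f - innerL2 k h.
Proof. by move=> *; rewrite innerL2C innerL2Bl// !(innerL2C k). Qed.

Lemma innerL2_suml I (s : seq I) (P : pred I) (f : I -> R -> R) k :
  (forall i, L2Omega (f i)) -> L2Omega k ->
  innerL2 (fun x => \sum_(i <- s | P i) f i x) k =
  \sum_(i <- s | P i) innerL2 (f i) k.
Proof.
move=> Lf Lk; rewrite /innerL2 -Rintegral_sum//; last first.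
  by move=> i _; exact: L2Omega_mul_integrable.
by apply: eq_Rintegral => x _; rewrite big_distrl.
Qed.

Lemma innerL2_ge0 f : 0 <= innerL2 f f.
Proof. by apply: Rintegral_ge0 => x _; rewrite -expr2 sqr_ge0. Qed.
#[local] Hint Extern 0 (is_true (0 <= innerL2 _ _)) => solve [apply: innerL2_ge0] : core.

Lemma innerL2_CS f h : L2Omega f -> L2Omega h ->
  innerL2 f h ^+ 2 <= innerL2 f f * innerL2 h h.
Proof.
move=> Lf Lh.
have key a : 0 <= innerL2 f f - 2 * a * innerL2 f h + a ^+ 2 * innerL2 h h.
  have := innerL2_ge0 (fun x => f x - a * h x).
  have La := L2OmegaZ a Lh.
  rewrite innerL2Bl ?innerL2Br ?innerL2Zl ?innerL2Zr//; last exact: L2OmegaB.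
  by rewrite (innerL2C h f); congr (_ <= _); ring.
have [h0|h0] := eqVneq (innerL2 h h) 0.
  rewrite h0 mulr0 exprn_even_le0//=; apply/eqP; apply: contrapT => /eqP f0.
  (* When [innerL2 h h] vanishes, [key] is affine in [a]; this choice of [a] would make its
     right-hand side equal to -1. *)
  have := key ((innerL2 f f + 1) / (2 * innerL2 f h)); rewrite h0 mulr0 addr0.
  have -> : 2 * ((innerL2 f f + 1) / (2 * innerL2 f h)) * innerL2 f h = innerL2 f f + 1.
    by field.
  lra.
have hp : 0 < innerL2 h h by rewrite lt_def h0 innerL2_ge0.
(* This is the minimiser of the quadratic in [key]. *)
have := key (innerL2 f h / innerL2 h h).
have -> : innerL2 f f - 2 * (innerL2 f h / innerL2 h h) * innerL2 f h +
  (innerL2 f h / innerL2 h h) ^+ 2 * innerL2 h h =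
  innerL2 f f - innerL2 f h ^+ 2 / innerL2 h h by field.
by rewrite subr_ge0 ler_pdivrMr.
Qed.

Lemma nrmL2_ge0 f : 0 <= nrmL2 f. Proof. by rewrite nrmL2.unlock sqrtr_ge0. Qed.
#[local] Hint Extern 0 (is_true (0 <= nrmL2 _)) => solve [apply: nrmL2_ge0] : core.

Lemma nrmL2_sqr f : nrmL2 f ^+ 2 = innerL2 f f.
Proof. by rewrite nrmL2.unlock sqr_sqrtr. Qed.

Lemma innerL2_le_nrm f h : L2Omega f -> L2Omega h ->
  `|innerL2 f h| <= nrmL2 f * nrmL2 h.
Proof.
move=> Lf Lh; rewrite -[leRHS]ger0_norm ?mulr_ge0//.
by rewrite -ler_sqr ?nnegrE// !real_normK ?num_real// exprMn !nrmL2_sqr innerL2_CS.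
Qed.

Lemma normL2E f : L2Omega f -> normL2 f = (nrmL2 f)%:E.
Proof.
move=> Lf; have fi := L2Omega_mul_integrable Lf Lf.
rewrite /normL2 unlock nrmL2.unlock /innerL2 /Rintegral.
have -> : (\int[mu]_x `|(EFin \o f \_ Omega) x| `^ 2 =
    \int[mu]_(x in Omega) (f x * f x)%:E)%E.
  rewrite [RHS]integral_mkcond; apply: eq_integral => x _ /=.
  rewrite /patch; case: ifPn => _ /=; rewrite ?normr0 ?powR0//.
  by rewrite powR_mulrn// real_normK// num_real.
rewrite -[X in (X `^ _)%E]fineK; last exact: integrable_fin_num.
by rewrite poweR_EFin powR12_sqrt// fine_ge0// integral_ge0// => x _; rewrite lee_fin -expr2 sqr_ge0.
Qed.

Lemma nrmL2_leD f h : L2Omega f -> L2Omega h ->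
  nrmL2 (fun x => f x + h x) <= nrmL2 f + nrmL2 h.
Proof.
move=> Lf Lh; rewrite -ler_sqr ?nnegrE ?addr_ge0// sqrrD !nrmL2_sqr.
have Lfh := L2OmegaD Lf Lh.
rewrite innerL2Dl// !innerL2Dr// (innerL2C h f).
have := innerL2_le_nrm Lf Lh; have := ler_norm (innerL2 f h); lra.
Qed.

Lemma nrmL2_distl f h : L2Omega f -> L2Omega h ->
  `|nrmL2 f - nrmL2 h| <= nrmL2 (fun x => f x - h x).
Proof.
move=> Lf Lh.
have h1 := nrmL2_leD (L2OmegaB Lf Lh) Lh.
have h2 := nrmL2_leD (L2OmegaB Lh Lf) Lf.
have e1 : (fun x => f x - h x + h x) = f by apply/funext => x; rewrite subrK.
have e2 : (fun x => h x - f x + f x) = h by apply/funext => x; rewrite subrK.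
have e3 : nrmL2 (fun x => h x - f x) = nrmL2 (fun x => f x - h x).
  by rewrite nrmL2.unlock; congr Num.sqrt; apply: eq_Rintegral => x _; ring.
rewrite e1 in h1; rewrite e2 e3 in h2.
by rewrite ler_norml; apply/andP; split; lra.
Qed.

Lemma innerL2_ae f f' h : L2Omega f -> L2Omega f' -> L2Omega h ->
  ae_eq mu Omega f f' -> innerL2 f h = innerL2 f' h.
Proof.
move=> /L2Omega_measurable mf /L2Omega_measurable mf' /L2Omega_measurable mh ff.
apply: ae_eq_Rintegral => //; try exact: measurable_funM.
by apply: filterS ff => x /[apply] ->.
Qed.

Lemma nrmL2_lip (F : R -> R) K f h :
  (forall y z, `|F y - F z| <= K * `|y - z|) -> L2Omega f -> L2Omega h ->
  nrmL2 (fun x => F (f x) - F (h x)) <= K * nrmL2 (fun x => f x - h x).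
Proof.
move=> FK Lf Lh.
have K0 : 0 <= K.
  by have := FK 1 0; rewrite subr0 normr1 mulr1; exact: le_trans.
have LF := L2OmegaB (L2Omega_lip FK Lf) (L2Omega_lip FK Lh).
have Lfh := L2OmegaB Lf Lh.
rewrite -ler_sqr ?nnegrE ?mulr_ge0// exprMn !nrmL2_sqr -innerL2Zl//.
apply: le_Rintegral => //; [exact: L2Omega_mul_integrable| |].
  by apply: L2Omega_mul_integrable => //; exact: L2OmegaZ.
move=> x _ /=; rewrite -mulrA -!expr2 -exprMn -real_normK ?num_real//.
rewrite -[leRHS]real_normK ?num_real// lerXn2r ?nnegrE//.
by rewrite normrM (ger0_norm K0).
Qed.

End SquareIntegrable.
#[global] Hint Resolve measurable_Omega : core.
#[global] Hint Extern 0 (is_true (0 <= innerL2 _ _)) => solve [apply: innerL2_ge0] : core.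
#[global] Hint Extern 0 (is_true (0 <= nrmL2 _)) => solve [apply: nrmL2_ge0] : core.

(** * The Neumann cosine system *)

Section CosineSystem.
Context {R : realType}.
Notation mu := (@lebesgue_measure R).

Lemma pi_neq0 : pi != 0 :> R.
Proof. by rewrite gt_eqF// pi_gt0. Qed.

Lemma FTC_is_derive (F f : R -> R) (a b : R) : a <= b ->
  (forall x : R, is_derive x 1 F (f x)) -> continuous f ->
  \int[mu]_(x in `[a, b]) f x = F b - F a.
Proof.
rewrite le_eqVlt => /predU1P[<- _ _|ab dF cf].
  by rewrite subrr set_itv1 Rintegral_set1.
have cF : continuous F.
  move=> x; apply: differentiable_continuous; apply/derivable1_diffP.
  exact: ex_derive.
rewrite /Rintegral (@continuous_FTC2 _ f F)//.
- exact: continuous_subspaceT.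
- split=> //.
  + by apply: cvg_at_right_filter; exact: cF.
  + by apply: cvg_at_left_filter; exact: cF.
- by move=> x _; rewrite derive1E; exact: (@derive_val _ _ _ _ _ _ _ (dF x)).
Qed.

Lemma sin_natpi (k : nat) : sin (k%:R * pi) = 0 :> R.
Proof.
elim: k => [|k ih]; first by rewrite mul0r sin0.
by rewrite -natr1 mulrDl mul1r sinDpi ih oppr0.
Qed.

Lemma continuous_cosM (a : R) : continuous (fun x => cos (a * x)).
Proof.
move=> x; apply: (@continuous_comp _ _ _ (fun x => a * x) cos); last exact: continuous_cos.
by apply: cvgM => //; exact: cvg_cst.
Qed.

Lemma integrable_continuous_Omega (f : R -> R) : continuous f ->
  mu.-integrable Omega (EFin \o f).
Proof.
move=> cf; have : mu.-integrable `[0, pi] (EFin \o f).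
  apply: continuous_compact_integrable; first exact: segment_compact.
  exact: continuous_subspaceT.
apply: integrableS => //; exact: subset_itv_oo_cc.
Qed.

Lemma Rintegral_Omega_cc (f : R -> R) : continuous f ->
  \int[mu]_(x in Omega) f x = \int[mu]_(x in `[0, pi]) f x.
Proof.
move=> cf; rewrite Rintegral_itv_bndo_bndc.
  rewrite Rintegral_itv_obnd_cbnd//.
  have : mu.-integrable `[0, pi] (EFin \o f).
    apply: continuous_compact_integrable; first exact: segment_compact.
    exact: continuous_subspaceT.
  apply: integrableS => //; exact: subset_itv_oc_cc.
exact: integrable_continuous_Omega.
Qed.

Lemma integral_cos_nat (k : nat) :
  \int[mu]_(x in Omega) cos (k%:R * x) = (k == 0%N)%:R * pi.
Proof.
rewrite (@Rintegral_Omega_cc (fun x => cos (k%:R * x))); last exact: continuous_cosM.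
case: k => [|k].
  under eq_Rintegral do rewrite mul0r cos0.
  rewrite Rintegral_cst//= lebesgue_measure_itv/= lte_fin pi_gt0/=.
  by rewrite oppr0 addr0.
have dF (x : R) : is_derive x 1 (fun x : R => k.+1%:R^-1 * sin (k.+1%:R * x))
    (cos (k.+1%:R * x)).
  apply: is_derive_eq; rewrite /GRing.scale/= mulr1 mulrC -mulrA.
  by rewrite mulfV ?mulr1// pnatr_eq0.
rewrite (FTC_is_derive (@pi_ge0 R) dF (@continuous_cosM _)).
by rewrite mulr0 sin0 sin_natpi !mulr0 subrr mul0r.
Qed.

Lemma cosM_cos (a b : R) : cos a * cos b = 2^-1 * (cos (a - b) + cos (a + b)).
Proof. by rewrite cosB cosD; field. Qed.

(** With truncated subtraction [(p - q) + (q - p)] is the distance of [p] and [q]. Keeping the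
    frequency a natural number makes [integral_cos_nat] and [sum_cos_node] applicable. *)
Lemma natr_dist (p q : nat) (x : R) :
  cos (p%:R * x - q%:R * x) = cos (((p - q) + (q - p))%N%:R * x).
Proof.
have [pq|/ltnW qp] := leqP p q.
  rewrite (eqP pq) add0n natrB// -cosN; congr cos; ring.
by rewrite (eqP qp) addn0 natrB//; congr cos; ring.
Qed.

Definition nphi (p : nat) : R := if p == 0%N then (Num.sqrt pi)^-1 else Num.sqrt (2 / pi).

Lemma phiE p (x : R) : phi p x = nphi p * cos (p%:R * x).
Proof.
rewrite /phi /nphi; case: eqP => // ->.
by rewrite mul0r cos0 mulr1.
Qed.

Lemma nphi_sqr p : nphi p ^+ 2 = (if p == 0%N then 1 else 2) / pi.
Proof.
rewrite /nphi; case: eqP => _.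
  by rewrite exprVn sqr_sqrtr ?pi_ge0// div1r.
by rewrite sqr_sqrtr// divr_ge0// pi_ge0.
Qed.

Lemma nphi_gt0 p : 0 < nphi p.
Proof.
by rewrite /nphi; case: eqP => _; rewrite ?invr_gt0 sqrtr_gt0 ?divr_gt0 ?pi_gt0.
Qed.

Lemma continuous_phi p : continuous (phi p : R -> R).
Proof.
have -> : phi p = (fun x => nphi p * cos (p%:R * x)).
  by apply/funext => x; exact: phiE.
by move=> x; apply: cvgM; [exact: cvg_cst|exact: continuous_cosM].
Qed.

Lemma phi_sqr_le p (x : R) : phi p x ^+ 2 <= 2 / pi.
Proof.
rewrite phiE exprMn nphi_sqr.
have c1 : cos (p%:R * x) ^+ 2 <= 1.
  by rewrite -(real_normK (num_real _)) expr_le1// ?cos_max.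
have pi0 : 0 < pi^-1 :> R by rewrite invr_gt0 pi_gt0.
by case: eqP => _; have := sqr_ge0 (cos (p%:R * x)); nra.
Qed.

Lemma phi_le p (x : R) : `|phi p x| <= 1.
Proof.
rewrite -(@expr_le1 _ 2)// real_normK ?num_real// (le_trans (phi_sqr_le _ _))//.
by rewrite ler_pdivrMr ?pi_gt0// mul1r pi_ge2.
Qed.

Lemma measurable_phi p (D : set R) : measurable_fun D (phi p).
Proof.
by apply: measurable_funTS; apply: continuous_measurable_fun; exact: continuous_phi.
Qed.

Lemma L2Omega_phi p : L2Omega (phi p : R -> R).
Proof.
apply: (@L2Omega_bounded _ _ 1); first exact: measurable_phi.
by move=> x _; exact: phi_le.
Qed.

Lemma phi_ortho p q : innerL2 (phi p) (phi q) = (p == q)%:R :> R.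
Proof.
have e (x : R) : phi p x * phi q x = nphi p * nphi q * 2^-1 *
    cos (((p - q) + (q - p))%N%:R * x) + nphi p * nphi q * 2^-1 * cos ((p + q)%N%:R * x).
  by rewrite !phiE -natr_dist natrD mulrDl mulrACA cosM_cos; ring.
rewrite /innerL2; under eq_Rintegral do rewrite e.
have ic (k : nat) : mu.-integrable Omega (EFin \o (fun x => cos (k%:R * x))).
  by apply: integrable_continuous_Omega; exact: continuous_cosM.
rewrite RintegralD//; try exact: int_mull.
rewrite !RintegralZl// !integral_cos_nat !addn_eq0 !subn_eq0 -eqn_leq.
have [->|pq] := eqVneq p q.
  rewrite /= andbb -expr2 nphi_sqr; case: eqP => _ /=.
    by move: pi_neq0; generalize (@pi R) => c hc; field; rewrite ?hc ?n0'.
  by move: pi_neq0; generalize (@pi R) => c hc; field; rewrite ?hc ?n0'.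
have -> : ((p == 0%N) && (q == 0%N)) = false.
  by apply/negbTE; apply: contra pq => /andP[/eqP-> /eqP->].
by rewrite !mul0r !mulr0 addr0.
Qed.

(** The nodes are odd multiples of pi / (2 n). Multiplying by 2 sin(h) with h = j pi / (2 n) makes
    the sum telescope to sin(j pi) = 0, and 0 < j < 2 n ensures sin(h) > 0. *)
Lemma sum_cos_node n j : (0 < j < 2 * n)%N ->
  \sum_(k < n) cos (j%:R * node k) = 0 :> R.
Proof.
move=> /andP[j0 jn].
have n0 : (0 < n)%N by lia.
have n0' : (n%:R : R) != 0 by rewrite pnatr_eq0 -lt0n.
pose h : R := j%:R * pi / (2 * n)%:R.
have hpos : 0 < sin h.
  apply: sin_gt0_pi; rewrite /h divr_gt0 ?mulr_gt0 ?ltr0n ?pi_gt0 ?muln_gt0//=.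
  rewrite mulrAC gtr_pMl ?pi_gt0// ltr_pdivrMr ?ltr0n ?muln_gt0// mul1r ltr_nat//.
have step (k : nat) : 2 * sin h * cos (j%:R * (pi * (2 * k + 1)%:R / (2 * n)%:R)) =
    sin (k.+1%:R * (2 * h)) - sin (k%:R * (2 * h)).
  have -> : j%:R * (pi * (2 * k + 1)%:R / (2 * n)%:R) = (2 * k + 1)%:R * h.
    by rewrite /h; ring.
  have -> : k.+1%:R * (2 * h) = (2 * k + 1)%:R * h + h.
    by rewrite -natr1 natrD natrM; ring.
  have -> : k%:R * (2 * h) = (2 * k + 1)%:R * h - h.
    by rewrite natrD natrM; ring.
  by rewrite sinD sinB; ring.
have : 2 * sin h * \sum_(k < n) cos (j%:R * node k) = 0.
  rewrite big_distrr/=; under eq_bigr do rewrite /node step.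
  rewrite -(big_mkord xpredT (fun k => sin (k.+1%:R * (2 * h)) - sin (k%:R * (2 * h)))).
  rewrite telescope_sumr// mul0r sin0 subr0.
  have -> : n%:R * (2 * h) = j%:R * pi.
    by rewrite /h natrM; field; rewrite n0'.
  exact: sin_natpi.
by move/eqP; rewrite mulf_eq0 mulf_eq0 pnatr_eq0/= gt_eqF//= => /eqP.
Qed.

(** For p, q < n both |p - q| and p + q lie below 2 n, so after the product-to-sum formula only a
    zero frequency contributes, with the value n. *)
Lemma discrete_ortho n p q : (p < n)%N -> (q < n)%N ->
  pi / n%:R * (\sum_(k < n) phi p (node k) * phi q (node k)) = (p == q)%:R :> R.
Proof.
move=> pn qn; have n0' : (n%:R : R) != 0 by rewrite pnatr_eq0 -lt0n; lia.
have e (x : R) : phi p x * phi q x = nphi p * nphi q * 2^-1 *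
    cos (((p - q) + (q - p))%N%:R * x) + nphi p * nphi q * 2^-1 * cos ((p + q)%N%:R * x).
  by rewrite !phiE -natr_dist natrD mulrDl mulrACA cosM_cos; ring.
under eq_bigr do rewrite e.
rewrite big_split/= -!big_distrr/=.
have s0 : \sum_(i < n) cos (0%N%:R * node i) = n%:R :> R.
  by under eq_bigr do rewrite mul0r cos0; rewrite sumr_const card_ord.
have [<-|pq] := eqVneq p q.
  rewrite !subnn addn0 s0; have [->|p0] := eqVneq p 0%N.
    rewrite addn0 s0 -expr2 nphi_sqr eqxx/=.
    by move: pi_neq0; generalize (@pi R) => c hc; field; rewrite ?hc ?n0'.
  rewrite sum_cos_node; last by lia.
  rewrite -expr2 nphi_sqr (negbTE p0)/= mulr0 addr0.
  by move: pi_neq0; generalize (@pi R) => c hc; field; rewrite ?hc ?n0'.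
rewrite !sum_cos_node ?mulr0 ?addr0 ?mulr0//.
  by move/eqP: pq => pq; lia.
by move/eqP: pq => pq; lia.
Qed.

Lemma node_Omega n (k : 'I_n) : Omega (node k : R).
Proof.
have n0 : (0 < n)%N by case: n k => // -[].
rewrite /Omega/= in_itv/=; apply/andP; split.
  by rewrite divr_gt0 ?mulr_gt0 ?pi_gt0 ?ltr0n// ?muln_gt0//; lia.
rewrite /node ltr_pdivrMr ?ltr0n ?muln_gt0// ltr_pM2l ?pi_gt0// ltr_nat.
by have := ltn_ord k; lia.
Qed.

End CosineSystem.
#[global] Hint Resolve L2Omega_phi : core.

(** * Completeness of the cosine system and Parseval's identity *)

Section CosineCompleteness.
Context {R : realType}.
Notation mu := (@lebesgue_measure R).
Implicit Types (f h k : R -> R) (e : R).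

Definition psum (N : nat) f : R -> R := fun x => \sum_(0 <= p < N) coef p f * phi p x.

Lemma L2Omega_psum N f : L2Omega (psum N f).
Proof. by apply: L2Omega_sum => p; apply: L2OmegaZ. Qed.
#[local] Hint Resolve L2Omega_psum : core.

Lemma coef_sum N (c : nat -> R) q :
  coef q (fun x => \sum_(0 <= p < N) c p * phi p x) = if (q < N)%N then c q else 0.
Proof.
rewrite /coef innerL2_suml//; last by move=> p; exact: L2OmegaZ.
under eq_bigr do rewrite innerL2Zl// phi_ortho.
case: ifPn => qN.
  rewrite (@big_cat_nat _ _ _ q)//=; last exact: ltnW.
  rewrite (@big_ltn _ _ _ q)//= eqxx mulr1 big_nat_cond big1.
    rewrite big_nat_cond big1 ?add0r ?addr0// => i /andP[/andP[qi _] _].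
    by rewrite gtn_eqF ?mulr0.
  by move=> i /andP[/andP[_ iq] _]; rewrite ltn_eqF ?mulr0.
rewrite big_nat_cond big1// => i /andP[/andP[_ iN] _].
by rewrite ltn_eqF ?mulr0// (leq_trans iN)// leqNgt.
Qed.

(** Pythagoras: the partial sum is the orthogonal projection. Bessel's inequality and the fact that
    taking residuals does not increase the norm both follow from it. *)
Lemma nrm_resid N f : L2Omega f ->
  nrmL2 (fun x => f x - psum N f x) ^+ 2 =
  innerL2 f f - \sum_(0 <= p < N) coef p f ^+ 2.
Proof.
move=> Lf; rewrite nrmL2_sqr.
have Lr := L2OmegaB Lf (L2Omega_psum N f).
have e h : L2Omega h -> innerL2 (psum N f) h = \sum_(0 <= p < N) coef p f * coef p h.
  move=> Lh; rewrite innerL2_suml//; last by move=> p; exact: L2OmegaZ.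
  by apply: eq_bigr => p _; rewrite innerL2Zl// innerL2C.
rewrite innerL2Bl// !innerL2Br// (innerL2C f (psum N f)) !e//.
have -> : \sum_(0 <= p < N) coef p f * coef p (psum N f) = \sum_(0 <= p < N) coef p f ^+ 2.
  by apply: eq_big_nat => p /andP[_ pN]; rewrite coef_sum pN expr2.
under [X in _ - X - _]eq_bigr do rewrite -expr2.
by ring.
Qed.

Lemma bessel N f : L2Omega f -> \sum_(0 <= p < N) coef p f ^+ 2 <= innerL2 f f.
Proof. by move=> Lf; rewrite -subr_ge0 -nrm_resid// sqr_ge0. Qed.

Lemma nrm_resid_le N f : L2Omega f -> nrmL2 (fun x => f x - psum N f x) <= nrmL2 f.
Proof.
move=> Lf; rewrite -ler_sqr ?nnegrE//.
by rewrite (nrm_resid N Lf) nrmL2_sqr gerBl sumr_ge0// => p _; exact: sqr_ge0.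
Qed.

(** The functions whose cosine expansion converges to them in L^2. They form a closed linear
    subspace, and completeness means that it is all of L^2. *)
Definition cosclosure f := L2Omega f /\
  forall e, 0 < e -> exists N0, forall N, (N0 <= N)%N ->
    nrmL2 (fun x => f x - psum N f x) <= e.

Lemma psumD N f h : L2Omega f -> L2Omega h ->
  psum N (fun x => f x + h x) = (fun x => psum N f x + psum N h x).
Proof.
move=> Lf Lh; apply/funext => x; rewrite /psum -big_split/=.
by apply: eq_bigr => p _; rewrite /coef innerL2Dl// mulrDl.
Qed.

Lemma psumZ N a f : L2Omega f -> psum N (fun x => a * f x) = (fun x => a * psum N f x).
Proof.
move=> Lf; apply/funext => x; rewrite /psum big_distrr/=.
by apply: eq_bigr => p _; rewrite /coef innerL2Zl// mulrA.
Qed.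

Lemma eq_nrmL2 f h : (forall x, Omega x -> f x = h x) -> nrmL2 f = nrmL2 h.
Proof.
move=> fh; rewrite nrmL2.unlock; congr Num.sqrt; apply: eq_Rintegral => x /set_mem Ox.
by rewrite fh.
Qed.

Lemma nrmL2Z a f : L2Omega f -> nrmL2 (fun x => a * f x) = `|a| * nrmL2 f.
Proof.
move=> Lf; rewrite nrmL2.unlock innerL2Zl ?innerL2Zr//; last exact: L2OmegaZ.
by rewrite mulrA -expr2 sqrtrM ?sqr_ge0// sqrtr_sqr.
Qed.

Lemma cosclosureD f h : cosclosure f -> cosclosure h -> cosclosure (fun x => f x + h x).
Proof.
move=> [Lf cf] [Lh ch]; split; first exact: L2OmegaD.
move=> e e0; have e2 : 0 < e / 2 by rewrite divr_gt0.
have [N1 h1] := cf _ e2; have [N2 h2] := ch _ e2.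
exists (maxn N1 N2) => N; rewrite geq_max => /andP[/h1 {}h1 /h2 {}h2].
rewrite psumD// (@eq_nrmL2 _ (fun x => (f x - psum N f x) + (h x - psum N h x))).
  rewrite (le_trans (nrmL2_leD _ _))//; [exact: L2OmegaB|exact: L2OmegaB|].
  by rewrite (splitr e) lerD.
by move=> x _; ring.
Qed.

Lemma cosclosureZ a f : cosclosure f -> cosclosure (fun x => a * f x).
Proof.
move=> [Lf cf]; split; first exact: L2OmegaZ.
move=> e e0; have a0 : 0 < `|a| + 1 by rewrite ltr_wpDl.
have [|N1 h1] := cf (e / (`|a| + 1)); first by rewrite divr_gt0.
exists N1 => N /h1; rewrite psumZ//.
rewrite (@eq_nrmL2 (fun x => a * f x - _) (fun x => a * (f x - psum N f x))).
  rewrite nrmL2Z; last exact: L2OmegaB.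
  rewrite ler_pdivlMr// => h2; apply: le_trans h2.
  by rewrite mulrC; apply: ler_wpM2l => //; rewrite lerDl.
by move=> x _; ring.
Qed.

(** The residual of f is at most that of h plus that of f - h, and the latter is no larger than the
    norm of f - h, uniformly in [N]. *)
Lemma cosclosure_lim f : L2Omega f ->
  (forall e, 0 < e -> exists2 h, cosclosure h & nrmL2 (fun x => f x - h x) <= e) ->
  cosclosure f.
Proof.
move=> Lf H; split=> // e e0; have e2 : 0 < e / 2 by rewrite divr_gt0.
have [h [Lh ch] fh] := H _ e2; have [N1 h1] := ch _ e2.
have Lk := L2OmegaB Lf Lh.
exists N1 => N /h1 {}h1.
have -> : f = (fun x => (f x - h x) + h x) by apply/funext => x; rewrite subrK.
rewrite psumD//.
rewrite (@eq_nrmL2 _ (fun x => ((f x - h x) - psum N (fun x => f x - h x) x) +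
    (h x - psum N h x))); last by move=> x _; ring.
rewrite (le_trans (nrmL2_leD _ _))//; [exact: L2OmegaB|exact: L2OmegaB|].
by rewrite (splitr e) lerD// (le_trans (nrm_resid_le N Lk)).
Qed.

Lemma eq_L2Omega f h : (forall x, Omega x -> f x = h x) -> L2Omega f -> L2Omega h.
Proof.
move=> fh; rewrite /L2Omega; suff -> : f \_ Omega = h \_ Omega by [].
by apply/funext => x; rewrite /patch; case: ifPn => // /set_mem /fh.
Qed.

Lemma eq_cosclosure f h : (forall x, Omega x -> f x = h x) -> cosclosure f -> cosclosure h.
Proof.
move=> fh cf; have Lf := cf.1; apply: cosclosure_lim; first exact: eq_L2Omega Lf.
move=> e e0; exists f => //; rewrite (@eq_nrmL2 _ (fun x => 0 * f x)).
  by rewrite nrmL2Z// normr0 mul0r ltW.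
by move=> x Ox; rewrite fh// subrr mul0r.
Qed.

Lemma cosclosure0 : cosclosure (fun _ => 0).
Proof.
split; first exact: L2Omega0.
move=> e e0; exists 0%N => N _; rewrite (le_trans (nrm_resid_le _ _))//.
  exact: L2Omega0.
rewrite nrmL2.unlock /innerL2; under eq_Rintegral do rewrite mul0r.
by rewrite Rintegral_cst// mul0r sqrtr0 ltW.
Qed.

Lemma cosclosure_sum I (s : seq I) (P : pred I) (F : I -> R -> R) :
  (forall i, cosclosure (F i)) -> cosclosure (fun x => \sum_(i <- s | P i) F i x).
Proof.
move=> cF; elim: s => [|i s ih].
  by under eq_fun do rewrite big_nil; exact: cosclosure0.
case Pi: (P i); under eq_fun do rewrite big_cons Pi; last exact: ih.
exact: cosclosureD (cF i) ih.
Qed.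

Lemma cosclosure_phi p : cosclosure (phi p).
Proof.
split=> // e e0; exists p.+1 => N pN.
rewrite (@eq_nrmL2 _ (fun x => 0 * phi p x)); first by rewrite nrmL2Z// normr0 mul0r ltW.
move=> x _; rewrite mul0r; apply/eqP; rewrite subr_eq0; apply/eqP; rewrite /psum.
under eq_bigr do rewrite /coef phi_ortho.
rewrite (@big_cat_nat _ _ _ p)//=; last exact: ltnW.
rewrite (@big_ltn _ _ _ p)//= eqxx mul1r big_nat_cond big1.
  rewrite big_nat_cond big1 ?add0r ?addr0// => i /andP[/andP[qi _] _].
  by rewrite ltn_eqF ?mul0r.
by move=> i /andP[/andP[_ iq] _]; rewrite gtn_eqF ?mul0r.
Qed.

Lemma cosclosure_cosnat p : cosclosure (fun x => cos (p%:R * x)).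
Proof.
apply: (@eq_cosclosure (fun x => (nphi p)^-1 * phi p x)).
  by move=> x _; rewrite phiE mulKf// gt_eqF// nphi_gt0.
exact/cosclosureZ/cosclosure_phi.
Qed.

Lemma cosclosure_cos_phi p : cosclosure (fun x => cos x * phi p x).
Proof.
apply: (@eq_cosclosure (fun x => nphi p * (2^-1 *
    (* The lower frequency is |p - 1|, which is 1 for p = 0. *)
    (cos ((p.-1 + (p == 0))%N%:R * x) + cos (p.+1%:R * x))))).
  move=> x _; rewrite phiE [RHS]mulrC -mulrA cosM_cos.
  congr (_ * (_ * _)); congr (_ + _).
    case: p => [|p]/=; first by rewrite add0n mul1r mul0r sub0r cosN.
    by rewrite addn0 -natr1; congr cos; ring.
  by rewrite -natr1; congr cos; ring.
by do 2 apply: cosclosureZ; apply: cosclosureD; exact: cosclosure_cosnat.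
Qed.

(** Multiplication by cos sends each mode to a combination of neighbouring modes and does not
    increase the L^2 norm, so it preserves the closed span. Polynomials in cos x are reached from
    constants this way. *)
Lemma cosclosureM_cos f : cosclosure f -> cosclosure (fun x => cos x * f x).
Proof.
have Lcos h : L2Omega h -> L2Omega (fun x => cos x * h x).
  move=> Lh; have /L2OmegaP[mh hi] := Lh; apply/L2OmegaP.
  have m : measurable_fun Omega (fun x => cos x * h x).
    apply: measurable_funM => //; apply: measurable_funTS.
    by apply: continuous_measurable_fun; exact: continuous_cos.
  split=> //; apply: (int_le _ _ hi) => //; first exact: measurable_funX.
  move=> x _; rewrite /= normrX normrM exprMn.
  rewrite -[leRHS]mul1r (real_normK (num_real (h x))) ler_wpM2r ?sqr_ge0//.
  by rewrite expr_le1// cos_max.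
move=> [Lf cf]; apply: cosclosure_lim; first exact: Lcos.
move=> e e0; have [N /(_ N (leqnn _)) fN] := cf _ e0.
exists (fun x => cos x * psum N f x).
  apply: (@eq_cosclosure (fun x => \sum_(0 <= p < N) coef p f * (cos x * phi p x))).
    by move=> x _; rewrite big_distrr/=; apply: eq_bigr => p _; rewrite mulrCA.
  by apply: cosclosure_sum => p; apply: cosclosureZ; exact: cosclosure_cos_phi.
apply: le_trans fN; rewrite (@eq_nrmL2 _ (fun x => cos x * (f x - psum N f x))).
  have Lr := L2OmegaB Lf (L2Omega_psum N f); have Lcr := Lcos _ Lr.
  rewrite nrmL2.unlock ler_wsqrtr//; apply: le_Rintegral => //; try exact: L2Omega_mul_integrable.
  move=> x _; rewrite mulrACA -!expr2 -[leRHS]mul1r ler_wpM2r ?sqr_ge0//.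
by move=> x _; rewrite mulrBr.
Qed.

Lemma cosclosure_poly (P : {poly R}) : cosclosure (fun x => P.[cos x]).
Proof.
elim/poly_ind: P => [|P c ih].
  by under eq_fun do rewrite horner0; exact: cosclosure0.
apply: (@eq_cosclosure (fun x => cos x * P.[cos x] + c * cos (0%:R * x))).
  by move=> x _; rewrite hornerMXaddC mul0r cos0 mulr1 mulrC.
by apply: cosclosureD; [exact: cosclosureM_cos|exact/cosclosureZ/cosclosure_cosnat].
Qed.

Lemma L2_dominated (f_ : nat -> R -> R) f h : L2Omega h ->
  (forall n, measurable_fun Omega (f_ n)) -> measurable_fun Omega f ->
  (forall n x, Omega x -> `|f_ n x| <= h x) -> (forall x, Omega x -> `|f x| <= h x) ->
  {ae mu, forall x, Omega x -> f_ ^~ x @ \oo --> f x} ->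
  forall e, 0 < e -> exists n, nrmL2 (fun x => f x - f_ n x) <= e.
Proof.
move=> Lh mf_ mf f_h fh f_f e e0.
(* Since |f - f_n| is at most 2 h, the squared differences are dominated by 4 h^2. *)
have ih := int_mull measurable_Omega 4 (L2Omega_mul_integrable Lh Lh).
have := @dominated_convergence _ _ _ mu Omega measurable_Omega
  (fun n x => ((f x - f_ n x) * (f x - f_ n x))%:E) (cst 0%E) _ _ _ _ ih.
case.
- by move=> n; apply/measurable_EFinP; apply: (@measurable_funM _ _ _ _ (fun x => f x - f_ n x)); exact: measurable_funB.
- exact: measurable_cst.
- apply: (@filterS _ _ (ae_filter_ringOfSetsType mu) _ _ _ f_f) => x H Ox; apply: cvg_EFin; first exact: nearW.
  rewrite (_ : fine \o _ = fun n => (f x - f_ n x) * (f x - f_ n x))//.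
  have H1 : f x - f_ n x @[n --> \oo] --> f x - f x.
    by apply: cvgB; [exact: cvg_cst|exact: H].
  by rewrite subrr in H1; have H2 := cvgM H1 H1; rewrite mulr0 in H2; exact: H2.
- apply: aeW => x n Ox; rewrite lee_fin.
  have := f_h n x Ox; have := fh x Ox; rewrite !ler_norml => /andP[? ?] /andP[? ?].
  by apply/andP; split; nra.
move=> _ _; rewrite integral0 => /fine_cvgP[_ /cvgrPdist_le/(_ (e ^+ 2))].
rewrite exprn_gt0// => /(_ isT)[n _ /(_ n (leqnn n))] /=.
rewrite sub0r normrN => H; exists n.
rewrite -ler_sqr ?nnegrE ?(ltW e0)// nrmL2_sqr; apply: le_trans H.
exact: ler_norm.
Qed.

Lemma bernoulli_le (a : R) n : 0 <= a <= 1 -> 1 - n%:R * a <= (1 - a) ^+ n.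
Proof.
move=> /andP[a0 a1]; elim: n => [|n ih]; first by rewrite mul0r subr0 expr0.
rewrite exprS -natr1; have h : 0 <= (n%:R : R) by [].
have : (1 - a) * (1 - n%:R * a) <= (1 - a) * (1 - a) ^+ n by rewrite ler_wpM2l// subr_ge0.
by apply: le_trans; nra.
Qed.

(** The division-free form of (1 - a)^n <= 1 / (1 + n a). The two Bernoulli bounds decide the limits
    below and above the threshold of the step polynomials. *)
Lemma bernoulli_ge (a : R) n : 0 <= a <= 1 -> (1 - a) ^+ n * (1 + n%:R * a) <= 1.
Proof.
move=> /andP[a0 a1]; elim: n => [|n ih]; first by rewrite mul0r addr0 expr0 mulr1.
rewrite exprS -natr1; have h : 0 <= (n%:R : R) by [].
have p0 : 0 <= (1 - a) ^+ n by rewrite exprn_ge0// subr_ge0.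
apply: le_trans ih; rewrite mulrAC mulrC ler_wpM2l//; nra.
Qed.

(* With z = (1 + cos x) / 2 and c the value of z at a, the polynomials
   (1 - z^m)^(c^-m) in cos x converge boundedly to the indicator of x > a. *)
Definition step_exp (c : R) (m : nat) : nat := (Num.truncn (c ^- m)).+1.

Lemma step_exp_bounds (c : R) m : 0 < c ->
  c ^- m <= (step_exp c m)%:R <= c ^- m + 1.
Proof.
move=> c0; have h0 : 0 <= c ^- m by rewrite invr_ge0 exprn_ge0// ltW.
have /andP[h1 h2] := truncn_itv h0.
by rewrite /step_exp (ltW h2)/= -natr1 lerD2r.
Qed.

(** Bernoulli bounds the power below by 1 - N z^m, and N <= c^-m + 1 turns the deficit into (z /
    c)^m + z^m, which tends to 0. *)
Lemma cvg_step_lt (c z : R) : 0 <= z -> z < c -> c < 1 ->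
  (1 - z ^+ m) ^+ step_exp c m @[m --> \oo] --> (1 : R).
Proof.
move=> z0 zc c1; have c0 : 0 < c by exact: le_lt_trans zc.
have z1 : z <= 1 by rewrite ltW// (lt_trans zc).
apply: (squeeze_cvgr (f := fun m => 1 - ((z / c) ^+ m + z ^+ m)) (h := fun=> 1)).
- apply: nearW => m.
  have a01 : 0 <= z ^+ m <= 1 by rewrite exprn_ge0//= exprn_ile1.
  have /andP[a0 a1] := a01.
  have /andP[_ h2] := step_exp_bounds m c0.
  apply/andP; split; last by rewrite exprn_ile1// ?subr_ge0// gerBl.
  rewrite (le_trans _ (bernoulli_le _ a01))// lerD2l lerN2.
  have := ler_wpM2r a0 h2; rewrite mulrDl mul1r.
  by rewrite expr_div_n [z ^+ m / _]mulrC.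
- have h : (z / c) ^+ m + z ^+ m @[m --> \oo] --> (0 + 0 : R).
    apply: cvgD; apply: cvg_expr.
      by rewrite ger0_norm ?divr_ge0 ?(ltW c0)// ltr_pdivrMr// mul1r.
    by rewrite ger0_norm// (lt_trans zc).
  have h1 : 1 - ((z / c) ^+ m + z ^+ m) @[m --> \oo] --> (1 - (0 + 0) : R).
    by apply: cvgB => //; exact: cvg_cst.
  by rewrite addr0 subr0 in h1.
- exact: cvg_cst.
Qed.

(** The reverse Bernoulli bound together with N >= c^-m gives the upper bound (c / z)^m. *)
Lemma cvg_step_gt (c z : R) : 0 < c -> c < z -> z <= 1 ->
  (1 - z ^+ m) ^+ step_exp c m @[m --> \oo] --> (0 : R).
Proof.
move=> c0 cz z1; have z0 : 0 < z by exact: lt_trans cz.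
apply: (squeeze_cvgr (f := fun=> 0) (h := fun m => (c / z) ^+ m)).
- apply: nearW => m.
  have a01 : 0 <= z ^+ m <= 1 by rewrite exprn_ge0 ?(ltW z0)//= exprn_ile1// ltW.
  have /andP[a0 a1] := a01.
  have /andP[h2 _] := step_exp_bounds m c0.
  have q0 : 0 <= (1 - z ^+ m) ^+ step_exp c m by rewrite exprn_ge0// subr_ge0.
  rewrite q0/= expr_div_n ler_pdivlMr ?exprn_gt0// -[leRHS]mulr1 -ler_pdivrMl ?exprn_gt0//.
  apply: le_trans (bernoulli_ge (step_exp c m) a01).
  rewrite mulrCA ler_wpM2l//.
  by rewrite (le_trans (ler_wpM2r a0 h2))// lerDr.
- exact: cvg_cst.
- by apply: cvg_expr; rewrite ger0_norm ?divr_ge0 ?ltW// ltr_pdivrMr// mul1r.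
Qed.

Lemma measurable_indic_Omega (A : set (measurableTypeR R)) : measurable A ->
  measurable_fun Omega (\1_A : R -> R).
Proof. by move=> mA; apply: measurable_funTS; exact: measurable_indic. Qed.

Lemma cosclosure_indic_ray (a : R) : cosclosure (\1_(`]a, +oo[%classic) : R -> R).
Proof.
have [a0|a0] := leP a 0.
  apply: (@eq_cosclosure (fun x => cos (0%:R * x))); last exact: cosclosure_cosnat.
  move=> x; rewrite /Omega/= in_itv/= => /andP[x0 _]; rewrite mul0r cos0 indicE mem_set//=.
  by rewrite in_itv/= andbT (le_lt_trans a0).
have [ap|ap] := leP pi a.
  apply: (@eq_cosclosure (fun=> 0)); last exact: cosclosure0.
  move=> x; rewrite /Omega/= in_itv/= => /andP[_ xp]; rewrite indicE memNset//=.
  by rewrite in_itv/= andbT; apply/negP; rewrite -leNgt ltW// (lt_le_trans xp).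
pose z (x : R) := (1 + cos x) / 2.
have z01 x : 0 <= z x <= 1.
  rewrite /z; have := cos_geN1 x; have := cos_le1 x; move: (cos x) => y ? ?.
  by apply/andP; split; lra.
have a0pi : a \in `[0, pi] by rewrite in_itv/= !ltW.
(* The cosine decreases on (0, pi), so the sublevel set of [z] at [a] is the ray to the right of
   [a]. *)
have zlt x : Omega x -> (z x < z a) = (a < x).
  rewrite /Omega/= in_itv/= => /andP[x0 xp].
  by rewrite /z ltr_pM2r// ltrD2l ltr_cos// in_itv/= !ltW.
have zgt x : Omega x -> (z a < z x) = (x < a).
  rewrite /Omega/= in_itv/= => /andP[x0 xp].
  by rewrite /z ltr_pM2r// ltrD2l ltr_cos// in_itv/= !ltW.
have za0 : 0 < z a.
  have : cos pi < cos a by rewrite ltr_cos// in_itv/= lexx pi_ge0.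
  by rewrite cospi /z; move: (cos a) => y ?; lra.
have za1 : z a < 1.
  have : cos a < cos 0 by rewrite ltr_cos// in_itv/= lexx pi_ge0.
  by rewrite cos0 /z; move: (cos a) => y ?; lra.
pose q m x := (1 - z x ^+ m) ^+ step_exp (z a) m.
(* The same function written as a polynomial in cos x, to which [cosclosure_poly] applies. *)
pose Q m : {poly R} := (1 - (2^-1 *: (1 + 'X)) ^+ m) ^+ step_exp (z a) m.
have qE m x : (Q m).[cos x] = q m x.
  by rewrite /Q /q /z !(hornerE, horner_exp) mulrC.
have q01 m x : 0 <= q m x <= 1.
  have /andP[z0 z1] := z01 x.
  have y0 : 0 <= 1 - z x ^+ m by rewrite subr_ge0 exprn_ile1.
  by rewrite /q exprn_ge0//= exprn_ile1// gerBl exprn_ge0.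
have m1 := @measurable_indic_Omega `]a, +oo[%classic (measurable_itv _).
have cq m : cosclosure (q m).
  apply: (@eq_cosclosure (fun x => (Q m).[cos x])); first by move=> x _; rewrite qE.
  exact: cosclosure_poly.
apply: cosclosure_lim.
  apply: (@L2Omega_bounded _ _ 1) => // x _.
  by rewrite indicE; case: (_ \in _); rewrite ?normr1// normr0.
move=> e e0.
have [||||||n hn] := @L2_dominated q (\1_(`]a, +oo[%classic)) (fun=> 1) _ _ _ _ _ _ e e0.
- exact: L2Omega_cst.
- by move=> m; apply: L2Omega_measurable; exact: (cq m).1.
- exact: m1.
- by move=> m x _; have /andP[? ?] := q01 m x; rewrite ger0_norm.
- by move=> x _; rewrite indicE; case: (_ \in _); rewrite ?normr1// normr0.
(* Convergence is not claimed at the threshold x = a, a null set. *)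
- exists [set a]; split => //; first exact: lebesgue_measure_set1.
  move=> x /= /not_implyP[Ox H]; apply: contrapT => /eqP xa; apply: H.
  have /andP[z0 z1] := z01 x.
  rewrite indicE; move: xa; rewrite neq_lt => /orP[xa|xa].
    rewrite memNset/=; last by rewrite in_itv/= andbT; apply/negP; rewrite -leNgt ltW.
    by apply: cvg_step_gt => //; rewrite zgt.
  rewrite mem_set/=; last by rewrite in_itv/= andbT.
  by apply: cvg_step_lt => //; rewrite zlt.
by exists (q n).
Qed.

Lemma sum_indic_trivIset (F : (set R)^nat) n (x : R) : trivIset [set: nat] F ->
  \1_(\big[setU/set0]_(k < n) F k) x = \sum_(k < n) \1_(F k) x :> R.
Proof.
move=> tF; elim: n => [|n ih]; first by rewrite !big_ord0 indic0.
rewrite !big_ord_recr/= -ih !indicE in_setU.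
have [xn|xn] := boolP (x \in F n); last by rewrite orbF addr0.
rewrite orbT memNset ?add0r//= -bigcup_mkord => -[k /= kn Fkx].
have := tF k n I I; rewrite (_ : k = n) ?ltnn// in kn *.
by apply: tF => //; exists x; split => //; exact: set_mem.
Qed.

(** Dynkin's argument: the rays are stable under intersection and generate the Borel sets;
    complements come from linearity and disjoint countable unions from dominated convergence. *)
Lemma cosclosure_indic (A : set (measurableTypeR R)) : measurable A ->
  cosclosure (\1_A : R -> R).
Proof.
move=> mA; suff H : forall S, <<s (@RGenOInfty.G R) >> S -> cosclosure (\1_S : R -> R).
  by move: mA; rewrite RGenOInfty.measurableE; exact: H.
apply: (@dynkin_induction _ (measurableTypeR R) (@RGenOInfty.G R)
  (fun A => cosclosure (\1_A : R -> R))).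
- exact: RGenOInfty.measurableE.
- move=> _ _ [x ->] [y ->]; exists (Num.max x y).
  by apply/seteqP; split => z /=; rewrite !in_itv/= !andbT gt_max => /andP.
- apply: (@eq_cosclosure (fun x => cos (0%:R * x))); last exact: cosclosure_cosnat.
  by move=> x _; rewrite mul0r cos0 indicT.
- by move=> _ [x ->]; exact: cosclosure_indic_ray.
- move=> S mS cS; apply: (@eq_cosclosure (fun x => cos (0%:R * x) + -1 * \1_S x)).
    move=> x _; rewrite mul0r cos0 !indicE in_setC; case: (_ \in _) => /=; ring.
  by apply: cosclosureD; [exact: cosclosure_cosnat|exact: cosclosureZ].
- move=> F mF tF cF; have mU : measurable (\bigcup_k F k) by exact: bigcupT_measurable.
  have b01 (B : set R) x : `|\1_B x| <= 1 :> R.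
    by rewrite indicE; case: (_ \in _); rewrite ?normr1// normr0.
  apply: cosclosure_lim.
    by apply: (@L2Omega_bounded _ _ 1) => //; exact: measurable_indic_Omega.
  move=> e e0; pose h n : R -> R := \1_(\big[setU/set0]_(k < n) F k).
  have ch n : cosclosure (h n).
    apply: (@eq_cosclosure (fun x => \sum_(k < n) \1_(F k) x)); last exact: cosclosure_sum.
    by move=> x _; rewrite /h -sum_indic_trivIset.
  have [||||||n hn] := @L2_dominated h (\1_(\bigcup_k F k)) (fun=> 1) _ _ _ _ _ _ e e0.
  + exact: L2Omega_cst.
  + by move=> n; apply: L2Omega_measurable; exact: (ch n).1.
  + exact: measurable_indic_Omega.
  + by move=> *; exact: b01.
  + by move=> *; exact: b01.
  + apply: aeW => x _; apply/cvgrPdist_le => d d0.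
    have [[k _ Fkx]|nF] := pselect ((\bigcup_k F k) x).
      exists k.+1 => // n /= kn; rewrite /h !indicE !mem_set; first by rewrite subrr normr0 ltW.
        by rewrite -bigcup_mkord; exists k.
      by exists k.
    exists 0%N => // n _; rewrite /h !indicE !memNset//; first by rewrite subrr normr0 ltW.
    by rewrite -bigcup_mkord => -[k _ Fk]; apply: nF; exists k.
  by exists (h n).
Qed.

(** The dyadic simple functions increase to f, so f dominates its own approximations. *)
Lemma cosclosure_ge0 f : L2Omega f -> (forall x, Omega x -> 0 <= f x) -> cosclosure f.
Proof.
move=> Lf f0; have mf := L2Omega_measurable Lf.
have mEf : measurable_fun Omega (EFin \o f) by exact/measurable_EFinP.
have f0' x : Omega x -> (0 <= (EFin \o f) x)%E by move=> /f0; rewrite lee_fin.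
apply: cosclosure_lim => // e e0.
pose A := approx (Omega : set (measurableTypeR R)) (EFin \o f).
have cA n : cosclosure (A n).
  rewrite /A /approx; apply: cosclosureD.
    apply: cosclosure_sum => k; apply: cosclosureZ; apply: cosclosure_indic.
    rewrite /dyadic_approx; case: ifPn => // _.
    under eq_set do rewrite inE.
    have mI : measurable ([set x%:E | x in [set` dyadic_itv R n k]] : set (\bar R)).
      by apply/measurable_image_EFin; exact: measurable_itv.
    exact: (mEf measurable_Omega _ mI).
  apply: cosclosureZ; apply: cosclosure_indic.
  exact: emeasurable_fun_c_infty.
have [|||||n hn] := @L2_dominated A f f Lf _ _ _ _ _ e e0.
- by move=> m; apply: L2Omega_measurable; exact: (cA m).1.
- by [].
- move=> m x Ox; rewrite ger0_norm; last first.
    rewrite /A /approx addr_ge0 ?sumr_ge0// => [k _|]; rewrite mulr_ge0// indicE; by case: (_ \in _).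
  by have := @le_approx _ _ _ _ _ m x f0' Ox; rewrite lee_fin.
- by move=> x Ox; rewrite ger0_norm// f0.
- by apply: aeW => x Ox; have := @cvg_approx _ _ _ _ _ x f0' Ox; apply; rewrite ltry.
by exists (A n).
Qed.

(** Completeness of the cosines, by splitting f into its positive and negative parts. *)
Lemma cosclosureT f : L2Omega f -> cosclosure f.
Proof.
move=> Lf; have /L2OmegaP[mf fi] := Lf.
have Lm h : measurable_fun Omega h -> (forall x, `|h x| <= `|f x|) -> L2Omega h.
  move=> mh hf; apply/L2OmegaP; split=> //.
  apply: (int_le _ _ fi) => //; first exact: measurable_funX.
  move=> x _; rewrite normrX -[leRHS]real_normK ?num_real// lerXn2r ?nnegrE//.
apply: (@eq_cosclosure (fun x => Num.max (f x) 0 + -1 * Num.max (- f x) 0)).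
  move=> x _; rewrite /Num.max; case: ltP => h1; case: ltP => h2; lra.
apply: cosclosureD; [|apply: cosclosureZ]; apply: cosclosure_ge0.
- apply: Lm; first by apply: measurable_maxr => //; exact: measurable_cst.
  by move=> x; rewrite /Num.max; case: ifP; rewrite ?normr0.
- by move=> x _; rewrite le_max lexx orbT.
- apply: Lm; first by apply: measurable_maxr; [exact: measurableT_comp|exact: measurable_cst].
  by move=> x; rewrite /Num.max; case: ifP; rewrite ?normr0 ?normrN.
- by move=> x _; rewrite le_max lexx orbT.
Qed.

Lemma parseval f : L2Omega f ->
  \sum_(0 <= p < N) coef p f ^+ 2 @[N --> \oo] --> innerL2 f f.
Proof.
move=> Lf; have [_ cf] := cosclosureT Lf.
apply/cvgrPdist_le => e e0; have se : 0 < Num.sqrt e by rewrite sqrtr_gt0.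
have [N0 hN] := cf _ se; exists N0 => // N /hN {}hN.
rewrite -(nrm_resid N Lf) ger0_norm ?sqr_ge0// -[leRHS](@sqr_sqrtr _ e) ?(ltW e0)//.
by rewrite lerXn2r ?nnegrE// sqrtr_ge0.
Qed.

(** Turns estimates of finitely many coefficients, uniform in their number, into estimates of the
    norm. *)
Lemma parseval_le f (B : R) : L2Omega f ->
  (forall N, \sum_(0 <= p < N) coef p f ^+ 2 <= B) -> innerL2 f f <= B.
Proof.
move=> Lf H; have := parseval Lf => /cvgP c.
by rewrite -(cvg_lim _ (parseval Lf))//; apply: limr_le => //; exact: nearW.
Qed.

End CosineCompleteness.

(** * Sampling error at the nodes *)

Section Sampling.
Context {R : realType}.
Notation mu := (@lebesgue_measure R).
Implicit Types (f : R -> R) (B S e : R).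

Lemma sum_CS I (s : seq I) (P : pred I) (a b : I -> R) :
  (\sum_(i <- s | P i) a i * b i) ^+ 2 <=
  (\sum_(i <- s | P i) a i ^+ 2) * (\sum_(i <- s | P i) b i ^+ 2).
Proof.
elim: s => [|i s ih]; first by rewrite !big_nil mul0r expr0n.
rewrite !big_cons; case: (P i) => //.
have : 0 <= \sum_(j <- s | P j) a j ^+ 2 by apply: sumr_ge0 => j _; exact: sqr_ge0.
have : 0 <= \sum_(j <- s | P j) b j ^+ 2 by apply: sumr_ge0 => j _; exact: sqr_ge0.
move: (\sum_(j <- s | P j) a j ^+ 2) (\sum_(j <- s | P j) b j ^+ 2)
  (\sum_(j <- s | P j) a j * b j) (a i) (b i) ih => X Y Z x y h Y0 X0.
(* The cross term: its square is at most 4 X Y x^2 y^2 by the induction hypothesis, hence at most (X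
   y^2 + Y x^2)^2. *)
have k : 2 * Z * x * y <= X * y ^+ 2 + Y * x ^+ 2.
  have W0 : 0 <= X * y ^+ 2 + Y * x ^+ 2 by apply: addr_ge0; apply: mulr_ge0 => //; exact: sqr_ge0.
  rewrite (le_trans (ler_norm _))// -ler_sqr ?nnegrE// real_normK ?num_real//.
  have := sqr_ge0 (X * y ^+ 2 - Y * x ^+ 2).
  have := ler_wpM2r (mulr_ge0 (sqr_ge0 x) (sqr_ge0 y)) h; nra.
rewrite !sqrrD; move: k h; rewrite !expr2; lra.
Qed.

(** Since q >= 1, 1 / q^2 is at most 2 / (q (q + 1)), which telescopes. *)
Lemma sum_inv_sqr_le m N : (0 < m)%N ->
  \sum_(m <= q < N) (q%:R : R) ^- 2 <= 2 / m%:R.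
Proof.
move=> m0; have [Nm|mN] := leqP N m.
  by rewrite big_geq// divr_ge0.
suff : \sum_(m <= q < N) (q%:R : R) ^- 2 <= 2 / m%:R - 2 / N%:R.
  by move=> /le_trans; apply; rewrite gerBl divr_ge0.
have -> : 2 / m%:R - 2 / N%:R = \sum_(m <= q < N) (- (2 / q.+1%:R) - - (2 / q%:R)) :> R.
  by rewrite telescope_sumr; [rewrite opprK addrC|exact: ltnW].
apply: ler_sum_nat => q /andP[mq _].
have q0 : 0 < (q%:R : R) by rewrite ltr0n (leq_trans m0).
have q1 : 1 <= (q%:R : R) by rewrite ler1n (leq_trans m0).
rewrite -(natr1 q) opprK; have q2 : 0 < (q%:R : R) + 1 by rewrite addr_gt0.
have -> : - (2 / (q%:R + 1)) + 2 / q%:R = 2 / (q%:R * (q%:R + 1)) :> R.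
  by field; rewrite !gt_eqF.
rewrite ler_pdivlMr ?mulr_gt0// mulrC ler_pdivrMr ?exprn_gt0// expr2.
nra.
Qed.

(** Cauchy-Schwarz with the weights 1 / q and q; the sum of 1 / q^2 from n on supplies the factor 1
    / n. *)
Lemma tail_coef_le f S n N : (0 < n)%N ->
  (forall N, \sum_(1 <= q < N) (q%:R ^+ 2 * coef q f ^+ 2) <= S) ->
  \sum_(n <= q < N) `|coef q f| <= Num.sqrt (2 * S / n%:R).
Proof.
move=> n0 HS; have [Nn|nN] := leqP N n; first by rewrite big_geq// sqrtr_ge0.
have S0 : 0 <= S by have := HS 0%N; rewrite big_geq.
rewrite -[leLHS]ger0_norm ?sumr_ge0// -sqrtr_sqr ler_sqrt ?divr_ge0 ?mulr_ge0//.
have -> : \sum_(n <= q < N) `|coef q f| = \sum_(n <= q < N) (q%:R^-1 * (q%:R * `|coef q f|)).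
  rewrite big_nat_cond [RHS]big_nat_cond; apply: eq_bigr => q /andP[/andP[nq _] _].
  by rewrite mulKf// pnatr_eq0 -lt0n (leq_trans n0).
rewrite (le_trans (sum_CS _ _ _ _))// mulrAC; apply: ler_pM.
- by apply: sumr_ge0 => *; exact: sqr_ge0.
- by apply: sumr_ge0 => *; exact: sqr_ge0.
- by under eq_bigr do rewrite exprVn; exact: sum_inv_sqr_le.
- under eq_bigr do rewrite exprMn real_normK ?num_real//.
  apply: le_trans (HS N); rewrite [leRHS](@big_cat_nat _ _ _ n)//=; last exact: ltnW.
  by rewrite lerDr sumr_ge0// => q _; rewrite mulr_ge0// sqr_ge0.
Qed.

Lemma psum_continuous N f : continuous (psum N f).
Proof.
elim: N => [|N ih] x; rewrite /psum.
  by under eq_fun do rewrite big_geq//; exact: cvg_cst.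
under eq_fun do rewrite big_nat_recr//=.
by apply: cvgD; [exact: ih|apply: cvgM; [exact: cvg_cst|exact: continuous_phi]].
Qed.

(* A continuous function departing from its partial sum by more than the tail
   bound at one point would do so on an interval, hence for every longer partial
   sum too, against L^2 convergence. *)
Lemma sup_resid_le f N B : L2Omega f -> {in Omega, continuous f} ->
  (forall N', (N <= N')%N -> \sum_(N <= q < N') `|coef q f| <= B) ->
  forall x, Omega x -> `|f x - psum N f x| <= B.
Proof.
move=> Lf cf HB x Ox; rewrite leNgt; apply/negP => hB.
(* Half of the assumed excess over [B]: on a small interval the residual stays above [B + eta], and
   longer partial sums move by at most [B], so [eta] survives. *)
pose h (y : R) : R := `|f y - psum N f y|; pose eta : R := (h x - B) / 2.
have eta0 : 0 < eta by rewrite divr_gt0// subr_gt0.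
have ch : {for x, continuous h}.
  apply: cvg_norm; apply: cvgB; last exact: psum_continuous.
  by apply: cf; rewrite inE.
have /nbhs_ballP[r /= r0 hr] : \forall y \near x, B + eta < h y.
  move/cvgr_gt: ch; apply.
  by move: hB; rewrite /eta -/(h x); move: (h x) => ?; lra.
have /andP[x0 xpi] : 0 < x < pi by move: Ox; rewrite /Omega/= in_itv.
pose b := Num.min (x + r) pi.
have xb : x < b by rewrite lt_min xpi andbT ltrDl.
have Ib y : `]x, b[%classic y -> Omega y /\ B + eta < h y.
  rewrite /= in_itv/= lt_min => /andP[xy /andP[yr yp]]; split.
    by rewrite /Omega/= in_itv/= yp andbT (lt_trans x0).
  by apply: hr; rewrite /ball/= ltr0_norm ?subr_lt0// opprB ltrBlDl.
have low N' : (N <= N')%N -> eta ^+ 2 * (b - x) <= nrmL2 (fun y => f y - psum N' f y) ^+ 2.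
  move=> NN; have Lr := L2OmegaB Lf (L2Omega_psum N' f).
  have ir := L2Omega_mul_integrable Lr Lr.
  rewrite nrmL2_sqr -lee_fin /innerL2 /Rintegral fineK; last exact: integrable_fin_num.
  have -> : (eta ^+ 2 * (b - x))%:E = (\int[mu]_(y in `]x, b[) (cst (eta ^+ 2)%:E) y)%E.
    by rewrite integral_cst//= lebesgue_measure_itv/= lte_fin xb EFinM EFinB.
  apply: (@le_trans _ _ (\int[mu]_(y in `]x, b[) ((f y - psum N' f y) * (f y - psum N' f y))%:E)%E).
    have mr : measurable_fun `]x, b[ (EFin \o (fun y => (f y - psum N' f y) * (f y - psum N' f y))).
      by apply: measurable_funS (measurable_int _ ir) => // y /Ib[].
    apply: ge0_le_integral => //.
    - by move=> y _; rewrite lee_fin sqr_ge0.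
    - move=> y /Ib[Oy hy]; rewrite /= lee_fin -expr2 -[leRHS]real_normK ?num_real//.
      rewrite lerXn2r ?nnegrE ?(ltW eta0)//.
      have : `|psum N' f y - psum N f y| <= B.
        have -> : psum N' f y - psum N f y = \sum_(N <= q < N') coef q f * phi q y.
          by apply/eqP; rewrite subr_eq addrC /psum -big_cat_nat.
        rewrite (le_trans (ler_norm_sum _ _ _))// (le_trans _ (HB N' NN))// ler_sum// => q _.
        by rewrite normrM ler_piMr// phi_le.
      move: hy; rewrite /h.
      have := ler_distD (psum N' f y) (f y) (psum N f y); lra.
  apply: ge0_subset_integral => //; first exact: (measurable_int _ ir).
  - by move=> y _; rewrite lee_fin -expr2 sqr_ge0.
  - by move=> y /Ib[].
have [_ cl] := cosclosureT Lf.
have c0 : 0 < eta ^+ 2 * (b - x) by rewrite mulr_gt0 ?exprn_gt0 ?subr_gt0.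
have s0 : 0 < Num.sqrt (eta ^+ 2 * (b - x) / 2) by rewrite sqrtr_gt0 divr_gt0.
have [N0 /(_ (maxn N N0) (leq_maxr _ _)) H1] := cl _ s0.
have := low (maxn N N0) (leq_maxl _ _).
have : nrmL2 (fun y => f y - psum (maxn N N0) f y) ^+ 2 <= eta ^+ 2 * (b - x) / 2.
  rewrite -[leRHS]sqr_sqrtr; last by rewrite divr_ge0// ltW.
  by rewrite lerXn2r ?nnegrE ?sqrtr_ge0.
move: (nrmL2 _ ^+ 2) c0; move: (eta ^+ 2 * (b - x)) => u v; lra.
Qed.

(** The midpoint rule reproduces the coefficients of [psum n f] exactly, so the error is the rule
    applied to f - psum n f. With |phi_p| <= 1 it is at most pi times the supremum of that
    residual. *)
Lemma sampling_error f n p S : L2Omega f -> {in Omega, continuous f} ->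
  (forall N, \sum_(1 <= q < N) (q%:R ^+ 2 * coef q f ^+ 2) <= S) -> (p < n)%N ->
  (pi / n%:R * (\sum_(k < n) f (node k) * phi p (node k)) - coef p f) ^+ 2 <=
  2 * pi ^+ 2 * S / n%:R.
Proof.
move=> Lf cf HS pn; have n0 : (0 < n)%N by exact: leq_ltn_trans pn.
have S0 : 0 <= S by have := HS 0%N; rewrite big_geq.
have n0' : (0 : R) < n%:R by rewrite ltr0n.
pose B := Num.sqrt (2 * S / n%:R).
have Hr k : `|f (@node R n k) - psum n f (node k)| <= B.
  apply: sup_resid_le => //; last exact: node_Omega.
  by move=> N' _; exact: tail_coef_le.
have -> : coef p f = pi / n%:R * \sum_(k < n) psum n f (node k) * phi p (node k).
  under eq_bigr do rewrite /psum big_distrl/=.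
  rewrite exchange_big/= big_distrr/=.
  have e q : (q < n)%N -> pi / n%:R * (\sum_(k < n) coef q f * phi q (@node R n k) * phi p (node k)) =
      coef q f * (q == p)%:R.
    move=> qn; under eq_bigr do rewrite -mulrA.
    by rewrite -big_distrr/= mulrCA discrete_ortho.
  rewrite (@big_cat_nat _ _ _ p)//=; last exact: ltnW.
  rewrite (@big_ltn _ _ _ p)//= e// eqxx mulr1 big_nat_cond big1.
    rewrite big_nat_cond big1 ?add0r ?addr0// => i /andP[/andP[qi ii] _].
    by rewrite e// gtn_eqF ?mulr0.
  move=> i /andP[/andP[_ iq] _]; rewrite e ?(ltn_trans iq)//.
  by rewrite ltn_eqF ?mulr0.
rewrite -mulrBr -sumrB; under eq_bigr do rewrite -mulrBl.
have H : `|pi / n%:R * \sum_(k < n) (f (node k) - psum n f (node k)) * phi p (node k)| <= pi * B.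
  have c0 : 0 <= pi / n%:R :> R by rewrite divr_ge0// pi_ge0.
  rewrite normrM (ger0_norm c0).
  have : `|\sum_(k < n) (f (node k) - psum n f (node k)) * phi p (@node R n k)| <= n%:R * B.
    rewrite (le_trans (ler_norm_sum _ _ _))//.
    rewrite -[X in X%:R]card_ord mulr_natl -sumr_const ler_sum// => k _.
    by rewrite normrM (le_trans _ (Hr k))// ler_piMr// phi_le.
  move=> /(ler_wpM2l c0)/le_trans; apply; rewrite mulrA divfK// gt_eqF//.
rewrite -real_normK ?num_real// (le_trans (lerXn2r _ _ _ H)) ?nnegrE//.
  by rewrite mulr_ge0 ?pi_ge0 ?sqrtr_ge0.
rewrite exprMn sqr_sqrtr ?divr_ge0 ?mulr_ge0//.
by rewrite le_eqVlt; apply/orP; left; apply/eqP; ring.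
Qed.

End Sampling.

(** * The fundamental theorem of calculus for an integrable derivative *)

Section IntegrableDerivative.
Context {R : realType}.
Notation mu := (@lebesgue_measure R).
Implicit Types (a b e x t : R) (f h w : R -> R).

(* Half of the Vitali-Caratheodory theorem.  The derivative of the mean mode of
   the solution is only known to be integrable, since the mean of g(., t) is
   dominated by an integrable function of t but need not be bounded. *)
Lemma ereal_lsc_majorant w a b e : a < b -> 0 < e ->
  (forall x, 0 <= w x) -> mu.-integrable `[a, b] (EFin \o w) ->
  exists v : R -> \bar R,
    [/\ measurable_fun `[a, b] v, forall x, (0 <= v x)%E,
     (\int[mu]_(x in `[a, b]) v x <= \int[mu]_(x in `[a, b]) (w x)%:E + e%:E)%E &
     forall x, x \in `[a, b] -> exists2 c, w x < c & \forall y \near x, (c%:E <= v y)%E].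
Proof.
move=> ab e0 w0 iw; have mw := int_meas iw.
pose D := `[a, b]%classic : set (measurableTypeR R).
have mD : measurable D by exact: measurable_itv.
have muD : mu D = (b - a)%:E by rewrite /D lebesgue_measure_itv/= lte_fin ab EFinB.
(* Height of the slices of the range of [w]. Rounding [w] up to the top of its slice costs at most
   eps (b - a) = e / 2. *)
pose eps := e / (2 * (b - a)).
have ba0 : 0 < b - a by rewrite subr_gt0.
have eps0 : 0 < eps by rewrite divr_gt0// mulr_gt0.
pose c k : R := k.+1%:R * eps.
have c0 k : 0 < c k by rewrite mulr_gt0.
pose E k : set (measurableTypeR R) := D `&` w @^-1` `[k%:R * eps, c k[%classic.
have mE k : measurable (E k) by apply: mw => //; exact: measurable_itv.
have muE k : (mu (E k) < +oo)%E.
  apply: (@le_lt_trans _ _ (mu D)); last by rewrite muD ltry.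
  by apply: le_measure; rewrite ?inE//; exact: subIsetl.
(* The tolerance for enlarging slice k to an open set: multiplied by the height [c k] it is e / 2 /
   2^(k+1), so these costs add up to at most e / 2. *)
pose de k := e / 2 / (2 ^ k.+1)%:R / c k.
have de0 k : 0 < de k by rewrite !divr_gt0.
pose V k := sval (cid (lebesgue_regularity_outer (mE k) (muE k) (de0 k))).
have VP k : [/\ open (V k), E k `<=` V k & (mu (V k `\` E k) < (de k)%:E)%E].
  exact: (svalP (cid (lebesgue_regularity_outer (mE k) (muE k) (de0 k)))).
have mV k : measurable (V k : set (measurableTypeR R)).
  by case: (VP k) => oV _ _; exact: open_measurable.
pose g k (x : measurableTypeR R) := (c k * \1_(V k) x)%:E.
have g0 k x : (0 <= g k x)%E by rewrite lee_fin mulr_ge0// ltW.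
have mg k : measurable_fun D (g k).
  apply/measurable_EFinP; apply: measurable_funM; first exact: measurable_cst.
  by apply: measurable_funTS; exact: measurable_indic.
(* A sum of nonnegative multiples of indicators of open sets is lower semicontinuous. *)
exists (fun x => \sum_(k <oo) g k x)%E; split.
- by apply: (@ge0_emeasurable_sum _ _ _ D g xpredT).
- by move=> x; apply: nneseries_ge0 => k _ _; exact: g0.
- rewrite integral_nneseries//.
  have EU : \bigcup_k E k = D.
    apply/seteqP; split=> [x [k _ []]//|x Dx].
    exists (Num.truncn (w x / eps)) => //; split=> //=; rewrite in_itv/=.
    have := @truncn_itv _ (w x / eps); rewrite divr_ge0 ?(ltW eps0)// => /(_ isT).
    by rewrite ler_pdivlMr// ltr_pdivrMr.
  have tE : trivIset setT E.
    move=> i j _ _ [x [[_ xi] [_ xj]]]; move: xi xj.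
    rewrite /= !in_itv/= => /andP[i1 i2] /andP[j1 j2].
    have := le_lt_trans i1 j2; have := le_lt_trans j1 i2.
    by rewrite !ltr_pM2r// !ltr_nat => ? ?; lia.
  have mwe : measurable_fun D (fun x => (w x + eps)%:E).
    by apply/measurable_EFinP; apply: measurable_funD => //; exact: measurable_cst.
  have we0 x : (0 <= (w x + eps)%:E)%E by rewrite lee_fin addr_ge0// ltW.
  have step k : (\int[mu]_(x in D) g k x <=
      \int[mu]_(x in E k) (w x + eps)%:E + (e / 2 / (2 ^ k.+1)%:R)%:E)%E.
    have -> : (\int[mu]_(x in D) g k x = (c k)%:E * mu (V k `&` D))%E.
      transitivity (\int[mu]_(x in D) ((c k)%:E * (\1_(V k) x)%:E))%E.
        by apply: eq_integral => x _; rewrite /g EFinM.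
      rewrite -integral_indic// ge0_integralZl_EFin//; last exact: ltW.
        by apply/measurable_EFinP; apply: measurable_funTS; exact: measurable_indic.
    apply: (@le_trans _ _ ((c k)%:E * (mu (E k) + (de k)%:E))%E).
      rewrite lee_pmul2l ?lte_fin//; apply: (@le_trans _ _ (mu (V k))).
        by apply: le_measure; rewrite ?inE//; exact: measurableI.
      have [_ EV /ltW dV] := VP k.
      have -> : V k = E k `|` (V k `\` E k).
        apply/seteqP; split=> [y Vy|y [/EV//|[]//]].
        by have [|] := pselect (E k y); [left|right].
      apply: le_trans; first by apply: measureU2 => //; exact: measurableD.
      exact: leeD2l.
    have ce : ((c k)%:E * (de k)%:E = (e / 2 / (2 ^ k.+1)%:R)%:E)%E.
      by rewrite -EFinM /de mulrC divfK// gt_eqF.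
    rewrite ge0_muleDr ?lee_fin ?(ltW (de0 k))// ce.
    rewrite leeD2r// -integral_cst//; apply: ge0_le_integral => //.
    - by move=> x _; rewrite lee_fin ltW.
    - by apply: measurable_funS mwe => //; exact: subIsetl.
    - move=> x [_]; rewrite /= in_itv/= => /andP[h _]; rewrite lee_fin /c -natr1 mulrDl mul1r.
      by rewrite lerD2r.
  apply: (@le_trans _ _ (\sum_(k <oo) (\int[mu]_(x in E k) (w x + eps)%:E +
       (e / 2 / (2 ^ k.+1)%:R)%:E))%E).
    apply: lee_nneseries => [k _ _|k _]; last exact: step.
    by apply: integral_ge0 => x _; exact: g0.
  rewrite nneseriesD; last 2 first.
  + by move=> k _ _; apply: integral_ge0.
  + by move=> k _ _; rewrite lee_fin divr_ge0// divr_ge0// ltW.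
  rewrite -ge0_integral_bigcup//; last by rewrite EU.
  rewrite EU; under eq_integral do rewrite EFinD.
  rewrite ge0_integralD//; last 3 first.
  + by move=> x _; rewrite lee_fin.
  + exact/measurable_EFinP.
  + by move=> x _; rewrite lee_fin ltW.
  rewrite -addeA leeD2l// integral_cst// [X in (_ * X)%E]muD -EFinM.
  apply: (@le_trans _ _ ((e / 2)%:E + (e / 2)%:E)%E).
    apply: leeD; last by apply: epsilon_trick0; rewrite divr_ge0// ltW.
    rewrite lee_fin le_eqVlt; apply/orP; left; apply/eqP; rewrite /eps.
    by field; rewrite gt_eqF.
  by rewrite -EFinD lee_fin -splitr.
- move=> x xab; pose k := Num.truncn (w x / eps).
  have : E k x.
    split=> //=; rewrite in_itv/=.
    have := @truncn_itv _ (w x / eps); rewrite divr_ge0 ?(ltW eps0)// => /(_ isT).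
    by rewrite ler_pdivlMr// ltr_pdivrMr.
  move=> Ekx; have [oV EV _] := VP k.
  exists (c k); first by case: Ekx => _; rewrite /= in_itv/= => /andP[].
  have : nbhs x (V k) by apply: open_nbhs_nbhs; split=> //; exact: EV.
  apply: filterS => y Vy; rewrite (@nneseriesD1 _ _ k)//.
  rewrite /g indicE mem_set// mulr1 leeDl// nneseries_ge0// => i _ _; exact: g0.
Qed.

(** Semicontinuity is restated through integrals over short intervals to the right of x. This form
    survives [fine], which alters the majorant only on the null set where it is infinite. *)
Lemma lsc_majorant w a b e : a < b -> 0 < e ->
  (forall x, 0 <= w x) -> mu.-integrable `[a, b] (EFin \o w) ->
  exists v : R -> R,
    [/\ mu.-integrable `[a, b] (EFin \o v),
     \int[mu]_(x in `[a, b]) v x <= \int[mu]_(x in `[a, b]) w x + e &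
     forall x, x \in `]a, b[ -> exists2 c, w x < c &
       \forall t \near x^'+, c * (t - x) <= \int[mu]_(y in `[x, t]) v y].
Proof.
move=> ab e0 w0 iw; have [v [mv v0 vw vc]] := ereal_lsc_majorant ab e0 w0 iw.
have mD : measurable (`[a, b]%classic : set (measurableTypeR R)) by exact: measurable_itv.
have wfin := integrable_fin_num mD iw.
have vfin : (\int[mu]_(x in `[a, b]) v x < +oo)%E.
  by apply: le_lt_trans vw _; rewrite -(fineK wfin) -EFinD ltry.
have iv : mu.-integrable `[a, b] v.
  apply/integrableP; split=> //; apply: le_lt_trans vfin.
  by rewrite le_eqVlt; apply/orP; left; apply/eqP; apply: eq_integral => x _; rewrite gee0_abs.
have mfv : measurable_fun `[a, b] (fine \o v).
  by apply: measurableT_comp => //; exact: measurable_fine.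
have fv : ae_eq mu `[a, b]%classic v (EFin \o (fine \o v)).
  apply: (@filterS _ _ (ae_filter_ringOfSetsType mu) _ _ _ (integrable_ae mD iv)).
  by move=> x H Dx; rewrite /= fineK// H.
have sub s t : a <= s -> t <= b -> `[s, t]%classic `<=` `[a, b]%classic.
  by move=> as_ tb; apply: subset_itv; rewrite bnd_simp.
have eqI s t : a <= s -> t <= b ->
    (\int[mu]_(y in `[s, t]) (fine (v y))%:E = \int[mu]_(y in `[s, t]) v y)%E.
  move=> as_ tb; apply/esym; apply: ae_eq_integral => //.
  - by apply: measurable_funS mv => //; exact: sub.
  - by apply/measurable_EFinP; apply: measurable_funS mfv => //; exact: sub.
  - apply: (@filterS _ _ (ae_filter_ringOfSetsType mu) _ _ _ fv) => x H Dx; apply: H.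
    exact: (sub s t).
exists (fine \o v); split.
- apply: (le_integrable mD _ _ iv); first exact/measurable_EFinP.
  by move=> x _ /=; have := v0 x; case: (v x) => //= r; rewrite leey.
- rewrite /Rintegral eqI// -lee_fin fineK; last first.
    by rewrite ge0_fin_numE// integral_ge0.
  by rewrite EFinD fineK.
move=> x; rewrite in_itv/= => /andP[ax xb].
have [|c wc /nbhs_ballP[r /= r0 hr]] := vc x; first by rewrite in_itv/= !ltW.
exists c => //; near=> t.
have xt : x < t by near: t; exact: nbhs_right_gt.
have tb : t <= b by near: t; apply: nbhs_right_le.
have tr : t < x + r by near: t; apply: nbhs_right_lt; rewrite ltrDl.
rewrite /Rintegral/= eqI//; last exact: ltW.
have xtab := sub x t (ltW ax) tb.
have fin : (\int[mu]_(y in `[x, t]) v y)%E \is a fin_num.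
  apply: integrable_fin_num => //; apply: integrableS iv => //.
rewrite -lee_fin fineK//.
have -> : (c * (t - x))%:E = (\int[mu]_(y in `[x, t]) (cst c%:E) y)%E.
  by rewrite integral_cst//= lebesgue_measure_itv/= lte_fin xt EFinM EFinB.
apply: ge0_le_integral => //.
- by move=> y _; rewrite lee_fin (le_trans (w0 x))// ltW.
- exact: measurable_funS mv.
- move=> y; rewrite /= in_itv/= => /andP[xy yt]; apply: hr.
  by rewrite /ball/= distrC ger0_norm ?subr_ge0// ltrBlDl (le_lt_trans yt).
Unshelve. all: by end_near. Qed.

(** At the supremum of the points where f is at least its initial value, continuity keeps the
    inequality and the local hypothesis would extend it further right. The hypothesis concerns
    interior points, so the endpoints are reached by limits. *)
Lemma right_increasing_le f a b : a <= b -> {within `[a, b], continuous f} ->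
  (forall x, x \in `]a, b[ -> \forall t \near x^'+, f x <= f t) -> f a <= f b.
Proof.
rewrite le_eqVlt => /predU1P[->//|ab] cf H.
have [cfx fa fb] := (continuous_within_itvP f ab).1 cf.
have mid a' b' : a < a' -> a' < b' -> b' < b -> f a' <= f b'.
  move=> aa' ab' bb'.
  pose S := [set x | a' <= x <= b' /\ f a' <= f x].
  have Sa : S a' by rewrite /S/= lexx (ltW ab').
  have Sb : ubound S b' by move=> x [/andP[]].
  have hs : has_sup S by split; [exists a'|exists b'].
  pose s := sup S.
  have as_ : a' <= s by apply: ub_le_sup => //; exact: hs.2.
  have sb : s <= b' by apply: ge_sup => //; exact: hs.1.
  have sab : s \in `]a, b[ by rewrite in_itv/= (lt_le_trans aa')//= (le_lt_trans sb).
  have fs : f a' <= f s.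
    rewrite leNgt; apply/negP => fsa.
    have /nbhs_ballP[r /= r0 hr] : \forall y \near s, f y < f a'.
      by have /cvgr_lt := cfx s sab; apply.
    have [x Sx sx] := sup_adherent r0 hs; have [_ fx] := Sx.
    have xs : x <= s by apply: ub_le_sup => //; exact: hs.2.
    have : f x < f a' by apply: hr; rewrite /ball/= ger0_norm ?subr_ge0// ltrBlDl -ltrBlDr.
    by rewrite ltNge fx.
  have [<-//|sb'] := eqVneq s b'.
  have ltsb : s < b' by rewrite lt_neqAle sb'.
  have : \forall t \near s^'+, False.
    near=> t; have st : s < t by near: t; exact: nbhs_right_gt.
    have tb : t <= b' by near: t; exact: nbhs_right_le.
    have ft : f s <= f t by near: t; exact: H.
    have : t <= s.
      apply: ub_le_sup => //; first exact: hs.2.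
      by split; [rewrite tb andbT (le_trans as_)// ltW|exact: le_trans ft].
    by rewrite leNgt st.
  by move=> /filter_ex[].
have fab' b' : a < b' -> b' < b -> f a <= f b'.
  move=> ab' bb'; apply: (cvgr_to_le fa).
  near=> x; have ax : a < x by near: x; exact: nbhs_right_gt.
  have xb : x < b' by near: x; exact: nbhs_right_lt.
  exact: mid.
apply: (cvgr_to_ge fb).
near=> x; have ax : a < x by near: x; exact: nbhs_left_gt.
have xb : x < b by near: x; exact: nbhs_left_lt.
exact: fab'.
Unshelve. all: by end_near. Qed.

Lemma derivative_near f x (l : R) : derivable f x 1 -> derive1 f x = l ->
  forall e, 0 < e -> \forall t \near x^'+, f t - f x <= (l + e) * (t - x).
Proof.
move=> df dl e e0.
have : (fun s => s^-1 *: (f (s *: 1 + x) - f x)) @ 0^' --> l.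
  by rewrite -dl derive1E; exact: df.
move=> /cvgrPdist_le/(_ _ e0)/nbhs_ballP[r /= r0 hr].
near=> t; have xt : x < t by near: t; exact: nbhs_right_gt.
have tr : t < x + r by near: t; apply: nbhs_right_lt; rewrite ltrDl.
have tx0 : 0 < t - x by rewrite subr_gt0.
have := hr (t - x); rewrite /ball/= sub0r normrN gtr0_norm// ltrBlDl => /(_ tr).
rewrite gt_eqF// => /(_ isT); rewrite [_ *: 1]mulr1 subrK ler_norml => /andP[+ _].
rewrite /GRing.scale/= => hh.
have : (t - x)^-1 * (f t - f x) <= l + e by lra.
by rewrite ler_pdivrMl// mulrC.
Unshelve. all: by end_near. Qed.

(** [lsc_majorant] needs a nonnegative function. Truncating below at -n and adding n provides one at
    an arbitrarily small cost in the integral. *)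
Lemma trunc_integral_le h a b e : 0 < e -> mu.-integrable `[a, b] (EFin \o h) ->
  exists n : nat, mu.-integrable `[a, b] (EFin \o (fun x => Num.max (h x) (- n%:R))) /\
    \int[mu]_(x in `[a, b]) Num.max (h x) (- n%:R) <= \int[mu]_(x in `[a, b]) h x + e.
Proof.
move=> e0 ih; have mh := int_meas ih.
have mD : measurable (`[a, b]%classic : set (measurableTypeR R)) by exact: measurable_itv.
have mm n : measurable_fun `[a, b] (fun x => Num.max (h x) (- (n : nat)%:R)).
  by apply: measurable_maxr => //; exact: measurable_cst.
have bnd (n : nat) x : `|Num.max (h x) (- n%:R)| <= `|h x|.
  rewrite /Num.max; case: ltP => // hn; rewrite normrN ger0_norm//.
  have n0 : 0 <= (n%:R : R) by [].
  rewrite ler0_norm; lra.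
have inorm := integrable_norm ih.
have im n : mu.-integrable `[a, b] (EFin \o (fun x => Num.max (h x) (- (n : nat)%:R))).
  by apply: (int_le mD (mm n) inorm) => x _; exact: bnd.
have := @dominated_convergence _ _ _ mu _ mD
  (fun n x => (Num.max (h x) (- n%:R))%:E) (EFin \o h) _ _ _ _ inorm.
case.
- by move=> n; apply/measurable_EFinP; exact: mm.
- exact/measurable_EFinP.
- apply: aeW => x _; apply: cvg_near_cst.
  exists (Num.truncn `|h x|).+1 => // n /= hn; congr EFin.
  have : `|h x| < n%:R.
    have /andP[_ h2] := truncn_itv (normr_ge0 (h x)).
    by rewrite (lt_le_trans h2)// ler_nat.
  move=> hxn; apply: max_l; rewrite lerNl (le_trans _ (ltW hxn))//.
  by rewrite -normrN ler_norm.
- by apply: aeW => x n _; rewrite lee_fin bnd.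
move=> _ _ cv.
have /fine_cvgP[_ /cvgrPdist_le/(_ _ e0)[n _ /(_ n (leqnn n))]] :
  (\int[mu]_(x in `[a, b]) (Num.max (h x) (- n%:R))%:E)%E @[n --> \oo] -->
     (fine (\int[mu]_(x in `[a, b]) (h x)%:E)%E)%:E.
  by rewrite fineK; [exact: cv|exact: integrable_fin_num].
rewrite /= -/(Rintegral _ _ _) distrC => H; exists n; split => //.
rewrite -lerBlDl; apply: le_trans H; exact: ler_norm.
Qed.

Lemma increment_le_integral f h a b : a < b -> {within `[a, b], continuous f} ->
  (forall x, x \in `]a, b[ -> derivable f x 1 /\ derive1 f x = h x) ->
  mu.-integrable `[a, b] (EFin \o h) ->
  f b - f a <= \int[mu]_(x in `[a, b]) h x.
Proof.
move=> ab cf df ih; apply/ler_addgt0Pr => e e0.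
have e2 : 0 < e / 2 by rewrite divr_gt0.
have mD : measurable (`[a, b]%classic : set (measurableTypeR R)) by exact: measurable_itv.
have [n [im hn]] := trunc_integral_le e2 ih.
have icst (c : R) : mu.-integrable `[a, b] (EFin \o (fun=> c)).
  apply: continuous_compact_integrable; first exact: segment_compact.
  by apply: continuous_subspaceT => x; exact: cvg_cst.
have iw := int_add mD im (icst n%:R).
have w0 x : 0 <= Num.max (h x) (- n%:R) + n%:R by rewrite -lerBlDr sub0r le_max lexx orbT.
have [v [iv vle vc]] := lsc_majorant ab e2 w0 iw.
have lenab : fine (mu `[a, b]%classic) = b - a.
  by rewrite lebesgue_measure_itv/= lte_fin ab.
rewrite RintegralD// Rintegral_cst// lenab in vle.
(* The function G(x) - n x - f(x) is shown to be locally nondecreasing to the right; comparing its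
   values at the endpoints gives the claim up to [e]. *)
pose G x := parameterized_integral mu a x v.
have cG : {within `[a, b], continuous G} by apply: parameterized_integral_continuous => //; exact: ltW.
have cH : {within `[a, b], continuous (fun x => G x - (n%:R * x + f x))}.
  move=> x; apply: cvgB; first exact: cG.
  apply: cvgD; last exact: cf.
  have : {within `[a, b], continuous (fun x => n%:R * x)}.
    by apply: continuous_subspaceT => y; apply: cvgM => //; exact: cvg_cst.
  exact.
have /(_ _)/= := right_increasing_le (ltW ab) cH.
have Ga : G a = 0 by rewrite /G /parameterized_integral set_itv1 Rintegral_set1.
rewrite Ga sub0r => H.
suff : - (n%:R * a + f a) <= G b - (n%:R * b + f b).
  by rewrite /G /parameterized_integral; move: vle hn; lra.
apply: H => x xab; have [c wc ct] := vc x xab; have [dx hx] := df x xab.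
(* This gap is the tolerance in the derivative of f: to the right of x, f grows by at most (c - n)(t
   - x) while G grows by at least c (t - x). *)
have eta0 : 0 < c - n%:R - h x.
  have : h x <= Num.max (h x) (- n%:R) by rewrite le_max lexx.
  move: wc; lra.
have dn := derivative_near dx hx eta0.
have /andP[ax xb] : a < x < b by move: xab; rewrite in_itv.
near=> t.
have xt : x < t by near: t; exact: nbhs_right_gt.
have ctt : c * (t - x) <= \int[mu]_(y in `[x, t]) v y by near: t.
have dtt : f t - f x <= (h x + (c - n%:R - h x)) * (t - x) by near: t.
have tb : t <= b by near: t; exact: nbhs_right_le.
have GG : G t - G x = \int[mu]_(y in `[x, t]) v y.
  have it : mu.-integrable `[a, t] (EFin \o v).
    by apply: integrableS iv => //; apply: subset_itv; rewrite bnd_simp.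
  rewrite /G /parameterized_integral Rintegral_itvB ?bnd_simp ?(ltW ax) ?(ltW xt)//.
  rewrite Rintegral_itv_obnd_cbnd//; apply: integrableS it => //.
  by apply: subset_itv; rewrite bnd_simp// ltW.
rewrite -GG in ctt; move: ctt dtt; nra.
Unshelve. all: by end_near. Qed.

Lemma FTC_integrable_derivative f h a b : a <= b -> {within `[a, b], continuous f} ->
  (forall x, x \in `]a, b[ -> derivable f x 1 /\ derive1 f x = h x) ->
  mu.-integrable `[a, b] (EFin \o h) ->
  \int[mu]_(x in `[a, b]) h x = f b - f a.
Proof.
rewrite le_eqVlt => /predU1P[<- _ _ _|ab cf df ih].
  by rewrite subrr set_itv1 Rintegral_set1.
have mD : measurable (`[a, b]%classic : set (measurableTypeR R)) by exact: measurable_itv.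
apply/eqP; rewrite eq_le increment_le_integral// andbT.
have := @increment_le_integral (fun x => - f x) (fun x => - h x) a b ab _ _ (int_opp ih).
have -> : \int[mu]_(x in `[a, b]) (- h x) = - \int[mu]_(x in `[a, b]) h x.
  by rewrite -[RHS]mulN1r -RintegralZl//; apply: eq_Rintegral => x _; rewrite mulN1r.
rewrite -opprB opprK addrC lerN2; apply.
  by move=> x; apply: cvgN; exact: cf.
move=> x xab; have [dx hx] := df x xab; split; first exact: derivableN.
by rewrite derive1E deriveN// -derive1E hx.
Qed.

End IntegrableDerivative.

(** * Centred Gaussian noise *)

Section ProbabilityFacts.
Context {R : realType} {d : measure_display} {W : measurableType d}.
Variable P : probability W R.
Implicit Types (X Y : W -> R) (f g : W -> \bar R).

(* [f] need not be measurable: the integral of a nonnegative function is the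
   supremum of the integrals of the simple functions below it. *)
Lemma le_lower_integral f g : (forall w, 0 <= f w)%E -> (forall w, 0 <= g w)%E ->
  measurable_fun setT g -> {ae P, forall w, (f w <= g w)%E} ->
  (\int[P]_w f w <= \int[P]_w g w)%E.
Proof.
move=> f0 g0 mg [N [mN N0 fgN]].
(* Setting g to +oo on the exceptional null set makes the inequality hold everywhere without
   changing the integral of g. *)
pose g' w := (g w + (+oo * (\1_N w)%:E))%E.
have mg' : measurable_fun setT g'.
  apply: emeasurable_funD => //; apply: emeasurable_funM => //.
  exact/measurable_EFinP.
have fg' w : (f w <= g' w)%E.
  rewrite /g' indicE; have [wN|wN] := boolP (w \in N).
    by rewrite mule1 addey ?leey// gt_eqF// (lt_le_trans _ (g0 w))// ltNye.
  rewrite mule0 adde0; apply: contrapT => H; move/negP: wN; apply.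
  by rewrite inE; apply: fgN.
have -> : (\int[P]_w g w = \int[P]_w g' w)%E.
  apply: ae_eq_integral => //; exists N; split => // w /= /not_implyP[_ H].
  apply: contrapT => wN; apply: H.
  by rewrite /g' indicE memNset// mule0 adde0.
have g'0 w : (0 <= g' w)%E by exact: le_trans (fg' w).
rewrite ge0_integralTE// [leRHS]ge0_integralTE//.
apply: le_ereal_sup => _ [h hf <-]; exists h => // w.
exact: le_trans (hf w) (fg' w).
Qed.

(** [Z] has the joint behaviour with [Y] that an independent copy of the law of [X] would have. It
    is used for both Z = X and Z = - X, which then give the same integral over one product
    measure. *)
Lemma joint_law (Z : W -> R) (X Y : {RV P >-> R}) : measurable_fun setT Z ->
  (forall A B : set R, measurable A -> measurable B ->
    P (Z @^-1` A `&` Y @^-1` B) = (P (X @^-1` A) * P (Y @^-1` B))%E) ->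
  P.-integrable setT (EFin \o (fun w => Z w * Y w)) ->
  (\int[distribution P X \x distribution P Y]_z (z.1 * z.2)%:E =
   \int[P]_w (Z w * Y w)%:E)%E.
Proof.
move=> mZ ZY iZY.
have mZY : measurable_fun setT (fun w => (Z w, Y w)) by exact: measurable_fun_pair.
pose V : {RV P >-> (R * R)%type} := HB.pack (fun w => (Z w, Y w)) (isMeasurableFun.Build _ _ _ _ _ mZY).
transitivity (\int[distribution P V]_z (z.1 * z.2)%:E)%E.
  apply: eq_measure_integral => A mA _.
  exact: product_measure_unique.
rewrite integral_distribution//.
by apply/measurable_EFinP; apply: measurable_funM; [exact: measurable_fst|exact: measurable_snd].
Qed.

(* [X] and [- X] having the same law, so do [(X, Y)] and [(- X, Y)]. *)
Lemma expectation_mul_symmetric (X Y : {RV P >-> R}) :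
  (forall A : set R, measurable A -> P (X @^-1` [set x | A (- x)]) = P (X @^-1` A)) ->
  (forall A B : set R, measurable A -> measurable B ->
    P (X @^-1` A `&` Y @^-1` B) = (P (X @^-1` A) * P (Y @^-1` B))%E) ->
  P.-integrable setT (EFin \o (fun w => X w * Y w)) ->
  \int[P]_w (X w * Y w) = 0.
Proof.
move=> sX XY iXY.
have mX : measurable_fun setT X by exact: measurable_funP.
have mN : measurable_fun setT (fun w => - X w) by exact: measurableT_comp.
have iN : P.-integrable setT (EFin \o (fun w => - X w * Y w)).
  by apply: eq_integrable (int_opp iXY) => // w _ /=; rewrite mulNr.
have e1 := joint_law mX XY iXY.
have e2 : (\int[distribution P X \x distribution P Y]_z (z.1 * z.2)%:E =
   \int[P]_w (- X w * Y w)%:E)%E.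
  apply: joint_law => // A B mA mB.
  have mA' : measurable [set x : R | A (- x)].
    by rewrite -[X in measurable X]setTI; exact: (@oppr_measurable R setT measurableT A mA).
  by rewrite -(sX A mA) -XY.
have : \int[P]_w (X w * Y w) = \int[P]_w (- X w * Y w) by rewrite /Rintegral -e1 -e2.
have -> : \int[P]_w (- X w * Y w) = - \int[P]_w (X w * Y w).
  by rewrite -[RHS]mulN1r -RintegralZl//; apply: eq_Rintegral => w _; rewrite mulN1r mulNr.
by lra.
Qed.

Lemma square_integrable_mul X Y : measurable_fun setT X -> measurable_fun setT Y ->
  P.-integrable setT (EFin \o (fun w => X w ^+ 2)) ->
  P.-integrable setT (EFin \o (fun w => Y w ^+ 2)) ->
  P.-integrable setT (EFin \o (fun w => X w * Y w)).
Proof.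
move=> mX mY iX iY; apply: (int_le measurableT _ (int_add measurableT iX iY)).
  exact: measurable_funM.
move=> w _; rewrite normrM -(real_normK (num_real (X w))) -(real_normK (num_real (Y w))).
have := sqr_ge0 (`|X w| - `|Y w|); have := normr_ge0 (X w); have := normr_ge0 (Y w).
by nra.
Qed.

Lemma second_moment_sum n (X : 'I_n -> {RV P >-> R}) (a : 'I_n -> R) (v : R) :
  (forall k, P.-integrable setT (EFin \o (fun w => X k w ^+ 2))) ->
  (forall k, \int[P]_w (X k w ^+ 2) <= v) ->
  (forall k l, k != l -> \int[P]_w (X k w * X l w) = 0) ->
  (\int[P]_w ((\sum_(k < n) a k * X k w) ^+ 2)%:E <= (v * \sum_(k < n) a k ^+ 2)%:E)%E.
Proof.
move=> iX vX oX.
have mX k : measurable_fun setT (X k) by exact: measurable_funP.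
have iXX k l := square_integrable_mul (mX k) (mX l) (iX k) (iX l).
have e w : (\sum_(k < n) a k * X k w) ^+ 2 =
    \sum_(k < n) \sum_(l < n) a k * a l * (X k w * X l w).
  rewrite expr2 big_distrl/=; apply: eq_bigr => k _; rewrite big_distrr/=.
  by apply: eq_bigr => l _; rewrite mulrACA.
have i1 k l : P.-integrable setT (EFin \o (fun w => a k * a l * (X k w * X l w))).
  exact: int_mull.
have i2 k : P.-integrable setT (EFin \o (fun w => \sum_(l < n) a k * a l * (X k w * X l w))).
  by apply: int_sum.
have i3 : P.-integrable setT (EFin \o (fun w => (\sum_(k < n) a k * X k w) ^+ 2)).
  under [X in EFin \o X]eq_fun do rewrite e.
  exact: int_sum.
rewrite -[leLHS]fineK; last exact: integrable_fin_num.
rewrite lee_fin -/(Rintegral _ _ _); under eq_Rintegral do rewrite e.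
rewrite Rintegral_sum// big_distrr/= ler_sum// => k _.
rewrite Rintegral_sum// (bigD1 k)//= big1 ?addr0.
  rewrite RintegralZl// -expr2 mulrC ler_wpM2r ?sqr_ge0//.
  by under eq_Rintegral do rewrite -expr2.
by move=> l lk; rewrite RintegralZl// oX ?mulr0// eq_sym.
Qed.

Lemma mutually_independent_pair (I : finType) (G : I -> set (set W)) i j A B :
  mutually_independent P G -> i != j -> (forall k, G k setT) -> G i A -> G j B ->
  P (A `&` B) = (P A * P B)%E.
Proof.
move=> ind ij GT GA GB.
(* The remaining indices receive the whole space, which does not affect the intersection. *)
pose E k := if k == i then A else if k == j then B else setT.
have := ind [set i; j]%SET E; rewrite big_setU1 ?inE//= big_set1 /E eqxx eq_sym (negbTE ij) eqxx.
move=> <-; last first.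
  by move=> k; rewrite /E; case: eqP => [->//|_]; case: eqP => [->|].
congr (P _); apply/seteqP; split => [w [wA wB] k /=|w H].
  by rewrite !inE => /orP[] /eqP ->; rewrite ?eqxx// eq_sym (negbTE ij).
split; first by have := H i; rewrite /= !inE eqxx => /(_ isT).
by have := H j; rewrite /= !inE eqxx orbT eq_sym (negbTE ij) => /(_ isT).
Qed.

End ProbabilityFacts.

(** * Symmetry and second moment of the normal law *)

Section Gaussian.
Context {R : realType}.
Notation mu := (@lebesgue_measure R).
Implicit Types (s x : R).

Lemma normal_prob_sym s (A : set R) : s != 0 -> measurable A ->
  normal_prob 0 s [set x | A (- x)] = normal_prob 0 s A.
Proof.
move=> s0 mA; rewrite /normal_prob.
have pN x : normal_pdf 0 s (- x) = normal_pdf 0 s x.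
  by rewrite normal_pdfE// /normal_fun !subr0 sqrrN.
have mp (D : set (measurableTypeR R)) : measurable_fun D (EFin \o normal_pdf 0 s).
  by apply/measurable_EFinP; apply: measurable_funTS; exact: measurable_normal_pdf.
transitivity (\int[pushforward mu (-%R : R -> measurableTypeR R)]_(x in A) (normal_pdf 0 s x)%:E)%E.
  rewrite ge0_integral_pushforward//=; last first.
    by move=> x _; rewrite lee_fin normal_pdf_ge0.
  by apply: eq_integral => x _; rewrite /= pN.
by apply: eq_measure_integral => //= B mB _; exact: lebesgue_measureN.
Qed.

(** The Radon-Nikodym derivative and [normal_pdf] have equal integrals over every measurable set,
    hence agree almost everywhere. *)
Lemma ge0_integral_normal_prob m s (f : R -> \bar R) : measurable_fun setT f ->
  (forall x, 0 <= f x)%E ->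
  (\int[normal_prob m s]_x f x = \int[mu]_x (f x * (normal_pdf m s x)%:E))%E.
Proof.
move=> mf f0; have dom := @normal_prob_dominates R m s.
rewrite -(Radon_Nikodym_SigmaFinite.change_of_variables dom)//.
apply: ae_eq_integral => //.
- apply: emeasurable_funM => //.
  exact: measurable_int (Radon_Nikodym_SigmaFinite.f_integrable dom).
- apply: emeasurable_funM => //; apply/measurable_EFinP; exact: measurable_normal_pdf.
- apply: ae_eqe_mul2l; apply: integral_ae_eq => //.
  + exact: Radon_Nikodym_SigmaFinite.f_integrable.
  + by apply/measurable_EFinP; exact: measurable_normal_pdf.
  + by move=> E _ mE; rewrite -Radon_Nikodym_SigmaFinite.f_integral.
Qed.

Lemma gauss_exponent_split s x : s != 0 ->
  - x ^+ 2 / (s ^+ 2 *+ 2) =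
  - x ^+ 2 / ((2 * s) ^+ 2 *+ 2) - 3 / 8 * x ^+ 2 / s ^+ 2.
Proof. by move=> s0; field. Qed.

Lemma normal_peakM s : normal_peak (2 * s) = 2^-1 * normal_peak s.
Proof.
rewrite /normal_peak.
have -> : ((2 * s) ^+ 2 * pi *+ 2 : R) = 2 ^+ 2 * (s ^+ 2 * pi *+ 2).
  by rewrite exprMn -!mulrnAr mulrA.
by rewrite sqrtrM ?sqr_ge0// sqrtr_sqr ger0_norm// invfM.
Qed.

(** Doubling the deviation frees a factor exp(-y) with y = 3 x^2 / (8 s^2). Then y exp(-y) <= 1
    absorbs x^2 at the cost (8/3) s^2, and the peaks differ by a factor 2: 16/3 <= 6. This avoids
    computing the exact variance. *)
Lemma sqr_gauss_le s x : 0 < s ->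
  x ^+ 2 * normal_pdf 0 s x <= 6 * s ^+ 2 * normal_pdf 0 (2 * s) x.
Proof.
move=> s0; have sn0 : s != 0 by rewrite gt_eqF.
rewrite !normal_pdfE ?mulf_neq0// normal_peakM /normal_fun subr0.
have p0 := normal_peak_ge0 s.
pose y := 3 / 8 * x ^+ 2 / s ^+ 2.
have y0 : 0 <= y by rewrite /y divr_ge0 ?sqr_ge0// mulr_ge0 ?sqr_ge0.
rewrite gauss_exponent_split// -/y.
rewrite expRD; set q := expR (- x ^+ 2 / _).
have q0 : 0 <= q by exact: expR_ge0.
have xy : x ^+ 2 = 8 / 3 * s ^+ 2 * y.
  by rewrite /y; move: (sn0); clear; move=> sn0; field.
have ye : y * expR (- y) <= 1.
  rewrite expRN ler_pdivrMr ?expR_gt0// mul1r.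
  by have := expR_ge1Dx y; lra.
rewrite xy; have s2 : 0 <= s ^+ 2 by exact: sqr_ge0.
move: (normal_peak s) p0 q q0 (s ^+ 2) s2 ye => p p0 q q0 t t0 ye.
have : p * q * t * (y * expR (- y)) <= p * q * t * 1.
  by rewrite ler_wpM2l// !mulr_ge0.
have : 0 <= p * q * t by rewrite !mulr_ge0.
by move: (expR (- y)) => E; nra.
Qed.

Lemma normal_second_moment s : 0 < s ->
  (\int[normal_prob 0 s]_x (x ^+ 2)%:E <= (6 * s ^+ 2)%:E)%E.
Proof.
move=> s0; have sn0 : s != 0 by rewrite gt_eqF.
have mx : measurable_fun [set: R] (fun x : R => (x ^+ 2)%:E).
  by apply/measurable_EFinP; apply: measurable_funX; exact: measurable_id.
have mp t : measurable_fun [set: R] (fun x => (normal_pdf 0 t x)%:E).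
  by apply/measurable_EFinP; exact: measurable_normal_pdf.
rewrite ge0_integral_normal_prob//; last by move=> x; rewrite lee_fin sqr_ge0.
apply: (@le_trans _ _ (\int[mu]_x ((6 * s ^+ 2)%:E * (normal_pdf 0 (2 * s) x)%:E))%E).
  apply: ge0_le_integral => //.
  - by move=> x _; rewrite -EFinM lee_fin mulr_ge0 ?sqr_ge0 ?normal_pdf_ge0.
  - exact: (emeasurable_funM mx (mp s)).
  - by apply: (emeasurable_funM (measurable_cst _) (mp (2 * s))).
  - by move=> x _; rewrite -!EFinM lee_fin sqr_gauss_le.
rewrite ge0_integralZl_EFin//.
- by rewrite integral_normal_pdf mule1.
- by move=> x _; rewrite lee_fin normal_pdf_ge0.
- exact: mp.
- by rewrite mulr_ge0 ?sqr_ge0.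
Qed.

End Gaussian.

(** * Riemann sums of continuous functions *)

Section Riemann.
Context {R : realType}.
Notation mu := (@lebesgue_measure R).
Implicit Types (f : R -> R).

Lemma within_dist f (D : set R) x e : {within D, continuous f} -> D x -> 0 < e ->
  exists2 r, 0 < r & forall y, D y -> `|x - y| < r -> `|f x - f y| <= e.
Proof.
move=> /subspace_continuousP cf Dx e0.
have /cvgrPdist_le/(_ _ e0)/nbhs_ballP[r /= r0 hr] := cf x Dx.
by exists r => // y Dy xy; exact: hr.
Qed.

(** Right-endpoint step functions converge pointwise and boundedly, so dominated convergence
    applies. Right endpoints keep the sample times positive, where the Gaussian law is
    nondegenerate. *)
Lemma riemann_sum_cvg f (T : R) : 0 < T -> {within `[0, T], continuous f} ->
  T / m.+1%:R * \sum_(j < m.+1) f (T * j.+1%:R / m.+1%:R) @[m --> \oo] -->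
  \int[mu]_(s in `[0, T]) f s.
Proof.
move=> T0 cf; have if_ : mu.-integrable `[0, T] (EFin \o f).
  by apply: continuous_compact_integrable => //; exact: segment_compact.
have mf := int_meas if_.
have mD : measurable (`[0, T[%classic : set (measurableTypeR R)) by exact: measurable_itv.
have sD : `[0, T[%classic `<=` `[0, T]%classic by exact: subset_itv_co_cc.
have ifo : mu.-integrable `[0, T[ (EFin \o f) by apply: integrableS if_.
have [c cT Hc] : exists2 c : R, 0 <= c & forall s : R, s \in `[0, T] -> `|f s| <= c.
  have T0' := ltW T0.
  have [a a1 a2] := EVT_max T0' cf; have [b b1 b2] := EVT_min T0' cf.
  exists (`|f a| + `|f b|); first by rewrite addr_ge0.
  move=> s sT; have := a2 s sT; have := b2 s sT; rewrite ler_norml.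
  have := ler_norm (f a); have := ler_norm (- f b); rewrite normrN.
  have := normr_ge0 (f a); have := normr_ge0 (f b).
  by move=> *; apply/andP; split; lra.
pose t m j : R := T * j%:R / m.+1%:R.
pose fm (m : nat) (s : R) : R := \sum_(j < m.+1) f (t m j.+1) * \1_(`[t m j, t m j.+1[%classic : set R) s.
(* The cell containing s has index the integer part of (m + 1) s / T. *)
have tm m (s : R) : s \in `[0, T[ ->
    [/\ fm m s = f (t m (Num.truncn (m.+1%:R * s / T)).+1),
      t m (Num.truncn (m.+1%:R * s / T)).+1 \in `[0, T] &
      `|s - t m (Num.truncn (m.+1%:R * s / T)).+1| <= T / m.+1%:R].
  rewrite in_itv/= => /andP[s0 sT]; set k := Num.truncn _.
  have m0 : 0 < (m.+1%:R : R) by [].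
  have /andP[k1 k2] : k%:R <= m.+1%:R * s / T < k.+1%:R.
    by apply: truncn_itv; rewrite divr_ge0 ?mulr_ge0// ltW.
  have tx j : (t m j <= s) = (j%:R <= m.+1%:R * s / T).
    by rewrite /t ler_pdivrMr// ler_pdivlMr// [T * _]mulrC [s * _]mulrC.
  have mem j : (s \in `[t m j, t m j.+1[) = (j == k).
    rewrite in_itv/= tx [s < _]ltNge tx -ltNge; apply/idP/idP => [/andP[j1 j2]|/eqP ->].
      have := le_lt_trans j1 k2; have := le_lt_trans k1 j2.
      by rewrite !ltr_nat !ltnS => j3 j4; rewrite eqn_leq j3 j4.
    by rewrite k1 k2.
  have km : (k < m.+1)%N.
    rewrite -(ltr_nat R); apply: (le_lt_trans k1).
    by rewrite ltr_pdivrMr// ltr_pM2l.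
  split.
  - rewrite /fm (bigD1 (Ordinal km))//= big1 ?addr0.
      by rewrite indicE mem_setE mem eqxx mulr1.
    by move=> j jk; rewrite indicE mem_setE mem (negbTE (_ : (j : nat) != k)) ?mulr0.
  - rewrite in_itv/= /t; apply/andP; split; first by rewrite divr_ge0// mulr_ge0// ltW.
    by rewrite ler_pdivrMr// ler_pM2l// ler_nat.
  - have : s \in `[t m k, t m k.+1[ by rewrite mem.
    rewrite in_itv/= => /andP[h1 h2].
    have e : t m k.+1 = t m k + T / m.+1%:R by rewrite /t -[k.+1%:R]natr1; ring.
    by rewrite ler0_norm ?subr_le0 ?(ltW h2)// e opprB lerBlDr [leLHS]addrC lerD2l.
have mfm m : measurable_fun `[0, T[ (fm m).
  apply: measurable_sum => j; apply: measurable_funM; first exact: measurable_cst.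
  by apply: measurable_funTS; apply: measurable_indic; exact: measurable_itv.
have ic : mu.-integrable `[0, T[ (EFin \o (fun=> c)).
  have : mu.-integrable `[0, T] (EFin \o (fun=> c)).
    apply: continuous_compact_integrable; first exact: segment_compact.
    by apply: continuous_subspaceT => x; exact: cvg_cst.
  exact: integrableS.
have := @dominated_convergence _ _ _ mu _ mD (fun m s => (fm m s)%:E) (EFin \o f) _ _ _ _ ic.
case.
- by move=> m; apply/measurable_EFinP; exact: mfm.
- exact: measurable_int ifo.
- apply: aeW => s sT; apply: cvg_EFin; first exact: nearW.
  apply/cvgrPdist_le => e e0.
  have [r r0 hr] := within_dist cf (sD _ sT) e0.
  exists (Num.truncn (T / r)).+1 => // m /= hm.
  have [-> h2 h3] := tm m s sT; apply: hr => //; apply: le_lt_trans h3 _.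
  rewrite ltr_pdivrMr// mulrC -ltr_pdivrMr//.
  have /andP[_ h4] : (Num.truncn (T / r))%:R <= T / r < (Num.truncn (T / r)).+1%:R.
    by apply: truncn_itv; rewrite divr_ge0// ltW.
  by rewrite (lt_le_trans h4)// ler_nat ltnW// ltnS.
- apply: aeW => s m sT; rewrite lee_fin.
  by have [-> h2 _] := tm m s sT; exact: Hc.
move=> _ _ cv.
have e1 : \int[mu]_(s in `[0, T]) f s = \int[mu]_(s in `[0, T[) f s.
  by rewrite Rintegral_itv_bndo_bndc.
have e2 m : T / m.+1%:R * \sum_(j < m.+1) f (T * j.+1%:R / m.+1%:R) =
    \int[mu]_(s in `[0, T[) fm m s.
  have i1 (j : 'I_m.+1) : mu.-integrable `[0, T[ (EFin \o (\1_(`[t m j, t m j.+1[%classic : set R) : R -> R)).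
    by apply: integrableS (integrable_indic_itv _ _ _ _).
  rewrite Rintegral_sum//; last by move=> j _; apply: int_mull.
  rewrite big_distrr/=; apply: eq_bigr => j _; rewrite (RintegralZl _ mD (i1 j)).
  have m0 : 0 < (m.+1%:R : R) by [].
  have tt : t m j < t m j.+1.
    by rewrite /t ltr_pM2r ?invr_gt0// ltr_pM2l// ltr_nat.
  rewrite /Rintegral integral_indic//.
  have -> : (`[t m j, t m j.+1[ `&` `[0, T[)%classic = `[t m j, t m j.+1[%classic.
    apply: setIidl => s; rewrite /= !in_itv/= => /andP[h1 h2]; apply/andP; split.
      by apply: le_trans h1; rewrite /t divr_ge0// mulr_ge0// ltW.
    apply: lt_le_trans h2 _; rewrite /t ler_pdivrMr// ler_pM2l// ler_nat.
    exact: ltn_ord.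
  have mt : mu `[t m j, t m j.+1[%classic = (t m j.+1 - t m j)%:E.
    by have := @lebesgue_measure_itv R `[t m j, t m j.+1[; rewrite /= lte_fin tt.
  transitivity (f (t m j.+1) * fine (mu `[t m j, t m j.+1[%classic)); last by [].
  rewrite mt/= mulrC; congr (_ * _).
  by rewrite /t -[j.+1%:R]natr1; ring.
rewrite e1; under eq_fun do rewrite e2.
have fin : (\int[mu]_(s in `[0%R, T[) (f s)%:E)%E \is a fin_num by exact: integrable_fin_num.
by apply: fine_cvg; rewrite fineK.
Qed.

End Riemann.

(** * Weighted sums of independent Gaussians and Brownian marginals *)

Section GaussianNoise.
Context {R : realType} {d : measure_display} {W : measurableType d}.
Variable P : probability W R.
Implicit Types (X : {RV P >-> R}).

Lemma gaussian_rv X (s : R) : 0 < s ->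
  (forall A : set R, measurable A -> P (X @^-1` A) = normal_prob 0 s A) ->
  [/\ forall A : set R, measurable A -> P (X @^-1` [set x | A (- x)]) = P (X @^-1` A),
      P.-integrable setT (EFin \o (fun w => X w ^+ 2)) &
      \int[P]_w (X w ^+ 2) <= 6 * s ^+ 2].
Proof.
move=> s0 HX.
have mX : measurable_fun setT X by exact: measurable_funP.
have m2 : measurable_fun [set: R] (fun x : R => (x ^+ 2)%:E).
  by apply/measurable_EFinP; apply: measurable_funX; exact: measurable_id.
have e : (\int[P]_w (X w ^+ 2)%:E = \int[normal_prob 0 s]_x (x ^+ 2)%:E)%E.
  have mX' : measurable_fun setT (X : W -> measurableTypeR R) by exact: mX.
  have p0 (y : measurableTypeR R) : (0 <= (y ^+ 2)%:E)%E by rewrite lee_fin sqr_ge0.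
  have m2' : measurable_fun setT (fun x : measurableTypeR R => (x ^+ 2)%:E) by exact: m2.
  have E := @ge0_integral_pushforward _ _ W (measurableTypeR R) R X mX' P setT (fun x => (x ^+ 2)%:E) measurableT m2' (fun y _ => p0 y).
  rewrite preimage_setT/= in E; rewrite -E.
  by apply: eq_measure_integral => A mA _; exact: HX.
have le := normal_second_moment s0; rewrite -e in le.
have i2 : P.-integrable setT (EFin \o (fun w => X w ^+ 2)).
  apply/integrableP; split.
    by apply/measurable_EFinP; exact: measurable_funX.
  under eq_integral do rewrite gee0_abs ?lee_fin ?sqr_ge0//.
  by apply: le_lt_trans le _; rewrite ltry.
split => //.
- move=> A mA; rewrite !HX//; first by apply: normal_prob_sym => //; rewrite gt_eqF.
  by rewrite -[X in measurable X]setTI; exact: (@oppr_measurable R setT measurableT A mA).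
- by rewrite -lee_fin /Rintegral fineK//; exact: integrable_fin_num.
Qed.

Lemma gaussian_noise n (X : 'I_n -> {RV P >-> R}) (a : 'I_n -> R) (s : R) : 0 < s ->
  (forall k (A : set R), measurable A -> P (X k @^-1` A) = normal_prob 0 s A) ->
  (forall k l (A B : set R), k != l -> measurable A -> measurable B ->
    P (X k @^-1` A `&` X l @^-1` B) = (P (X k @^-1` A) * P (X l @^-1` B))%E) ->
  (\int[P]_w ((\sum_(k < n) a k * X k w) ^+ 2)%:E <=
   (6 * s ^+ 2 * \sum_(k < n) a k ^+ 2)%:E)%E.
Proof.
move=> s0 lX iX; have H k := gaussian_rv s0 (lX k).
apply: second_moment_sum => [k|k|k l kl]; [by have [] := H k|by have [] := H k|].
have [sk ik _] := H k; have [_ il _] := H l.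
apply: expectation_mul_symmetric => //.
  by move=> A B mA mB; exact: iX.
apply: square_integrable_mul => //; exact: measurable_funP.
Qed.

Lemma ae_law (X Y : W -> R) (A : set R) : measurable_fun setT X -> measurable_fun setT Y ->
  {ae P, forall w, X w = Y w} -> measurable A -> P (X @^-1` A) = P (Y @^-1` A).
Proof.
move=> mX mY XY mA.
have mXA : measurable (X @^-1` A) by rewrite -[X in measurable X]setTI; exact: mX.
have mYA : measurable (Y @^-1` A) by rewrite -[X in measurable X]setTI; exact: mY.
rewrite -(setIT (X @^-1` A)) -(setIT (Y @^-1` A)) -!integral_indic//.
apply: ae_eq_integral => //; try by apply/measurable_EFinP; exact: measurable_indic.
apply: filterS XY => w XYw _; rewrite !indicE; congr (_%:R)%:E; congr nat_of_bool.
by apply/idP/idP; rewrite !inE /preimage/= XYw.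
Qed.

(** The law is that of the increment from time 0, where the path vanishes only almost surely;
    [ae_law] bridges the difference. *)
Lemma brownian_law (T : R) (B : R -> {RV P >-> R}) (t : R) (A : set R) :
  std_brownian T B -> 0 < t -> t <= T -> measurable A ->
  P (B t @^-1` A) = normal_prob 0 (Num.sqrt t) A.
Proof.
move=> [B0 inc _ _] t0 tT mA; have := inc 0 t (lexx 0) t0 tT A mA.
have m1 : measurable_fun setT (B t) by exact: measurable_funP.
have m2 : measurable_fun setT (B t \- B 0).
  by apply: measurable_funB => //; exact: measurable_funP.
rewrite subr0 => <-; apply: (ae_law m1 m2) => //.
by apply: filterS B0 => w /= ->; rewrite subr0.
Qed.

End GaussianNoise.

(** * The pathwise estimate *)

Section TimeRegularity.
Context {R : realType}.
Notation mu := (@lebesgue_measure R).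
Implicit Types (T t s K A : R) (v w : R -> R -> R) (f h : R -> R).

Lemma within_cc_measurable f (a b : R) : {within `[a, b], continuous f} ->
  measurable_fun `[a, b] f.
Proof. by move=> cf; apply: subspace_continuous_measurable_fun. Qed.

Lemma within_cc_integrable f (a b : R) : {within `[a, b], continuous f} ->
  mu.-integrable `[a, b] (EFin \o f).
Proof. by move=> cf; apply: continuous_compact_integrable => //; exact: segment_compact. Qed.

Lemma continuous_expM (c t : R) : continuous (fun s : R => expR ((s - t) * c)).
Proof.
move=> s; apply: (@continuous_comp _ _ _ (fun s => (s - t) * c) expR); last exact: continuous_expR.
by apply: cvgMl; apply: cvgB; [exact: cvg_id|exact: cvg_cst].
Qed.

Lemma int_expM (a b c t : R) h : mu.-integrable `[a, b] (EFin \o h) ->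
  mu.-integrable `[a, b] (EFin \o (fun s => expR ((s - t) * c) * h s)).
Proof.
move=> ih; have mD : measurable (`[a, b]%classic : set (measurableTypeR R)) by exact: measurable_itv.
have [ab|ba] := leP a b; last first.
  have -> : `[a, b]%classic = set0 :> set R by rewrite set_itv_ge// bnd_simp -ltNge.
  exact: integrable_set0.
have ce : {within `[a, b], continuous (fun s : R => expR ((s - t) * c))}.
  exact/continuous_subspaceT/continuous_expM.
have [m m1 m2] := EVT_max ab ce.
apply: (@int_le _ _ _ _ _ mD _ (fun s => expR ((m - t) * c) * `|h s|)).
- have mh := int_meas ih.
  by apply: measurable_funM; [exact: within_cc_measurable|exact: mh].
- by apply: int_mull => //; exact: (integrable_norm ih).
- move=> s sab; rewrite normrM ler_wpM2r// ger0_norm ?expR_ge0//; exact: m2.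
Qed.

(** The derivative is the pointwise limit of difference quotients with step 1 / (m + 1). The shifted
    point is capped at [b], which keeps it where f is known to be measurable and changes nothing for
    large m. *)
Lemma measurable_derive1_oo f (a b : R) : {within `[a, b], continuous f} ->
  (forall x, x \in `]a, b[ -> derivable f x 1) -> measurable_fun `]a, b[ (derive1 f).
Proof.
move=> cf df.
have mD : measurable (`[a, b]%classic : set (measurableTypeR R)) by exact: measurable_itv.
have mf : measurable_fun `[a, b] f by exact: within_cc_measurable.
have H := @measurable_fun_cvg _ R R `]a, b[%classic
  (fun m x => m.+1%:R * (f (Order.min (x + m.+1%:R^-1) b) - f x)) (derive1 f).
apply: H => [m|x /= xab].
  apply: measurable_funM; first exact: measurable_cst.
  apply: measurable_funB; last first.
    by apply: measurable_funS mf => //; exact: subset_itv_oo_cc.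
  have H := @measurable_comp _ _ _ R R R `[a, b]%classic f `]a, b[%classic (fun x => Order.min (x + m.+1%:R^-1) b).
  apply: H => //.
    move=> _ [x /= + <-]; rewrite !in_itv/= => /andP[ax xb].
    rewrite ge_min lexx orbT andbT le_min (ltW (lt_trans ax xb)) andbT.
    by rewrite (le_trans (ltW ax))// lerDl invr_ge0.
  apply: measurable_minr; last exact: measurable_cst.
  by apply: measurable_funD; [exact: measurable_id|exact: measurable_cst].
have : (fun s => s^-1 *: (f (s *: 1 + x) - f x)) @ 0^' --> derive1 f x.
  by rewrite derive1E; exact: df.
move=> cv; apply/cvgrPdist_le => e e0.
have /cvgrPdist_le/(_ _ e0)/nbhs_ballP[r /= r0 hr] := cv.
have xb : 0 < b - x by move: xab; rewrite in_itv/= subr_gt0 => /andP[].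
near=> m; have m0 : 0 < (m.+1%:R^-1 : R) by rewrite invr_gt0.
have mr : m.+1%:R^-1 < Order.min r (b - x).
  by near: m; apply: near_infty_natSinv_lt (PosNum _); rewrite lt_min r0.
move: mr; rewrite lt_min => /andP[mr mb].
have -> : Order.min (x + m.+1%:R^-1) b = x + m.+1%:R^-1.
  by apply/min_idPl; rewrite addrC -lerBrDr ltW.
have := hr m.+1%:R^-1; rewrite /ball/= sub0r normrN gtr0_norm// => /(_ mr).
by rewrite gt_eqF// => /(_ isT); rewrite [_ *: 1]mulr1 invrK [_ + x]addrC.
Unshelve. all: by end_near. Qed.

(** With the rate 3 K, the comparison function w satisfies K int_s^T w = (w(s) - 1) / 3, so the
    integral term absorbs only a third of the left side. *)
Lemma backward_gronwall (T K A : R) (y : R -> R) : 0 <= T -> 0 < K -> 0 <= A ->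
  {within `[0, T], continuous y} ->
  (forall t, t \in `[0, T] -> y t <= A + K * \int[mu]_(s in `[t, T]) y s) ->
  forall t, t \in `[0, T] -> y t <= 3 / 2 * A * expR (3 * K * (T - t)).
Proof.
move=> T0 K0 A0 cy Hy.
pose w (s : R) : R := expR (3 * K * (T - s)).
have w0 s : 0 < w s by exact: expR_gt0.
have wV s : w s * expR (- (3 * K * (T - s))) = 1 by rewrite /w expRxMexpNx_1.
have cw : continuous w.
  move=> s; apply: (@continuous_comp _ _ _ (fun s => 3 * K * (T - s)) expR); last exact: continuous_expR.
  by apply: cvgMr; apply: cvgB; [exact: cvg_cst|exact: cvg_id].
have cwi : continuous (fun s => expR (- (3 * K * (T - s)))).
  move=> s; apply: (@continuous_comp _ _ _ (fun s => - (3 * K * (T - s))) expR); last exact: continuous_expR.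
  by apply: cvgN; apply: cvgMr; apply: cvgB; [exact: cvg_cst|exact: cvg_id].
have cz : {within `[0, T], continuous (fun s => y s * expR (- (3 * K * (T - s))))}.
  move=> s; apply: cvgM; first exact: cy.
  exact: continuous_subspaceT.
(* [B] is the maximum of y / w, attained at [s0]; the integral inequality is evaluated there. *)
have [s0 s0T ms0] := EVT_max T0 cz; set B := y s0 * _ in ms0.
have yB s : s \in `[0, T] -> y s <= B * w s.
  move=> /ms0 /=; rewrite -(ler_pM2r (w0 s)); apply: le_trans.
  by rewrite -[y s * _ * _]mulrA [expR _ * w _]mulrC wV mulr1.
have dw (s : R) : is_derive s 1 (fun s => - (3 * K)^-1 * w s) (w s).
  rewrite /w; apply: is_derive_eq; rewrite /GRing.scale/=.
  have := gt_eqF K0; set E := expR _ => K1; field.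
  by rewrite K1.
have Hs : y s0 <= A + B / 3 * (w s0 - 1).
  apply: le_trans (Hy _ s0T) _; rewrite lerD2l.
  have s0T' : s0 <= T by move: s0T; rewrite in_itv/= => /andP[].
  have e : \int[mu]_(s in `[s0, T]) w s = (3 * K)^-1 * (w s0 - 1).
    rewrite (FTC_is_derive s0T' dw cw).
    by rewrite {1}/w subrr mulr0 expR0; ring.
  have -> : B / 3 * (w s0 - 1) = K * \int[mu]_(s in `[s0, T]) (B * w s).
    rewrite RintegralZl//; last exact/within_cc_integrable/continuous_subspaceT.
    rewrite e; have := gt_eqF K0 => K1; field.
    by rewrite K1.
  rewrite ler_wpM2l ?(ltW K0)//; apply: le_Rintegral => //.
  - apply: within_cc_integrable; apply: continuous_subspaceW cy.
    by apply: subset_itvr; rewrite bnd_simp; move: s0T; rewrite in_itv/= => /andP[].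
  - apply: within_cc_integrable; apply: continuous_subspaceT => s.
    by apply: cvgMr; exact: cw.
  - move=> s /=; rewrite in_itv/= => /andP[h1 h2]; apply: yB; rewrite in_itv/= h2 andbT.
    by apply: le_trans h1; move: s0T; rewrite in_itv/= => /andP[].
have w1 : 1 <= w s0.
  rewrite /w -expR0 ler_expR mulr_ge0 ?subr_ge0//; first by rewrite mulr_ge0// ltW.
  by move: s0T; rewrite in_itv/= => /andP[].
have eB : B * w s0 = y s0 by rewrite /B -[y s0 * _ * _]mulrA [expR _ * w _]mulrC wV mulr1.
rewrite -eB in Hs; have BA : B <= 3 / 2 * A.
  (* For B > 0, discarding -B/3 leaves (2/3) B w(s0) <= A, and w(s0) >= 1. *)
  have [B0|B0] := leP B 0; first by apply: le_trans B0 _; rewrite mulr_ge0.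
  by clear -Hs w1 B0; move: B (w s0) Hs w1 B0 => b x; nra.
move=> t tT; apply: le_trans (yB t tT) _.
by rewrite ler_pM2r.
Qed.

End TimeRegularity.

(** * Fourier coefficients in time and Duhamel's formula *)

Section TimeDependentCoefficients.
Context {R : realType}.
Notation mu := (@lebesgue_measure R).
Implicit Types (T t s K A beta : R) (v w u g : R -> R -> R) (f h F uT : R -> R) (p : nat).

(** A quantity that is Lipschitz in the L^2 norm inherits continuity in time; this serves the
    coefficients of v, those of F(v), and the norm. *)
Lemma C0L2_continuous T v h (c : R) : C0L2 T v -> 0 < c ->
  (forall s t, s \in `[0, T] -> t \in `[0, T] ->
    `|h s - h t| <= c * nrmL2 (fun x => v s x - v t x)) ->
  {within `[0, T], continuous h}.
Proof.
move=> [Lv cv] c0 hc; apply/subspace_continuousP => t0 t0T.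
have /fine_cvgP[_ /cvgrPdist_le H] := cv t0 t0T.
apply/cvgrPdist_le => e e0.
have /nbhs_ballP[r /= r0 hr] := H (e / c) (divr_gt0 e0 c0).
apply/nbhs_ballP; exists r => //= t rt tT.
rewrite distrC; apply: le_trans (hc _ _ tT t0T) _; rewrite mulrC -ler_pdivlMr//.
have := hr _ rt tT; rewrite /= sub0r normrN normL2E ?ger0_norm//=.
by apply: L2OmegaB; apply: Lv.
Qed.

Lemma nrm_phi p : nrmL2 (phi p : R -> R) = 1.
Proof. by rewrite nrmL2.unlock phi_ortho eqxx sqrtr1. Qed.

Lemma coef_le p f : L2Omega f -> `|coef p f| <= nrmL2 f.
Proof. by move=> Lf; have := innerL2_le_nrm Lf (L2Omega_phi p); rewrite nrm_phi mulr1. Qed.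

Lemma coefB p f h : L2Omega f -> L2Omega h ->
  coef p (fun x => f x - h x) = coef p f - coef p h.
Proof. by move=> Lf Lh; rewrite /coef innerL2Bl. Qed.

Lemma C0L2_coef T v p : C0L2 T v -> {within `[0, T], continuous (fun t => coef p (v t))}.
Proof.
move=> cv; apply: (C0L2_continuous cv ltr01) => s t sT tT.
rewrite mul1r -coefB; [|exact: cv.1|exact: cv.1].
by apply: coef_le; apply: L2OmegaB; apply: cv.1.
Qed.

Lemma C0L2_coef_lip T v p F K : C0L2 T v -> 0 < K ->
  (forall y z, `|F y - F z| <= K * `|y - z|) ->
  {within `[0, T], continuous (fun t => coef p (F \o v t))}.
Proof.
move=> cv K0 FK; apply: (C0L2_continuous cv K0) => s t sT tT.
have Ls := L2Omega_lip FK (cv.1 _ sT); have Lt := L2Omega_lip FK (cv.1 _ tT).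
rewrite -coefB//; apply: le_trans (nrmL2_lip FK (cv.1 _ sT) (cv.1 _ tT)).
by apply: coef_le; exact: L2OmegaB.
Qed.

Lemma C0L2B T v w : C0L2 T v -> C0L2 T w -> C0L2 T (fun t x => v t x - w t x).
Proof.
move=> [Lv cv] [Lw cw]; split => [t tT|t0 t0T]; first by apply: L2OmegaB; [exact: Lv|exact: Lw].
have Lvw t : t \in `[0, T] -> L2Omega (fun x => v t x - w t x).
  by move=> tT; apply: L2OmegaB; [exact: Lv|exact: Lw].
have /fine_cvgP[_ H1] := cv t0 t0T; have /fine_cvgP[_ H2] := cw t0 t0T.
apply/fine_cvgP; split.
  apply: filterS (withinT _ _) => t tT.
  by rewrite normL2E//; apply: L2OmegaB; exact: Lvw.
have FF : Filter (within `[0, T]%classic (nbhs t0)) by exact: within_filter.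
have H3 := cvgD H1 H2; rewrite addr0 in H3.
apply: (squeeze_cvgr _ (cvg_cst (0 : R)) (H3 FF)).
apply: filterS (withinT _ _) => t tT /=; apply/andP; split.
  by rewrite normL2E//=; apply: L2OmegaB; exact: Lvw.
have Lv' := L2OmegaB (Lv _ tT) (Lv _ t0T); have Lw' := L2OmegaB (Lw _ tT) (Lw _ t0T).
rewrite /= normL2E//=; last by apply: L2OmegaB; exact: Lvw.
apply: le_trans (_ : nrmL2 (fun x => (v t x - v t0 x) - (w t x - w t0 x)) <= _).
  by rewrite le_eqVlt; apply/orP; left; apply/eqP; apply: eq_nrmL2 => x _ /=; ring.
have e : (fun x => (v t x - v t0 x) - (w t x - w t0 x)) =
   (fun x => (v t x - v t0 x) + (-1) * (w t x - w t0 x)).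
  by apply/funext => x; ring.
rewrite e; apply: le_trans (nrmL2_leD Lv' (L2OmegaZ _ Lw')) _.
rewrite (nrmL2Z (-1) Lw') normrN1 mul1r.
by rewrite -[leRHS]/(fine (normL2 (v t \- v t0)) + fine (normL2 (w t \- w t0))) !normL2E.
Qed.

Lemma C0L2_nrm T v : C0L2 T v -> {within `[0, T], continuous (fun t => nrmL2 (v t))}.
Proof.
move=> cv; apply: (C0L2_continuous cv ltr01) => s t sT tT; rewrite mul1r.
by apply: nrmL2_distl; apply: cv.1.
Qed.

Lemma lam_ge0 beta p : 0 <= lam beta p. Proof. exact: powR_ge0. Qed.

Lemma lam0 beta : beta != 0 -> lam beta 0 = 0.
Proof. by move=> b0; rewrite /lam powR0// mulf_neq0. Qed.

Lemma lam_le beta p q : 0 <= beta -> (p <= q)%N -> lam beta p <= lam beta q.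
Proof. by move=> b0 pq; rewrite /lam ge0_ler_powR ?mulr_ge0 ?nnegrE ?ler_nat. Qed.

(** The equation itself supplies measurability: g_p = u_p' + p^(2 beta) u_p - F_p(u) on the open
    interval, and u_p' is a limit of difference quotients. *)
Lemma is_solution_source_measurable T beta F g uT u K p : 0 < K ->
  (forall y z, `|F y - F z| <= K * `|y - z|) -> is_solution T beta F g uT u ->
  measurable_fun `[0, T] (fun t => coef p (g t)).
Proof.
move=> K0 FK [cu su]; have [du _] := su p.
have ca := C0L2_coef (p := p) cu; have cF := C0L2_coef_lip (p := p) cu K0 FK.
apply: (@measurable_fun_itv_cc _ _ _ false true).
have md := measurable_derive1_oo ca (fun t tT => (du t tT).1).
have sub : `]0, T[%classic `<=` `[0, T]%classic by exact: subset_itv_oo_cc.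
have mF : measurable_fun `]0, T[ (fun t => coef p (F \o u t)).
  by apply: measurable_funS (within_cc_measurable cF).
have ma : measurable_fun `]0, T[ (fun t => coef p (u t)).
  by apply: measurable_funS (within_cc_measurable ca).
apply: (eq_measurable_fun (fun t => derive1 (fun s => coef p (u s)) t +
    lam beta p * coef p (u t) - coef p (F \o u t))).
  by move=> t /set_mem tT; rewrite (du t tT).2 addrC addKr.
apply: measurable_funB => //; apply: measurable_funD => //.
by apply: measurable_funM => //; exact: measurable_cst.
Qed.

(** The integrating factor exp((s - t) p^(2 beta)) gives u_p an explicit derivative, which is
    integrable though possibly discontinuous; hence the use of [FTC_integrable_derivative]. *)
Lemma duhamel T beta F g uT u K p : 0 < K ->
  (forall y z, `|F y - F z| <= K * `|y - z|) -> is_solution T beta F g uT u ->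
  mu.-integrable `[0, T] (EFin \o (fun t => coef p (g t))) ->
  forall t, t \in `[0, T] ->
  coef p (u t) = expR ((T - t) * lam beta p) * coef p uT -
    \int[mu]_(s in `[t, T])
      (expR ((s - t) * lam beta p) * (coef p (F \o u s) + coef p (g s))).
Proof.
move=> K0 FK [cu su] ig t tT; have [du uTE] := su p.
have [t0 t1] : 0 <= t /\ t <= T by move: tT; rewrite in_itv/= => /andP.
have ca := C0L2_coef (p := p) cu; have cF := C0L2_coef_lip (p := p) cu K0 FK.
have sub : `[t, T]%classic `<=` `[0, T]%classic.
  by move=> s /=; rewrite !in_itv/= => /andP[ts ->]; rewrite (le_trans t0).
set l := lam beta p.
have mD : measurable (`[0, T]%classic : set (measurableTypeR R)) by exact: measurable_itv.
have mDt : measurable (`[t, T]%classic : set (measurableTypeR R)) by exact: measurable_itv.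
rewrite (@FTC_integrable_derivative _ (fun s => expR ((s - t) * l) * coef p (u s)) _ t T) => //.
- by rewrite subrr mul0r expR0 mul1r uTE; ring.
- move=> s; apply: cvgM; last exact: (continuous_subspaceW sub ca).
  exact/continuous_subspaceT/continuous_expM.
- move=> s; rewrite in_itv/= => /andP[ts sT].
  have [|d1 d2] := du s; first by rewrite in_itv/= sT (le_lt_trans t0).
  have D1 : is_derive s 1 (fun s => coef p (u s)) (derive1 (fun s => coef p (u s)) s).
    by rewrite derive1E; exact: derivableP.
  have D2 : is_derive s 1 (fun s => expR ((s - t) * l)) (l * expR ((s - t) * l)).
    by apply: is_derive_eq; rewrite /GRing.scale/=; ring.
  have D3 : is_derive s 1 (fun r => expR ((r - t) * l) * coef p (u r)) _ := is_deriveM D2 D1.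
  split; first exact: (@ex_derive _ _ _ _ _ _ _ D3).
  rewrite derive1E (@derive_val _ _ _ _ _ _ _ D3); rewrite -d2 /GRing.scale/= -/l; ring.
- apply: int_expM; apply: integrableS (int_add mD (within_cc_integrable cF) ig) => //.
Qed.

End TimeDependentCoefficients.

(** * Coefficients of the regularized solution and vector estimates *)

Section LowModes.
Context {R : realType}.
Notation mu := (@lebesgue_measure R).
Implicit Types (T t s K A S beta : R) (v w u g : R -> R -> R) (f h F uT : R -> R) (p n M N : nat).

Lemma measurable_cc (a b : R) : measurable (`[a, b]%classic : set (measurableTypeR R)).
Proof. exact: measurable_itv. Qed.
#[local] Hint Resolve measurable_cc : core.

Lemma within_continuous_sum I (r : seq I) (h : I -> R -> R) (A : set R) :
  (forall i, {within A, continuous (h i)}) ->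
  {within A, continuous (fun t => \sum_(i <- r) h i t)}.
Proof.
move=> ch; elim: r => [|i r ih] t.
  by under eq_fun do rewrite big_nil; exact: cvg_cst.
under eq_fun do rewrite big_cons; apply: cvgD; [exact: ch|exact: ih].
Qed.

(** The midpoint-rule approximation of the p-th cosine coefficient, a discrete cosine transform of
    the node values. *)
Definition dcoef n p (a : 'I_n -> R) : R :=
  pi / n%:R * \sum_(k < n) a k * phi p (node k).

Lemma dcoefD n p (a b : 'I_n -> R) :
  dcoef p (fun k => a k + b k) = dcoef p a + dcoef p b.
Proof. by rewrite /dcoef -mulrDr -big_split; congr (_ * _); apply: eq_bigr => k _; rewrite mulrDl. Qed.

(** Since phi_0^2 = 1 / pi, the separate averages in [Phi] and [Phit] are their p = 0 terms, so all
    modes can be treated alike. *)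
Lemma dcoef0 n (a : 'I_n -> R) (x : R) :
  dcoef 0 a * phi 0 x = n%:R^-1 * \sum_(k < n) a k.
Proof.
rewrite /dcoef phiE mul0r cos0 mulr1.
under eq_bigr do rewrite phiE mul0r cos0 mulr1.
rewrite -mulr_suml; have := @nphi_sqr R 0 => /=.
move: (nphi 0) (\sum_(i < n) a i) => q z q2.
have -> : pi / n%:R * (z * q) * q = n%:R^-1 * z * (pi * q ^+ 2) by ring.
by rewrite q2 mul1r divff ?mulr1// pi_neq0.
Qed.

Lemma int_dcoef n p (b : 'I_n -> R -> R) (c e : R) :
  (forall k, mu.-integrable `[c, e] (EFin \o b k)) ->
  mu.-integrable `[c, e] (EFin \o (fun s => dcoef p (b ^~ s))).
Proof.
move=> ib; apply: int_mull => //; apply: int_sum => // k _.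
by apply: int_mulr => //; exact: ib.
Qed.

Lemma coef_sqr_le f S p : (0 < p)%N ->
  (forall N, \sum_(1 <= q < N) (q%:R ^+ 2 * coef q f ^+ 2) <= S) -> coef p f ^+ 2 <= S.
Proof.
move=> p0 /(_ p.+1); apply: le_trans.
rewrite big_nat_recr//= -[leLHS]add0r lerD//.
  by apply: sumr_ge0 => q _; rewrite mulr_ge0 ?sqr_ge0.
by rewrite ler_peMl ?sqr_ge0// expr_ge1 ?ler1n.
Qed.

(** The weighted sum says nothing about the mode p = 0. A point value does: f departs from its mean
    by at most sqrt(2 S). *)
Lemma mean_le f S x : L2Omega f -> {in Omega, continuous f} ->
  (forall N, \sum_(1 <= q < N) (q%:R ^+ 2 * coef q f ^+ 2) <= S) -> Omega x ->
  `|coef 0 f| <= (nphi 0)^-1 * (`|f x| + Num.sqrt (2 * S)).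
Proof.
move=> Lf cf HS Ox; rewrite ler_pdivlMl ?nphi_gt0//.
have := sup_resid_le (N := 1) (B := Num.sqrt (2 * S)) Lf cf _ Ox.
rewrite /psum big_nat1 phiE mul0r cos0 mulr1 => H.
rewrite -[X in X * _]gtr0_norm ?nphi_gt0// -normrM mulrC.
have -> : coef 0 f * nphi 0 = f x - (f x - coef 0 f * nphi 0) by rewrite subKr.
rewrite (le_trans (ler_normB _ _))// lerD2l; apply: H => N _.
by have := tail_coef_le (n := 1) N (ltn0Sn 0) HS; rewrite divr1.
Qed.

Lemma source_integrable T beta F g uT u K S p : 0 < K ->
  (forall y z, `|F y - F z| <= K * `|y - z|) ->
  (forall t, t \in `[0, T] -> L2Omega (g t) /\ {in Omega, continuous (g t)}) ->
  (forall x, x \in Omega -> mu.-integrable `[0, T] (fun t => (g t x)%:E)) ->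
  (forall t, t \in `[0, T] ->
    forall N, \sum_(1 <= q < N) (q%:R ^+ 2 * coef q (g t) ^+ 2) <= S) ->
  is_solution T beta F g uT u ->
  mu.-integrable `[0, T] (EFin \o (fun t => coef p (g t))).
Proof.
move=> K0 FK Lg ig HS su; have mg : measurable_fun `[0, T] (fun t => coef p (g t)) := is_solution_source_measurable p K0 FK su.
have icst (c : R) : mu.-integrable `[0, T] (EFin \o (fun=> c)).
  by apply: within_cc_integrable; apply: continuous_subspaceT => x; exact: cvg_cst.
have [->{p mg}|p0] := posnP p; last first.
  apply: (int_le (measurable_cc _ _) mg (icst (1 + S))) => t tT.
  have := coef_sqr_le p0 (HS t tT); rewrite -real_normK ?num_real//.
  move: `|_| => x; have := sqr_ge0 (x - 1); rewrite expr2; nra.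
(* Any fixed interior point would do: the mean of g(., t) is dominated by the value there, which is
   integrable in time. *)
have Oc : Omega (pi / 2 : R).
  by rewrite /Omega/= in_itv/= divr_gt0 ?pi_gt0//= ltr_pdivrMr// ltr_pMr ?pi_gt0// ltr1n.
have mg : measurable_fun `[0, T] (fun t => coef 0 (g t)) := is_solution_source_measurable 0 K0 FK su.
apply: (int_le (measurable_cc _ _) mg (h := fun t => (nphi 0)^-1 * (`|g t (pi / 2)| + Num.sqrt (2 * S)))).
  apply: int_mull => //; apply: int_add => //.
  by have i1 := ig _ (mem_set Oc); exact: (integrable_norm i1).
by move=> t tT; have [L1 L2] := Lg t tT; exact: mean_le (HS t tT) _.
Qed.

Lemma regularized_coef T beta M n F (a : 'I_n -> R) (b : 'I_n -> R -> R) U K :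
  beta != 0 -> 0 < K -> (forall y z, `|F y - F z| <= K * `|y - z|) ->
  (forall k, mu.-integrable `[0, T] (EFin \o b k)) ->
  is_regularized T beta M F a b U -> forall t, t \in `[0, T] -> forall p,
  coef p (U t) = if (p < M.+1)%N then
    expR ((T - t) * lam beta p) * dcoef p a -
    \int[mu]_(s in `[t, T]) (expR ((s - t) * lam beta p) * dcoef p (b ^~ s)) -
    \int[mu]_(s in `[t, T]) (expR ((s - t) * lam beta p) * coef p (F \o U s)) else 0.
Proof.
(* The integral equation makes U(t) almost everywhere a finite cosine sum, whose coefficients
   [coef_sum] reads off. *)
move=> b0 K0 FK ib [cU HU] t tT p; rewrite -[RHS](coef_sum M.+1 (fun p =>
    expR ((T - t) * lam beta p) * dcoef p a -
    \int[mu]_(s in `[t, T]) (expR ((s - t) * lam beta p) * dcoef p (b ^~ s)) -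
    \int[mu]_(s in `[t, T]) (expR ((s - t) * lam beta p) * coef p (F \o U s)))).
apply: innerL2_ae; [exact: cU.1|by apply: L2Omega_sum => q; apply: L2OmegaZ|by []|].
apply: filterS (HU t tT) => x /[apply] ->.
have t0 : 0 <= t by move: tT; rewrite in_itv/= => /andP[].
have sub : `[t, T]%classic `<=` `[0, T]%classic.
  by move=> s /=; rewrite !in_itv/= => /andP[ts ->]; rewrite (le_trans t0).
have ibt k : mu.-integrable `[t, T] (EFin \o b k) by apply: integrableS (ib k).
under [RHS]eq_bigr => q _ do rewrite (mulrBl (phi q x)) (mulrBl (phi q x)).
rewrite !sumrB; congr (_ - _ - _).
  rewrite /Phi [in RHS]big_ltn// lam0// mulr0 expR0 mul1r; congr (_ + _).
  by rewrite dcoef0.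
rewrite /Phit [in RHS]big_ltn//; congr (_ + _).
rewrite -RintegralZr//; last by apply: int_expM; exact: int_dcoef.
apply: eq_Rintegral => s _; rewrite lam0// mulr0 expR0 mul1r.
by rewrite dcoef0.
Qed.

Lemma abs_sum_le N (e z : nat -> R) (r : R) : 0 <= r ->
  \sum_(0 <= p < N) z p ^+ 2 <= r ^+ 2 ->
  `|\sum_(0 <= p < N) e p * z p| <= Num.sqrt (\sum_(0 <= p < N) e p ^+ 2) * r.
Proof.
move=> r0 zr; have e0 : 0 <= \sum_(0 <= p < N) e p ^+ 2.
  by apply: sumr_ge0 => *; exact: sqr_ge0.
rewrite -ler_sqr ?nnegrE ?mulr_ge0 ?sqrtr_ge0// real_normK ?num_real// exprMn sqr_sqrtr//.
by apply: le_trans (sum_CS _ _ _ _) _; rewrite ler_wpM2l.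
Qed.

(** Minkowski's integral inequality in dual form: pairing with the vector [e] first reduces it to
    Cauchy-Schwarz under a scalar integral. *)
Lemma abs_sum_Rintegral_le N (e : nat -> R) (G : nat -> R -> R) r (a b : R) :
  (forall p, mu.-integrable `[a, b] (EFin \o G p)) ->
  mu.-integrable `[a, b] (EFin \o r) ->
  (forall s, s \in `[a, b] -> 0 <= r s /\ \sum_(0 <= p < N) G p s ^+ 2 <= r s ^+ 2) ->
  `|\sum_(0 <= p < N) e p * \int[mu]_(s in `[a, b]) G p s| <=
  Num.sqrt (\sum_(0 <= p < N) e p ^+ 2) * \int[mu]_(s in `[a, b]) r s.
Proof.
move=> iG ir Hr; have ieG p : mu.-integrable `[a, b] (EFin \o (fun s => e p * G p s)).
  exact: int_mull.
under eq_bigr do rewrite -RintegralZl//.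
rewrite -Rintegral_sum//; have iS : mu.-integrable `[a, b] (EFin \o (fun s => \sum_(0 <= p < N) e p * G p s)).
  exact: int_sum.
apply: le_trans (le_normr_Rintegral _ iS) _ => //.
rewrite -RintegralZl//; apply: le_Rintegral => //.
- exact: (integrable_norm iS).
- exact: int_mull.
- by move=> s sab; have [r0 r1] := Hr s sab; exact: abs_sum_le.
Qed.

Lemma abs_le_sum5 (E W a b c J Y i3 i4 s1 s2 s3 s4 s5 : R) :
  `|s1| <= E * (W * a) -> `|s2| <= E * (W * b) -> `|s3| <= E * i3 -> `|s4| <= E * i4 ->
  `|s5| <= E * Y -> E * i3 <= E * (W * c) -> E * i4 <= E * (W * J) ->
  s1 + s2 - s3 - s4 - s5 <= E * (W * (a + b + c + J) + Y).
Proof.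
rewrite !ler_norml => /andP[_ ?] /andP[_ ?] /andP[? _] /andP[? _] /andP[? _] ? ?.
by rewrite !mulrDr; lra.
Qed.

(** Splitting off q costs 2, squaring a sum of four terms costs 4, and 9/4 is the square of the
    Gronwall factor: 9/4 * 2 <= 6 and 9/4 * 2 * 4 = 6 * 3. *)
Lemma error_budget (q G a b c j X T Q : R) : q ^+ 2 = Q -> j ^+ 2 <= T * X ->
  9 / 4 * (q + G * (a + b + T * c + j)) ^+ 2 <=
  6 * (Q + 3 * G ^+ 2 * (a ^+ 2 + b ^+ 2 + T ^+ 2 * c ^+ 2 + T * X)).
Proof.
move=> <- jX; pose s := a + b + T * c + j.
have h1 : (q + G * s) ^+ 2 <= 2 * q ^+ 2 + 2 * (G ^+ 2 * s ^+ 2).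
  rewrite -subr_ge0 (_ : _ - _ = (q - G * s) ^+ 2) ?sqr_ge0//; ring.
have h2 : s ^+ 2 <= 4 * (a ^+ 2 + b ^+ 2 + T ^+ 2 * c ^+ 2 + j ^+ 2).
  rewrite -subr_ge0 (_ : _ - _ = (a - b) ^+ 2 + (a - T * c) ^+ 2 + (a - j) ^+ 2 +
    (b - T * c) ^+ 2 + (b - j) ^+ 2 + (T * c - j) ^+ 2); last by rewrite /s; ring.
  by rewrite !addr_ge0 ?sqr_ge0.
have h3 : s ^+ 2 <= 4 * (a ^+ 2 + b ^+ 2 + T ^+ 2 * c ^+ 2 + T * X).
  by apply: le_trans h2 _; rewrite ler_pM2l// lerD2l.
have h4 := ler_wpM2l (sqr_ge0 G) h3; rewrite -/s.
have := sqr_ge0 q; move: h1 h4.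
move: ((q + _) ^+ 2) (s ^+ 2) (a ^+ 2 + _ + _ + _) (G ^+ 2) (q ^+ 2) => x y z g p; nra.
Qed.

Lemma sqr_Rintegral_le T f : 0 < T -> {within `[0, T], continuous f} ->
  (\int[mu]_(s in `[0, T]) f s) ^+ 2 <= T * \int[mu]_(s in `[0, T]) (f s ^+ 2).
Proof.
move=> T0 cf; have if1 := within_cc_integrable cf.
have if2 : mu.-integrable `[0, T] (EFin \o (fun s => f s ^+ 2)).
  by apply: within_cc_integrable => s; apply: cvgM; exact: cf.
set J := \int[mu]_(s in _) f s; set Q := \int[mu]_(s in _) _.
have icst (c : R) : mu.-integrable `[0, T] (EFin \o (fun=> c)).
  by apply: within_cc_integrable; apply: continuous_subspaceT => x; exact: cvg_cst.
have muT : fine (mu `[0, T]%classic) = T.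
  by have := @lebesgue_measure_itv R `[0, T]; rewrite /= lte_fin T0 => ->; rewrite /= subr0.
(* Cauchy-Schwarz against 1, obtained by integrating the squared deviation from the average J /
   T. *)
have : 0 <= \int[mu]_(s in `[0, T]) (f s ^+ 2 + (- (2 * (J / T)) * f s + (J / T) ^+ 2)).
  apply: Rintegral_ge0 => s _.
  have -> : f s ^+ 2 + (- (2 * (J / T)) * f s + (J / T) ^+ 2) = (f s - J / T) ^+ 2 by ring.
  exact: sqr_ge0.
have i1 : mu.-integrable `[0, T] (EFin \o (fun s => - (2 * (J / T)) * f s)) by exact: int_mull.
rewrite RintegralD//; last exact: int_add.
rewrite RintegralD// RintegralZl// Rintegral_cst// muT -/J -/Q.
have -> : Q + (- (2 * (J / T)) * J + (J / T) ^+ 2 * T) = (T * Q - J ^+ 2) / T.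
  by field; rewrite gt_eqF.
by rewrite pmulr_lge0 ?invr_gt0// subr_ge0.
Qed.

End LowModes.

(** * Error estimate for a fixed noise path *)

Section Pathwise.
Context {R : realType}.
Notation mu := (@lebesgue_measure R).
Variables (T beta K S1 S2 Q : R) (F uT : R -> R) (g u U : R -> R -> R).
Variables (M n : nat) (nu : 'I_n -> R) (eta : 'I_n -> R -> R).
Hypotheses (T0 : 0 < T) (beta0 : 0 < beta) (K0 : 0 < K) (Mn : (M < n)%N).
Hypothesis FK : forall y z, `|F y - F z| <= K * `|y - z|.
Hypotheses (LuT : L2Omega uT) (cuT : {in Omega, continuous uT}).
Hypothesis Lg : forall t, t \in `[0, T] -> L2Omega (g t) /\ {in Omega, continuous (g t)}.
Hypothesis ig : forall x, x \in Omega -> mu.-integrable `[0, T] (fun t => (g t x)%:E).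
Hypothesis HS1 : forall N, \sum_(1 <= q < N) (q%:R ^+ 2 * coef q uT ^+ 2) <= S1.
Hypothesis HS2 : forall t, t \in `[0, T] ->
  forall N, \sum_(1 <= q < N) (q%:R ^+ 2 * coef q (g t) ^+ 2) <= S2.
Hypothesis HQ : forall t, t \in `[0, T] -> forall N,
  \sum_(M.+1 <= p < N) coef p (u t) ^+ 2 <= expR (- (2 * lam beta M * t)) * Q.
Hypothesis su : is_solution T beta F g uT u.
Hypothesis ceta : forall k, {within `[0, T], continuous (eta k)}.
Hypothesis rU : is_regularized T beta M F (fun k => uT (node k) + nu k)
  (fun k t => g t (node k) + eta k t) U.

#[local] Hint Resolve measurable_cc : core.

Let L := lam beta M.
Let v t x := U t x - u t x.
Let gn t (k : 'I_n) := g t (node k).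
Let bias1 p := dcoef p (fun k : 'I_n => uT (node k)) - coef p uT.
Let bias2 p t := dcoef p (gn t) - coef p (g t).
(** Euclidean sizes over the modes 0 to M: [d1] and [d2] bound the sampling biases, [n1] and [x1]
    are the norms of the projected noise. *)
Let d1 := Num.sqrt (M.+1%:R * (2 * pi ^+ 2 * S1 / n%:R)).
Let d2 := Num.sqrt (M.+1%:R * (2 * pi ^+ 2 * S2 / n%:R)).
Let n1 := Num.sqrt (\sum_(0 <= p < M.+1) dcoef p nu ^+ 2).
Let x1 t := Num.sqrt (\sum_(0 <= p < M.+1) dcoef p (eta ^~ t) ^+ 2).

Let cv : C0L2 T v. Proof. exact: C0L2B rU.1 su.1. Qed.

Let subT t : t \in `[0, T] -> `[t, T]%classic `<=` `[0, T]%classic.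
Proof.
rewrite in_itv/= => /andP[t0 _] s /=.
by rewrite !in_itv/= => /andP[ts ->]; rewrite (le_trans t0).
Qed.

Let itT t (h : R -> R) : t \in `[0, T] -> mu.-integrable `[0, T] (EFin \o h) ->
  mu.-integrable `[t, T] (EFin \o h).
Proof. by move=> tT; apply: integrableS => //; exact: subT. Qed.

Let ign k : mu.-integrable `[0, T] (EFin \o (fun t => gn t k)).
Proof. by apply: ig; apply: mem_set; exact: node_Omega. Qed.

Let ieta k : mu.-integrable `[0, T] (EFin \o eta k).
Proof. exact: within_cc_integrable. Qed.

Let igp p : mu.-integrable `[0, T] (EFin \o (fun t => coef p (g t))).
Proof. exact: (source_integrable p K0 FK Lg ig HS2 su). Qed.

Let iFp (w : R -> R -> R) p : C0L2 T w ->
  mu.-integrable `[0, T] (EFin \o (fun t => coef p (F \o w t))).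
Proof. by move=> cw; apply: within_cc_integrable; exact: C0L2_coef_lip cw K0 FK. Qed.

Let ib k : mu.-integrable `[0, T] (EFin \o (fun s => g s (node k) + eta k s)).
Proof. exact: (int_add (measurable_cc _ _) (ign k) (ieta k)). Qed.

Let b0 : beta != 0. Proof. by rewrite gt_eqF. Qed.

Lemma error_coef t p : t \in `[0, T] -> (p < M.+1)%N ->
  coef p (v t) = expR ((T - t) * lam beta p) * bias1 p +
    expR ((T - t) * lam beta p) * dcoef p nu -
    \int[mu]_(s in `[t, T]) (expR ((s - t) * lam beta p) * bias2 p s) -
    \int[mu]_(s in `[t, T]) (expR ((s - t) * lam beta p) * dcoef p (eta ^~ s)) -
    \int[mu]_(s in `[t, T])
      (expR ((s - t) * lam beta p) * (coef p (F \o U s) - coef p (F \o u s))).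
Proof.
move=> tT pM.
have key (w a b c I1 I2 I3 I4 I5 : R) : w * (a + b) - (I1 + I2) - I3 - (w * c - (I4 + I5)) =
  w * (a - c) + w * b - (I1 - I5) - I2 - (I3 - I4) by ring.
rewrite coefB; [|exact: rU.1.1|exact: su.1.1].
rewrite (regularized_coef b0 K0 FK ib rU tT) pM (duhamel K0 FK su (igp p) tT) dcoefD.
have i1 : mu.-integrable `[0, T] (EFin \o (fun s => dcoef p (gn s))) := int_dcoef p ign.
have i2 : mu.-integrable `[0, T] (EFin \o (fun s => dcoef p (eta ^~ s))) := int_dcoef p ieta.
have i3 := iFp p rU.1; have i4 := iFp p su.1; have i5 := igp p.
have e1 : \int[mu]_(s in `[t, T]) (expR ((s - t) * lam beta p) *
      dcoef p (fun k => g s (node k) + eta k s)) =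
    \int[mu]_(s in `[t, T]) (expR ((s - t) * lam beta p) * dcoef p (gn s)) +
    \int[mu]_(s in `[t, T]) (expR ((s - t) * lam beta p) * dcoef p (eta ^~ s)).
  rewrite -RintegralD//; [|exact/int_expM/itT|exact/int_expM/itT].
  by apply: eq_Rintegral => s _; rewrite dcoefD mulrDr.
have e2 : \int[mu]_(s in `[t, T]) (expR ((s - t) * lam beta p) * bias2 p s) =
    \int[mu]_(s in `[t, T]) (expR ((s - t) * lam beta p) * dcoef p (gn s)) -
    \int[mu]_(s in `[t, T]) (expR ((s - t) * lam beta p) * coef p (g s)).
  rewrite -RintegralB//; [|exact/int_expM/itT|exact/int_expM/itT].
  by apply: eq_Rintegral => s _; rewrite /bias2 mulrBr.
have e3 : \int[mu]_(s in `[t, T]) (expR ((s - t) * lam beta p) *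
      (coef p (F \o U s) - coef p (F \o u s))) =
    \int[mu]_(s in `[t, T]) (expR ((s - t) * lam beta p) * coef p (F \o U s)) -
    \int[mu]_(s in `[t, T]) (expR ((s - t) * lam beta p) * coef p (F \o u s)).
  rewrite -RintegralB//; [|exact/int_expM/itT|exact/int_expM/itT].
  by apply: eq_Rintegral => s _; rewrite mulrBr.
have e4 : \int[mu]_(s in `[t, T]) (expR ((s - t) * lam beta p) *
      (coef p (F \o u s) + coef p (g s))) =
    \int[mu]_(s in `[t, T]) (expR ((s - t) * lam beta p) * coef p (F \o u s)) +
    \int[mu]_(s in `[t, T]) (expR ((s - t) * lam beta p) * coef p (g s)).
  rewrite -RintegralD//; [|exact/int_expM/itT|exact/int_expM/itT].
  by apply: eq_Rintegral => s _; rewrite mulrDr.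
by rewrite e1 e2 e3 e4 /bias1; exact: key.
Qed.

Let weighted_sqr_le (w z : nat -> R) (W Z : R) :
  (forall p, (p < M.+1)%N -> 0 <= w p <= W) ->
  \sum_(0 <= p < M.+1) z p ^+ 2 <= Z ^+ 2 ->
  \sum_(0 <= p < M.+1) (w p * z p) ^+ 2 <= (W * Z) ^+ 2.
Proof.
move=> Hw Hz; rewrite exprMn; apply: le_trans (_ : W ^+ 2 * \sum_(0 <= p < M.+1) z p ^+ 2 <= _).
  rewrite big_distrr/=; apply: ler_sum_nat => p /Hw /andP[w0 wW].
  by rewrite exprMn ler_wpM2r ?sqr_ge0// lerXn2r// nnegrE (le_trans w0).
by rewrite ler_wpM2l ?sqr_ge0.
Qed.

Let expW t s p : t <= s -> (p < M.+1)%N ->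
  0 <= expR ((s - t) * lam beta p) <= expR ((s - t) * L).
Proof.
move=> ts pM; rewrite expR_ge0/= ler_expR ler_wpM2l ?subr_ge0//.
exact: lam_le (ltW beta0) _.
Qed.

Let sampling_sum (f : R -> R) (S : R) : L2Omega f -> {in Omega, continuous f} ->
  (forall N, \sum_(1 <= q < N) (q%:R ^+ 2 * coef q f ^+ 2) <= S) ->
  \sum_(0 <= p < M.+1) (dcoef p (fun k : 'I_n => f (node k)) - coef p f) ^+ 2 <=
  Num.sqrt (M.+1%:R * (2 * pi ^+ 2 * S / n%:R)) ^+ 2.
Proof.
move=> Lf cf HS; have S0 : 0 <= S by have := HS 0%N; rewrite big_geq.
rewrite sqr_sqrtr; last by rewrite mulr_ge0// divr_ge0// mulr_ge0// mulr_ge0// sqr_ge0.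
apply: le_trans (_ : \sum_(0 <= p < M.+1) (2 * pi ^+ 2 * S / n%:R) <= _).
  by apply: ler_sum_nat => p pM; apply: sampling_error => //; exact: leq_trans pM Mn.
by rewrite sumr_const_nat subn0 -[X in X <= _]mulr_natl.
Qed.

Let x1_continuous : {within `[0, T], continuous x1}.
Proof.
have H : {within `[0, T], continuous (fun t => \sum_(0 <= p < M.+1) dcoef p (eta ^~ t) ^+ 2)}.
  apply: within_continuous_sum => p.
  have K1 : {within `[0, T], continuous (fun t => dcoef p (eta ^~ t))}.
    have K2 : {within `[0, T], continuous (fun t => \sum_(k < n) eta k t * phi p (node k))}.
      by apply: within_continuous_sum => k t; apply: cvgMl; exact: ceta.
    by move=> t; apply: cvgMr; exact: K2.
  by move=> t; apply: cvgM; exact: K1.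
by move=> t; exact: (continuous_comp (H t) (@sqrt_continuous R _)).
Qed.

Lemma low_modes_le t : t \in `[0, T] ->
  expR (L * t) * Num.sqrt (\sum_(0 <= p < M.+1) coef p (v t) ^+ 2) <=
  expR (L * T) * (d1 + n1 + T * d2 + \int[mu]_(s in `[0, T]) x1 s) +
  K * \int[mu]_(s in `[t, T]) (expR (L * s) * nrmL2 (v s)).
Proof.
move=> tT; have [t0 t1] : 0 <= t /\ t <= T by move: tT; rewrite in_itv/= => /andP.
pose e p := coef p (v t); set E := Num.sqrt _; pose W := expR ((T - t) * L).
have E0 : 0 <= E by exact: sqrtr_ge0.
have W0 : 0 <= W by exact: expR_ge0.
have icst (c : R) : mu.-integrable `[0, T] (EFin \o (fun=> c)).
  by apply: within_cc_integrable; apply: continuous_subspaceT => x; exact: cvg_cst.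
have expWT s p : s \in `[t, T] -> (p < M.+1)%N -> 0 <= expR ((s - t) * lam beta p) <= W.
  rewrite in_itv/= => /andP[ts sT] pM; have /andP[-> h] := expW ts pM.
  by rewrite (le_trans h)// ler_expR ler_wpM2r ?lam_ge0// lerD2r.
have cy : {within `[0, T], continuous (fun s => nrmL2 (v s))} by exact: C0L2_nrm cv.
have ix : mu.-integrable `[0, T] (EFin \o x1) by exact: within_cc_integrable x1_continuous.
have B1 : `|\sum_(0 <= p < M.+1) e p * (expR ((T - t) * lam beta p) * bias1 p)| <= E * (W * d1).
  apply: abs_sum_le; first by rewrite mulr_ge0// sqrtr_ge0.
  by apply: weighted_sqr_le => [p pM|]; [exact: expW|exact: sampling_sum].
have B2 : `|\sum_(0 <= p < M.+1) e p * (expR ((T - t) * lam beta p) * dcoef p nu)| <= E * (W * n1).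
  apply: abs_sum_le; first by rewrite mulr_ge0// sqrtr_ge0.
  apply: weighted_sqr_le => [p pM|]; [exact: expW|rewrite sqr_sqrtr//].
  by apply: sumr_ge0 => p _; exact: sqr_ge0.
have B3 : `|\sum_(0 <= p < M.+1) e p * \int[mu]_(s in `[t, T])
    (expR ((s - t) * lam beta p) * bias2 p s)| <= E * \int[mu]_(s in `[t, T]) (W * d2).
  apply: abs_sum_Rintegral_le => [p||s sT]; last 1 first.
  - split; first by rewrite mulr_ge0// sqrtr_ge0.
    have [Ls cs] := Lg (subT tT sT).
    apply: weighted_sqr_le => [p pM|]; first exact: expWT.
    by apply: sampling_sum => //; apply: HS2; exact: subT tT _ sT.
  - apply: int_expM; apply: itT tT _; apply: int_sub => //; exact: (int_dcoef p ign).
  - exact: itT tT (icst _).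
have B4 : `|\sum_(0 <= p < M.+1) e p * \int[mu]_(s in `[t, T])
    (expR ((s - t) * lam beta p) * dcoef p (eta ^~ s))| <= E * \int[mu]_(s in `[t, T]) (W * x1 s).
  apply: abs_sum_Rintegral_le => [p||s sT]; last 1 first.
  - split; first by rewrite mulr_ge0// sqrtr_ge0.
    apply: weighted_sqr_le => [p pM|]; first exact: expWT.
    by rewrite sqr_sqrtr//; apply: sumr_ge0 => p _; exact: sqr_ge0.
  - by apply: int_expM; apply: itT tT _; exact: (int_dcoef p ieta).
  - by apply: int_mull => //; exact: itT tT ix.
(* Unlike in the data terms, the weight at time s is not enlarged to [W]: multiplied by exp(L t) it
   becomes exp(L s) and rebuilds the Gronwall integrand. *)
have B5 : `|\sum_(0 <= p < M.+1) e p * \int[mu]_(s in `[t, T])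
    (expR ((s - t) * lam beta p) * (coef p (F \o U s) - coef p (F \o u s)))| <=
    E * \int[mu]_(s in `[t, T]) (expR ((s - t) * L) * (K * nrmL2 (v s))).
  apply: abs_sum_Rintegral_le => [p||s sT]; last 1 first.
  - have sT' := subT tT sT; split.
      by rewrite mulr_ge0 ?expR_ge0// mulr_ge0// ltW.
    apply: weighted_sqr_le => [p pM|].
      by apply: expW => //; move: sT; rewrite in_itv/= => /andP[].
    have LU := rU.1.1 _ sT'; have Lu := su.1.1 _ sT'.
    have LFU := L2Omega_lip FK LU; have LFu := L2Omega_lip FK Lu.
    apply: le_trans (_ : nrmL2 (fun x => F (U s x) - F (u s x)) ^+ 2 <= _).
      under eq_bigr do rewrite -coefB//.
      by rewrite nrmL2_sqr; apply: bessel; exact: L2OmegaB.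
    rewrite lerXn2r ?nnegrE ?mulr_ge0// ?(ltW K0)//.
    exact: nrmL2_lip.
  - apply: int_expM; apply: itT tT _; apply: int_sub => //; [exact: iFp rU.1|exact: iFp su.1].
  - by apply: int_expM; apply: itT tT _; apply: int_mull => //; exact: within_cc_integrable.
pose Y := \int[mu]_(s in `[t, T]) (expR ((s - t) * L) * (K * nrmL2 (v s))).
have Y0 : 0 <= Y.
  by apply: Rintegral_ge0 => s _; rewrite mulr_ge0 ?expR_ge0// mulr_ge0// ltW.
have J3 : \int[mu]_(s in `[t, T]) (W * d2) <= W * (T * d2).
  rewrite Rintegral_cst//; have -> : fine (mu `[t, T]%classic) = T - t.
    have := @lebesgue_measure_itv R `[t, T]; rewrite /= lte_fin.
    by case: ltgtP t1 => // [_ _ ->//|-> _ ->]; rewrite subrr.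
  rewrite -mulrA ler_wpM2l// mulrC ler_wpM2r ?sqrtr_ge0//.
  by rewrite gerBl.
have J4 : \int[mu]_(s in `[t, T]) (W * x1 s) <= W * \int[mu]_(s in `[0, T]) x1 s.
  rewrite RintegralZl//; last exact: itT tT ix.
  rewrite ler_wpM2l//; apply: fine_le.
  - by apply: integrable_fin_num => //; exact: itT tT ix.
  - exact: integrable_fin_num.
  - apply: ge0_subset_integral => //; last exact: subT.
      exact: measurable_int ix.
    by move=> s _; rewrite lee_fin sqrtr_ge0.
have EE : E ^+ 2 <= E * (W * (d1 + n1 + T * d2 + \int[mu]_(s in `[0, T]) x1 s) + Y).
  rewrite sqr_sqrtr; last by apply: sumr_ge0 => p _; exact: sqr_ge0.
  have -> : \sum_(0 <= p < M.+1) coef p (v t) ^+ 2 =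
      \sum_(0 <= p < M.+1) e p * (expR ((T - t) * lam beta p) * bias1 p) +
      \sum_(0 <= p < M.+1) e p * (expR ((T - t) * lam beta p) * dcoef p nu) -
      \sum_(0 <= p < M.+1) e p * \int[mu]_(s in `[t, T])
        (expR ((s - t) * lam beta p) * bias2 p s) -
      \sum_(0 <= p < M.+1) e p * \int[mu]_(s in `[t, T])
        (expR ((s - t) * lam beta p) * dcoef p (eta ^~ s)) -
      \sum_(0 <= p < M.+1) e p * \int[mu]_(s in `[t, T])
        (expR ((s - t) * lam beta p) * (coef p (F \o U s) - coef p (F \o u s))).
    rewrite -big_split -!sumrB; apply: eq_big_nat => p /andP[_ pM] /=.
    by rewrite expr2 {2}error_coef// 3!mulrBr mulrDr.
  exact: abs_le_sum5 B1 B2 B3 B4 B5 (ler_wpM2l E0 J3) (ler_wpM2l E0 J4).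
(* Division by [E]; when [E] is 0 the right-hand side is still nonnegative. *)
have EL : E <= W * (d1 + n1 + T * d2 + \int[mu]_(s in `[0, T]) x1 s) + Y.
  move: E0; rewrite le_eqVlt => /predU1P[<-|E0]; last by rewrite -(ler_pM2l E0) -expr2.
  rewrite addr_ge0// mulr_ge0// !addr_ge0 ?mulr_ge0 ?sqrtr_ge0 ?(ltW T0)//.
  by apply: Rintegral_ge0 => s _; exact: sqrtr_ge0.
apply: le_trans (ler_wpM2l (expR_ge0 _) EL) _; rewrite mulrDr mulrA /W -expRD.
have -> : L * t + (T - t) * L = L * T by ring.
rewrite lerD2l le_eqVlt; apply/orP; left; apply/eqP.
have iy : mu.-integrable `[t, T] (EFin \o (fun s => K * nrmL2 (v s))).
  by apply: itT tT _; apply: int_mull => //; exact: within_cc_integrable.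
have iy' : mu.-integrable `[t, T] (EFin \o (fun s => expR (L * s) * nrmL2 (v s))).
  have := @int_expM R t T L 0 (fun s => nrmL2 (v s)) (itT tT (within_cc_integrable cy)).
  by apply: eq_integrable => // s _ /=; rewrite subr0 mulrC [L * _]mulrC mulrC.
rewrite /Y -(RintegralZl _ (measurable_cc t T) (int_expM L t iy)).
rewrite -(RintegralZl _ (measurable_cc t T) iy'); apply: eq_Rintegral => s _.
rewrite mulrA -expRD; have -> : L * t + (s - t) * L = L * s by ring.
by rewrite mulrCA.
Qed.

(** The tail hypothesis enters only through [Q], which becomes P1 under one source condition and
    M^(-2 beta alpha) P2 under the other, so one estimate serves both. *)
Lemma pathwise_bound t : t \in `[0, T] ->
  innerL2 (v t) (v t) <= 6 * expR (- (2 * L * t)) *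
    (Q + 3 * expR (2 * T * L) * (M.+1%:R * (2 * pi ^+ 2 * S1 / n%:R) +
      \sum_(0 <= p < M.+1) dcoef p nu ^+ 2 + T ^+ 2 * (M.+1%:R * (2 * pi ^+ 2 * S2 / n%:R)) +
      T * \int[mu]_(s in `[0, T]) (\sum_(0 <= p < M.+1) dcoef p (eta ^~ s) ^+ 2))) *
    expR (6 * K * (T - t)).
Proof.
move=> tT.
have Q0 : 0 <= Q by have := HQ tT 0; rewrite big_geq// pmulr_rge0// expR_gt0.
pose y s := expR (L * s) * nrmL2 (v s).
have cy : {within `[0, T], continuous y}.
  move=> s; apply: cvgM; last exact: C0L2_nrm cv _.
  apply: continuous_subspaceT => r; apply: (@continuous_comp _ _ _ (fun s => L * s) expR).
    by apply: cvgMr; exact: cvg_id.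
  exact: continuous_expR.
set J := \int[mu]_(s in `[0, T]) x1 s.
pose A := Num.sqrt Q + expR (L * T) * (d1 + n1 + T * d2 + J).
have J0 : 0 <= J by apply: Rintegral_ge0 => s _; exact: sqrtr_ge0.
have A0 : 0 <= A.
  by rewrite /A addr_ge0 ?sqrtr_ge0// mulr_ge0 ?expR_ge0// !addr_ge0 ?mulr_ge0 ?sqrtr_ge0// ltW.
have yA s : s \in `[0, T] -> y s <= A + K * \int[mu]_(r in `[s, T]) y r.
  move=> sT; set E := Num.sqrt (\sum_(0 <= p < M.+1) coef p (v s) ^+ 2).
  (* Above [M] the coefficients of U vanish, so the error there is the tail of u, controlled by
     [HQ]. *)
  have H : innerL2 (v s) (v s) <= E ^+ 2 + expR (- (2 * L * s)) * Q.
    apply: parseval_le; first exact: cv.1.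
    move=> N; rewrite sqr_sqrtr; last by apply: sumr_ge0 => p _; exact: sqr_ge0.
    have e p : (M < p)%N -> coef p (v s) ^+ 2 = coef p (u s) ^+ 2.
      move=> Mp; rewrite coefB; [|exact: rU.1.1|exact: su.1.1].
      by rewrite (regularized_coef b0 K0 FK ib rU sT) ltnS leqNgt Mp sub0r sqrrN.
    apply: le_trans (_ : \sum_(0 <= p < maxn N M.+1) coef p (v s) ^+ 2 <= _).
      rewrite [leRHS](@big_cat_nat _ _ _ N)//= ?leq_maxl// lerDl.
      by apply: sumr_ge0 => p _; exact: sqr_ge0.
    rewrite (@big_cat_nat _ _ _ M.+1)//= ?leq_maxr// lerD2l.
    rewrite (@eq_big_nat _ _ _ _ _ _ (fun p => coef p (u s) ^+ 2)); first exact: HQ.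
    by move=> p /andP[Mp _]; exact: e.
  (* The root of a sum of squares is at most the sum of the roots; the weight exp(L s) cancels the
     decay in [HQ]. *)
  apply: le_trans (_ : Num.sqrt Q + expR (L * s) * E <= _); last first.
    by rewrite /A -addrA lerD2l; exact: low_modes_le.
  have ee : expR (L * s) ^+ 2 * expR (- (2 * L * s)) = 1.
    by rewrite -expRM_natl -expRD -expR0; congr expR; ring.
  rewrite -ler_sqr ?nnegrE ?addr_ge0 ?mulr_ge0 ?expR_ge0 ?sqrtr_ge0//.
  rewrite sqrrD sqr_sqrtr// /y !exprMn nrmL2_sqr.
  have := ler_wpM2l (sqr_ge0 (expR (L * s))) H; rewrite mulrDr [X in _ + X]mulrA ee mul1r.
  have : 0 <= Num.sqrt Q * (expR (L * s) * E) by rewrite !mulr_ge0 ?expR_ge0 ?sqrtr_ge0.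
  rewrite mulr2n; lra.
have yt := backward_gronwall (ltW T0) K0 A0 cy yA tT.
have JJ : J ^+ 2 <= T * \int[mu]_(s in `[0, T]) (\sum_(0 <= p < M.+1) dcoef p (eta ^~ s) ^+ 2).
  apply: le_trans (sqr_Rintegral_le T0 x1_continuous) _; rewrite ler_pM2l//.
  rewrite le_eqVlt; apply/orP; left; apply/eqP; apply: eq_Rintegral => s _.
  by rewrite sqr_sqrtr//; apply: sumr_ge0 => p _; exact: sqr_ge0.
have S10 : 0 <= S1 by have := HS1 0; rewrite big_geq.
have S20 : 0 <= S2 by have := HS2 tT 0; rewrite big_geq.
have dd1 : d1 ^+ 2 = M.+1%:R * (2 * pi ^+ 2 * S1 / n%:R).
  by rewrite sqr_sqrtr// mulr_ge0// divr_ge0// mulr_ge0// mulr_ge0// sqr_ge0.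
have dd2 : d2 ^+ 2 = M.+1%:R * (2 * pi ^+ 2 * S2 / n%:R).
  by rewrite sqr_sqrtr// mulr_ge0// divr_ge0// mulr_ge0// mulr_ge0// sqr_ge0.
have nn1 : n1 ^+ 2 = \sum_(0 <= p < M.+1) dcoef p nu ^+ 2.
  by rewrite sqr_sqrtr//; apply: sumr_ge0 => p _; exact: sqr_ge0.
rewrite -nrmL2_sqr; have -> : nrmL2 (v t) ^+ 2 = expR (- (2 * L * t)) * y t ^+ 2.
  rewrite /y exprMn mulrA -expRM_natl -expRD.
  by rewrite (_ : _ + _ = 0) ?expR0 ?mul1r//; ring.
have key (a b c r : R) : a * b * c * r = b * (a * c * r) by ring.
rewrite key ler_wpM2l ?expR_ge0// -dd1 -dd2 -nn1.
have y0 : 0 <= y t by rewrite mulr_ge0 ?expR_ge0.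
have -> : expR (6 * K * (T - t)) = expR (3 * K * (T - t)) ^+ 2.
  by rewrite -expRM_natl; congr expR; rewrite !mulrA -natrM.
have -> : expR (2 * T * L) = expR (L * T) ^+ 2.
  by rewrite -expRM_natl; congr expR; rewrite -mulrA [T * L]mulrC.
apply: le_trans (_ : (3 / 2 * A * expR (3 * K * (T - t))) ^+ 2 <= _).
  by rewrite lerXn2r ?nnegrE// !mulr_ge0 ?expR_ge0.
rewrite exprMn ler_wpM2r ?sqr_ge0// exprMn.
have -> : (3 / 2 : R) ^+ 2 = 9 / 4 by field.
exact: error_budget (sqr_sqrtr Q0) JJ.
Qed.

End Pathwise.

(** * Expectations *)

Section NoiseExpectation.
Context {R : realType} {d : measure_display} {W : measurableType d}.
Variable P : probability W R.
Notation mu := (@lebesgue_measure R).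

Lemma dcoefM n p (c X : 'I_n -> R) :
  dcoef p (fun k => c k * X k) = \sum_(k < n) (pi / n%:R * (c k * phi p (node k))) * X k.
Proof. by rewrite /dcoef big_distrr; apply: eq_bigr => k _ /=; ring. Qed.

Lemma noise_modes n N (X : 'I_n -> {RV P >-> R}) (c : 'I_n -> R) (V s : R) : (0 < n)%N ->
  0 < s -> (forall k, `|c k| <= V) ->
  (forall k (A : set R), measurable A -> P (X k @^-1` A) = normal_prob 0 s A) ->
  (forall k l (A B : set R), k != l -> measurable A -> measurable B ->
    P (X k @^-1` A `&` X l @^-1` B) = (P (X k @^-1` A) * P (X l @^-1` B))%E) ->
  (\int[P]_w (\sum_(0 <= p < N) dcoef p (fun k => c k * X k w) ^+ 2)%:E <=
   (N%:R * (6 * s ^+ 2 * (pi ^+ 2 * V ^+ 2 / n%:R)))%:E)%E.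
Proof.
move=> n0 s0 cV lX iX; have n0' : (0 : R) < n%:R by rewrite ltr0n.
under eq_integral do rewrite -sumEFin.
have mX p : measurable_fun setT (fun w => (dcoef p (fun k => c k * X k w) ^+ 2)%:E).
  apply/measurable_EFinP; apply: measurable_funX; apply: measurable_funM => //.
  apply: measurable_sum => k; apply: measurable_funM => //.
  by apply: measurable_funM => //; exact: measurable_funP.
rewrite ge0_integral_sum//; last by move=> p w _; rewrite lee_fin sqr_ge0.
have H p : (\int[P]_w (dcoef p (fun k => c k * X k w) ^+ 2)%:E <=
    (6 * s ^+ 2 * (pi ^+ 2 * V ^+ 2 / n%:R))%:E)%E.
  under eq_integral do rewrite dcoefM.
  apply: le_trans (gaussian_noise _ s0 lX iX) _.
  rewrite lee_fin; apply: ler_wpM2l; first by rewrite mulr_ge0// sqr_ge0.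
  (* Independence makes the n weights add in squares, so n (pi / n)^2 leaves the gain pi^2 / n. *)
  apply: le_trans (_ : \sum_(k < n) (pi / n%:R) ^+ 2 * V ^+ 2 <= _).
    apply: ler_sum => k _; rewrite exprMn ler_wpM2l ?sqr_ge0//.
    rewrite -[leLHS]real_normK ?num_real// lerXn2r ?nnegrE//.
      exact: le_trans (cV k).
    by rewrite normrM -[leRHS]mulr1; apply: ler_pM => //; exact: phi_le.
  rewrite sumr_const card_ord -[leLHS]mulr_natl le_eqVlt; apply/orP; left; apply/eqP.
  by move: n0'; move: (n%:R : R) (@pi R) => x y x0; field; rewrite gt_eqF.
apply: le_trans (lee_sum _ (fun p _ => H p)) _.
by rewrite sumEFin lee_fin sumr_const_nat subn0 -[leLHS]mulr_natl.
Qed.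

Lemma limn_einf_le (v : (\bar R)^nat) (B : \bar R) : (forall n, v n <= B)%E -> (limn_einf v <= B)%E.
Proof.
move=> vB; rewrite limn_einf_lim; apply: lime_le; first exact: is_cvg_einfs.
apply: nearW => n; apply: le_trans (vB n); apply: ereal_inf_lbound.
by exists n => /=.
Qed.

(* No joint measurability of (s, w) |-> X k s w is available, so Fubini does not
   apply: [G] is the lower limit of Riemann sums, bounded by Fatou's lemma. *)
Lemma path_integral_majorant n N (X : 'I_n -> R -> {RV P >-> R}) (T theta : R) :
  (0 < n)%N -> 0 < T -> (forall k, std_brownian T (X k)) ->
  (forall k l s (A B : set R), s \in `[0, T] -> k != l -> measurable A -> measurable B ->
    P (X k s @^-1` A `&` X l s @^-1` B) = (P (X k s @^-1` A) * P (X l s @^-1` B))%E) ->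
  exists G : W -> \bar R, [/\ measurable_fun setT G, forall w, (0 <= G w)%E,
    {ae P, forall w, (\int[mu]_(s in `[0, T])
       \sum_(0 <= p < N) dcoef p (fun k => theta * X k s w) ^+ 2)%:E = G w} &
    (\int[P]_w G w <=
      (T * (N%:R * (6 * T * (pi ^+ 2 * theta ^+ 2 / n%:R))))%:E)%E].
Proof.
move=> n0 T0 bX iX.
pose h s w := \sum_(0 <= p < N) dcoef p (fun k => theta * X k s w) ^+ 2.
pose S (m : nat) w : R := T / m.+1%:R * \sum_(j < m.+1) h (T * j.+1%:R / m.+1%:R) w.
have h0 s w : 0 <= h s w by apply: sumr_ge0 => p _; exact: sqr_ge0.
have S0 m w : 0 <= S m w by rewrite mulr_ge0 ?divr_ge0 ?sumr_ge0// ltW.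
have mh s : measurable_fun setT (h s).
  apply: measurable_sum => p; apply: measurable_funX; apply: measurable_funM => //.
  apply: measurable_sum => k; apply: measurable_funM => //.
  by apply: measurable_funM => //; exact: measurable_funP.
have mS m : measurable_fun setT (fun w => (S m w)%:E).
  by apply/measurable_EFinP; apply: measurable_funM => //; apply: measurable_sum => j.
exists (fun w => limn_einf (fun m => (S m w)%:E)); split.
(* Measurability is transferred from upper limits by a double change of sign. *)
- have -> : (fun w => limn_einf (fun m => (S m w)%:E)) =
      (fun w => (- limn_esup (fun m => - (S m w)%:E))%E).
    apply/funext => w; rewrite -limn_einfN; congr limn_einf.
    by apply/funext => m; rewrite /comp oppeK.
  apply: measurableT_comp => //; apply: measurable_fun_limn_esup => m.
  exact: measurableT_comp.
- move=> w; rewrite limn_einf_lim; apply: lime_ge; first exact: is_cvg_einfs.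
  by apply: nearW => m; apply: le_ereal_inf_tmp => _ [k _ <-]; rewrite lee_fin.
- have cX : {ae P, forall w, forall k, {within `[0, T], continuous (fun t => X k t w)}}.
    by apply: (filter_forall (F := almost_everywhere P)) => k; have [] := bX k.
  apply: filterS cX => w cX.
  have ch : {within `[0, T], continuous (fun s => h s w)}.
    apply: within_continuous_sum => p.
    have K1 : {within `[0, T], continuous (fun s => dcoef p (fun k => theta * X k s w))}.
      have K2 : {within `[0, T], continuous (fun s => \sum_(k < n) theta * X k s w * phi p (node k))}.
        by apply: within_continuous_sum => k s; apply: cvgMl; apply: cvgMr; exact: cX.
      by move=> s; apply: cvgMr; exact: K2.
    by move=> s; apply: cvgM; exact: K1.
  have cv := riemann_sum_cvg T0 ch.
  apply/esym; apply: (cvg_limn_einf_sup _).1; apply: cvg_EFin; [exact: nearW|exact: cv].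
- apply: le_trans (fatou P measurableT mS _) _; first by move=> m w _; rewrite lee_fin.
  apply: limn_einf_le => m.
  have m0 : (0 : R) < m.+1%:R by [].
  under eq_integral do rewrite /S EFinM.
  rewrite ge0_integralZl//; last first.
  - by rewrite lee_fin divr_ge0// ltW.
  - by move=> w _; rewrite lee_fin sumr_ge0.
  - by apply/measurable_EFinP; apply: measurable_sum.
  under eq_integral do rewrite -sumEFin.
  rewrite ge0_integral_sum//; last 2 first.
  - by move=> j; exact/measurable_EFinP.
  - by move=> j w _; rewrite lee_fin.
  have H (j : 'I_m.+1) : (\int[P]_w (h (T * j.+1%:R / m.+1%:R) w)%:E <=
      (N%:R * (6 * T * (pi ^+ 2 * theta ^+ 2 / n%:R)))%:E)%E.
    set s := T * _ / _.
    (* The sample times are right endpoints, hence positive, as [brownian_law] requires; the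
       variance s is later enlarged to T. *)
    have s0 : 0 < s by rewrite divr_gt0 ?mulr_gt0.
    have sT : s <= T by rewrite ler_pdivrMr// ler_pM2l// ler_nat.
    have sT' : s \in `[0, T] by rewrite in_itv/= sT ltW.
    have q0 : 0 < Num.sqrt s by rewrite sqrtr_gt0.
    have := @noise_modes n N (fun k => X k s) (fun=> theta) `|theta| (Num.sqrt s) n0 q0
      (fun=> lexx _) (fun k A mA => brownian_law (bX k) s0 sT mA) (fun k l A B kl mA mB => iX k l s A B sT' kl mA mB).
    move/le_trans; apply; rewrite lee_fin ler_wpM2l// sqr_sqrtr ?(ltW s0)//.
    rewrite real_normK ?num_real// ler_wpM2r// ?ler_pM2l//.
    by rewrite divr_ge0// mulr_ge0// sqr_ge0.
  apply: le_trans (lee_wpmul2l _ (lee_sum _ (fun j _ => H j))) _.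
    by rewrite lee_fin divr_ge0// ltW.
  rewrite sumEFin sumr_const card_ord -EFinM lee_fin -[X in T / _ * X]mulr_natl.
  by rewrite [leLHS]mulrA divfK// gt_eqF.
Qed.

End NoiseExpectation.

(** * Consequences of the weighted summability conditions *)

Section SourceConditions.
Context {R : realType}.

Lemma sup_series_le (D : set R) (a : R -> nat -> R) m (B : R) :
  (forall t p, 0 <= a t p) ->
  (ereal_sup [set (\sum_(m <= p <oo) (a t p)%:E)%E | t in D] <= B%:E)%E ->
  forall t, D t -> forall N, \sum_(m <= p < N) a t p <= B.
Proof.
move=> a0 H t Dt N; rewrite -lee_fin -sumEFin; apply: le_trans H.
apply: le_trans (ereal_sup_ubound _); last by exists t.
by apply: nneseries_lim_ge => p _ _; rewrite lee_fin.
Qed.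

Lemma tail_sum_le (c a : nat -> R) (M : nat) (r B : R) : 0 < r ->
  (forall p, 0 <= a p) -> (forall p, 0 <= c p) -> (forall p, (M < p)%N -> r <= c p) ->
  (forall N, \sum_(1 <= p < N) c p * a p <= B) ->
  forall N, \sum_(M.+1 <= p < N) a p <= r^-1 * B.
Proof.
move=> r0 a0 c0 cr HB N; rewrite ler_pdivlMl//; apply: le_trans (HB N).
have [NM|MN] := leqP N M.+1.
  by rewrite big_geq// mulr0 sumr_ge0// => p _; rewrite mulr_ge0.
rewrite [leRHS](@big_cat_nat _ _ _ M.+1)//=; last exact: ltnW.
rewrite -[leLHS]add0r lerD//; first by rewrite sumr_ge0// => p _; rewrite mulr_ge0.
by rewrite big_distrr/=; apply: ler_sum_nat => p /andP[Mp _]; rewrite ler_wpM2r// cr.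
Qed.

Lemma sqr_le_powR (gamma : R) q : 1 <= gamma -> (0 < q)%N ->
  q%:R ^+ 2 <= (q%:R : R) `^ (2 * gamma).
Proof.
move=> g1 q0; rewrite -powR_mulrn//; apply: ler_powR; first by rewrite ler1n.
by rewrite ler_peMr.
Qed.

(** The bound beta >= 1/2 gives q <= q^(2 beta), and x <= exp(x) then controls q T. *)
Lemma sqr_le_expR_lam (T beta : R) q : 0 < T -> 2^-1 <= beta -> (0 < q)%N ->
  q%:R ^+ 2 <= expR (2 * lam beta q * T) / T ^+ 2.
Proof.
move=> T0 b1 q0; have l1 : q%:R <= lam beta q.
  rewrite -[leLHS](@powRr1 _ q%:R)// /lam; apply: ler_powR; first by rewrite ler1n.
  by rewrite -ler_pdivrMl// mulr1.
rewrite ler_pdivlMr ?exprn_gt0// -exprMn -mulrA expRM_natl.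
rewrite lerXn2r ?nnegrE ?expR_ge0// ?mulr_ge0 ?(ltW T0)//.
apply: le_trans (expR_ge1Dx _); rewrite (le_trans (ler_wpM2r (ltW T0) l1))//.
by rewrite lerDr.
Qed.

End SourceConditions.

(** * Expectation of the pathwise estimate *)

Section ExpectedError.
Context {R : realType} {d : measure_display} {W : measurableType d}.
Variable P : probability W R.
Variables (T beta K S1 S2 Q Vmax theta : R) (F uT : R -> R) (g u : R -> R -> R).
Variables (M n : nat) (sigma : 'I_n -> R) (eps : 'I_n -> {RV P >-> R}).
Variables (xi : 'I_n -> R -> {RV P >-> R}) (U : W -> R -> R -> R).
Hypotheses (T0 : 0 < T) (beta0 : 0 < beta) (K0 : 0 < K) (Mn : (M < n)%N).
Hypothesis FK : forall y z, `|F y - F z| <= K * `|y - z|.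
Hypotheses (LuT : L2Omega uT) (cuT : {in Omega, continuous uT}).
Hypothesis Lg : forall t, t \in `[0, T] -> L2Omega (g t) /\ {in Omega, continuous (g t)}.
Hypothesis ig : forall x, x \in Omega -> lebesgue_measure.-integrable `[0, T] (fun t => (g t x)%:E).
Hypothesis HS1 : forall N, \sum_(1 <= q < N) (q%:R ^+ 2 * coef q uT ^+ 2) <= S1.
Hypothesis HS2 : forall t, t \in `[0, T] ->
  forall N, \sum_(1 <= q < N) (q%:R ^+ 2 * coef q (g t) ^+ 2) <= S2.
Hypothesis HQ : forall t, t \in `[0, T] -> forall N,
  \sum_(M.+1 <= p < N) coef p (u t) ^+ 2 <= expR (- (2 * lam beta M * t)) * Q.
Hypothesis su : is_solution T beta F g uT u.
Hypothesis sV : forall k, 0 <= sigma k < Vmax.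
Hypothesis eN : forall k, std_normal (eps k).
Hypothesis xB : forall k, std_brownian T (xi k).
Hypothesis ind : mutually_independent P (fun i : 'I_n + 'I_n =>
  match i with inl k => sigma_rv (eps k) | inr k => sigma_process T (xi k) end).
Hypothesis rU : {ae P, forall w, is_regularized T beta M F
  (fun k : 'I_n => uT (node k) + sigma k * eps k w)
  (fun (k : 'I_n) t => g t (node k) + theta * xi k t w) (U w)}.

Let sigT (i : 'I_n + 'I_n) :
  match i with inl k => sigma_rv (eps k) | inr k => sigma_process T (xi k) end [set: W].
Proof.
case: i => k; first by exists setT; [exact: measurableT|rewrite setTI preimage_setT].
apply: sub_sigma_algebra; exists T; first by rewrite /= in_itv/= lexx ltW.
by exists setT; [exact: measurableT|rewrite setTI preimage_setT].
Qed.

(** The four terms are the bias of [uT], its noise, the bias of [g] and its noise. In the last, T^3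
    combines Cauchy-Schwarz in time, the length of the interval, and the variance bound T. *)
Lemma expected_error t : t \in `[0, T] ->
  (\int[P]_w (normL2 (U w t \- u t)%R) ^+ 2 <=
   (6 * expR (- (2 * lam beta M * t)) *
     (3 * (2 * pi ^+ 2 * S1 + 6 * pi ^+ 2 * Vmax ^+ 2 + 2 * pi ^+ 2 * T ^+ 2 * S2 +
        6 * pi ^+ 2 * theta ^+ 2 * T ^+ 3) *
       (M.+1%:R * expR (2 * T * lam beta M) / n%:R) + Q) *
     expR (6 * K * (T - t)))%:E)%E.
Proof.
move=> tT; have n0 : (0 < n)%N by exact: leq_ltn_trans Mn.
have Q0 : 0 <= Q by have := HQ tT 0; rewrite big_geq// pmulr_rge0// expR_gt0.
have S10 : 0 <= S1 by have := HS1 0; rewrite big_geq.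
have S20 : 0 <= S2 by have := HS2 tT 0; rewrite big_geq.
have ieps k l (A B : set R) : k != l -> measurable A -> measurable B ->
    P (eps k @^-1` A `&` eps l @^-1` B) = (P (eps k @^-1` A) * P (eps l @^-1` B))%E.
  move=> kl mA mB; apply: (mutually_independent_pair (i := inl k) (j := inl l) ind _ sigT) => //.
  - by exists A => //; rewrite setTI.
  - by exists B => //; rewrite setTI.
have ixi k l s (A B : set R) : s \in `[0, T] -> k != l -> measurable A -> measurable B ->
    P (xi k s @^-1` A `&` xi l s @^-1` B) = (P (xi k s @^-1` A) * P (xi l s @^-1` B))%E.
  move=> sT kl mA mB; apply: (mutually_independent_pair (i := inr k) (j := inr l) ind _ sigT) => //.
  - by apply: sub_sigma_algebra; exists s => //; exists A => //; rewrite setTI.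
  - by apply: sub_sigma_algebra; exists s => //; exists B => //; rewrite setTI.
have [G [mG G0 GE intG]] := path_integral_majorant M.+1 theta n0 T0 xB ixi.
pose N w := \sum_(0 <= p < M.+1) dcoef p (fun k => sigma k * eps k w) ^+ 2.
have N0 w : 0 <= N w by apply: sumr_ge0 => p _; exact: sqr_ge0.
have mN : measurable_fun setT (fun w => (N w)%:E).
  apply/measurable_EFinP; apply: measurable_sum => p; apply: measurable_funX.
  apply: measurable_funM => //; apply: measurable_sum => k; apply: measurable_funM => //.
  by apply: measurable_funM => //; exact: measurable_funP.
have intN : (\int[P]_w (N w)%:E <= (M.+1%:R * (6 * 1 ^+ 2 * (pi ^+ 2 * Vmax ^+ 2 / n%:R)))%:E)%E.
  apply: noise_modes => // k; first by have /andP[s0 s1] := sV k; rewrite ger0_norm// ltW.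
pose k1 := 6 * expR (- (2 * lam beta M * t)) * expR (6 * K * (T - t)).
pose k2 := 3 * expR (2 * T * lam beta M).
pose b1 := M.+1%:R * (2 * pi ^+ 2 * S1 / n%:R).
pose b2 := T ^+ 2 * (M.+1%:R * (2 * pi ^+ 2 * S2 / n%:R)).
have k10 : 0 <= k1 by rewrite !mulr_ge0 ?expR_ge0.
have k20 : 0 <= k2 by rewrite mulr_ge0 ?expR_ge0.
have b10 : 0 <= b1 by rewrite mulr_ge0// divr_ge0// mulr_ge0// mulr_ge0// sqr_ge0.
have b20 : 0 <= b2.
  by rewrite mulr_ge0 ?sqr_ge0// mulr_ge0// divr_ge0// mulr_ge0// mulr_ge0// sqr_ge0.
pose c0 := k1 * (Q + k2 * (b1 + b2)).
have c00 : 0 <= c0 by rewrite mulr_ge0// addr_ge0// mulr_ge0// addr_ge0.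
(* A measurable majorant of the squared error: a deterministic part plus multiples of the two noise
   terms, with [G] replacing the time integral it equals almost surely. *)
pose H w := (c0%:E + ((k1 * k2)%:E * (N w)%:E + (k1 * k2 * T)%:E * G w))%E.
have k120 : 0 <= k1 * k2 by exact: mulr_ge0.
have k12T0 : 0 <= k1 * k2 * T by rewrite mulr_ge0// ltW.
have m1 : measurable_fun setT (fun w => ((k1 * k2)%:E * (N w)%:E)%E) by exact: measurable_funeM.
have m2 : measurable_fun setT (fun w => ((k1 * k2 * T)%:E * G w)%E) by exact: measurable_funeM.
have p1 w : (0 <= (k1 * k2)%:E * (N w)%:E)%E by rewrite mule_ge0 ?lee_fin.
have p2 w : (0 <= (k1 * k2 * T)%:E * G w)%E by rewrite mule_ge0 ?lee_fin.
have m12 : measurable_fun setT (fun w => ((k1 * k2)%:E * (N w)%:E + (k1 * k2 * T)%:E * G w)%E).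
  exact: emeasurable_funD.
apply: (@le_trans _ _ (\int[P]_w H w)%E).
  apply: le_lower_integral.
  - by move=> w; rewrite expe_ge0// Lnorm_ge0.
  - by move=> w; rewrite !adde_ge0// lee_fin.
  - exact: emeasurable_funD.
  have cX : {ae P, forall w, forall k, {within `[0, T], continuous (fun t => xi k t w)}}.
    by apply: (filter_forall (F := almost_everywhere P)) => k; have [] := xB k.
  apply: filterS3 rU GE cX => w rw Gw cw.
  have cw' k : {within `[0, T], continuous (fun t => theta * xi k t w)}.
    by move=> s; apply: cvgMr; exact: cw.
  have := pathwise_bound T0 beta0 K0 Mn FK LuT cuT Lg ig HS1 HS2 HQ su cw' rw tT.
  have Lv : L2Omega (fun x => U w t x - u t x).
    by apply: L2OmegaB; [exact: rw.1.1|exact: su.1.1].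
  rewrite -nrmL2_sqr normL2E// /H -Gw -EFin_expe -!EFinM -!EFinD lee_fin.
  move=> /le_trans; apply; rewrite -/b1 -/b2 -/k2 -/(N w) le_eqVlt; apply/orP; left; apply/eqP.
  by rewrite /c0 /k1; ring.
rewrite ge0_integralD//; last by move=> w _; rewrite adde_ge0.
rewrite (@ge0_integralD _ _ _ P setT measurableT _ _ (fun w _ => p1 w) m1 (fun w _ => p2 w) m2).
rewrite (@ge0_integralZl _ _ _ P setT measurableT _ mN)//; last by move=> w _; rewrite lee_fin.
rewrite (@ge0_integralZl _ _ _ P setT measurableT _ mG)//.
rewrite integral_cst//= probability_setT mule1.
apply: le_trans (leeD2l _ (leeD (lee_wpmul2l _ intN) (lee_wpmul2l _ intG))) _; rewrite ?lee_fin//.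
rewrite le_eqVlt; apply/orP; left; apply/eqP.
rewrite /c0 /b1 /b2 /k1 /k2.
move: (expR _) (expR _) (expR _) (M.+1%:R : R) (n%:R^-1 : R) (@pi R) => x1 x2 x3 x4 x5 x6.
by clear; ring.
Qed.

End ExpectedError.

(** * Choice of the constant and the two source conditions *)

Theorem theorem2p6 (R : realType) (T beta gamma E2 Vmax theta : R)
    (F : R -> R) (u : R -> R -> R)
    (T_gt0 : 0 < T) (beta_gt : 2^-1 < beta) (gamma_gt1 : 1 < gamma)
    (E2_gt0 : 0 < E2) (Vmax_gt0 : 0 < Vmax)
    (F_bounded : F \in Lfun lebesgue_measure +oo%E) :
  exists C3 : R, 0 < C3 /\
  forall (K : R) (g : R -> R -> R) (uT : R -> R) (M : nat -> nat),
    0 < K ->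
    (forall xi1 xi2 : R, `|F xi1 - F xi2| <= K * `|xi1 - xi2|) ->
    L2Omega uT -> {in Omega, continuous uT} ->
    (forall t : R, t \in `[0, T] -> L2Omega (g t) /\ {in Omega, continuous (g t)}) ->
    (forall x : R, x \in Omega ->
       lebesgue_measure.-integrable `[0%R, T] (fun t => (g t x)%:E)) ->
    (ereal_sup [set (\sum_(0 <= p <oo)
                       (p%:R `^ (2 * gamma) * coef p (g t) ^+ 2)%:E)%E
               | t in `[0%R, T]] <= E2%:E)%E ->
    (forall n, (1 < n)%N -> (0 < M n < n)%N) ->
    (exists B : R, \forall n \near \oo,
       (M n).+1%:R * expR (2 * T * (M n)%:R `^ (2 * beta)) / n%:R <= B) ->
    is_unique_solution T beta F g uT u ->
  forall (n : nat) (d : measure_display) (W : measurableType d)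
      (P : probability W R) (sigma : 'I_n -> R)
      (eps : 'I_n -> {RV P >-> R}) (xi : 'I_n -> R -> {RV P >-> R})
      (U : W -> R -> R -> R),
    (1 < n)%N ->
    (forall k, 0 <= sigma k < Vmax) ->
    (forall k, std_normal (eps k)) ->
    (forall k, std_brownian T (xi k)) ->
    mutually_independent P (fun i : 'I_n + 'I_n =>
      match i with
      | inl k => sigma_rv (eps k)
      | inr k => sigma_process T (xi k)
      end) ->
    {ae P, forall w,
       is_regularized T beta (M n) F
         (fun k : 'I_n => uT (node k) + sigma k * eps k w)
         (fun (k : 'I_n) t => g t (node k) + theta * xi k t w)
         (U w)} ->
  forall t : R, t \in `[0, T] ->
    (forall P1 : R,
       (ereal_sup [set (\sum_(1 <= p <oo)
           (expR (2 * p%:R `^ (2 * beta) * s) * `|coef p (u s)| ^+ 2)%:E)%E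
         | s in `[0%R, T]] <= P1%:E)%E ->
       (\int[P]_w (normL2 (U w t \- u t)%R) ^+ 2
        <= (6 * expR (- (2 * (M n)%:R `^ (2 * beta) * t)) *
            (C3 * ((M n).+1%:R * expR (2 * T * (M n)%:R `^ (2 * beta)) / n%:R)
             + P1) *
            expR (6 * K * (T - t)))%:E)%E)
    /\
    (forall alpha P2 : R, 0 < alpha ->
       (ereal_sup [set (\sum_(1 <= p <oo)
           (p%:R `^ (2 * beta * alpha) * expR (2 * p%:R `^ (2 * beta) * s) *
            `|coef p (u s)| ^+ 2)%:E)%E
         | s in `[0%R, T]] <= P2%:E)%E ->
       (\int[P]_w (normL2 (U w t \- u t)%R) ^+ 2
        <= (6 * expR (- (2 * (M n)%:R `^ (2 * beta) * t)) *
            (C3 * ((M n).+1%:R * expR (2 * T * (M n)%:R `^ (2 * beta)) / n%:R)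
             + (M n)%:R `^ (- (2 * beta * alpha)) * P2) *
            expR (6 * K * (T - t)))%:E)%E).
Proof.
have beta0 : 0 < beta by apply: lt_trans beta_gt; rewrite invr_gt0.
(* Both source conditions imply a bound of this kind, which involves only [u], [T] and [beta] and is
   available before [g] and [uT]. *)
pose weighted B := forall s, s \in `[0, T] -> forall N,
  \sum_(1 <= p < N) (expR (2 * p%:R `^ (2 * beta) * s) * coef p (u s) ^+ 2) <= B.
have V2 : 0 < 6 * pi ^+ 2 * Vmax ^+ 2 by rewrite !mulr_gt0 ?exprn_gt0 ?pi_gt0.
have th2 : 0 <= 6 * pi ^+ 2 * theta ^+ 2 * T ^+ 3.
  by rewrite mulr_ge0 ?exprn_ge0 ?(ltW T_gt0)// mulr_ge0 ?sqr_ge0// mulr_ge0// sqr_ge0.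
have T2E : 0 <= 2 * pi ^+ 2 * T ^+ 2 * E2 by rewrite mulr_ge0 ?(ltW E2_gt0)// mulr_ge0 ?sqr_ge0// mulr_ge0// sqr_ge0.
have TT : T \in `[0, T] by rewrite in_itv/= lexx ltW.
have series1 (P1 : R) : (ereal_sup [set (\sum_(1 <= p <oo)
    (expR (2 * p%:R `^ (2 * beta) * s) * `|coef p (u s)| ^+ 2)%:E)%E
    | s in `[0%R, T]] <= P1%:E)%E -> weighted P1.
  move=> H s sT N; have := sup_series_le (m := 1)
    (a := fun s p => expR (2 * p%:R `^ (2 * beta) * s) * `|coef p (u s)| ^+ 2) _ H sT N.
  under [in X in _ -> X]eq_bigr do rewrite -real_normK ?num_real//.
  by apply => r p; rewrite mulr_ge0 ?expR_ge0 ?sqr_ge0.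
have series2 (alpha P2 : R) : 0 < alpha -> (ereal_sup [set (\sum_(1 <= p <oo)
    (p%:R `^ (2 * beta * alpha) * expR (2 * p%:R `^ (2 * beta) * s) *
     `|coef p (u s)| ^+ 2)%:E)%E | s in `[0%R, T]] <= P2%:E)%E ->
    forall s, s \in `[0, T] -> forall N, \sum_(1 <= p < N) (p%:R `^ (2 * beta * alpha) *
      expR (2 * p%:R `^ (2 * beta) * s) * coef p (u s) ^+ 2) <= P2.
  move=> a0 H s sT N; have := sup_series_le (m := 1)
    (a := fun s p => p%:R `^ (2 * beta * alpha) * expR (2 * p%:R `^ (2 * beta) * s) *
      `|coef p (u s)| ^+ 2) _ H sT N.
  under [in X in _ -> X]eq_bigr do rewrite -real_normK ?num_real//.
  by apply => r p; rewrite !mulr_ge0 ?expR_ge0 ?powR_ge0 ?sqr_ge0.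
have weighted2 (alpha P2 : R) : 0 < alpha -> (forall s, s \in `[0, T] -> forall N,
    \sum_(1 <= p < N) (p%:R `^ (2 * beta * alpha) *
      expR (2 * p%:R `^ (2 * beta) * s) * coef p (u s) ^+ 2) <= P2) -> weighted P2.
  move=> a0 H s sT N; apply: le_trans (H s sT N).
  apply: ler_sum_nat => p /andP[p0 _]; rewrite ler_wpM2r ?sqr_ge0// ler_peMl ?expR_ge0//.
  rewrite -[leLHS](powRr0 (p%:R : R)); apply: ler_powR; first by rewrite ler1n.
  by rewrite !mulr_ge0 ?(ltW beta0) ?(ltW a0).
(* If no weighted bound exists, neither source condition can hold, so both conclusions are vacuous
   and the constant 1 serves. *)
have [[B HB]|nB] := pselect (exists B, weighted B); last first.
  exists 1; split=> //; move=> K g uT M _ _ _ _ _ _ _ _ _ _ n d W P sigma eps xi U _ _ _ _ _ _ t _.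
  split=> [P1 HP|alpha P2 a0 HP]; first by case: nB; exists P1; exact: series1.
  by case: nB; exists P2; apply: (weighted2 alpha) => //; exact: series2.
have B0 : 0 <= B by have := HB T TT 0; rewrite big_geq.
have S1 : 0 <= 2 * pi ^+ 2 * (B / T ^+ 2) by rewrite mulr_ge0 ?divr_ge0 ?sqr_ge0// mulr_ge0// sqr_ge0.
(* The constant of [expected_error] with S1 = B / T^2 and S2 = [E2]. It uses [B] rather than the
   later P1 or P2. *)
exists (3 * (2 * pi ^+ 2 * (B / T ^+ 2) + 6 * pi ^+ 2 * Vmax ^+ 2 +
  2 * pi ^+ 2 * T ^+ 2 * E2 + 6 * pi ^+ 2 * theta ^+ 2 * T ^+ 3)); split.
  by rewrite mulr_gt0// ltr_wpDr// ltr_wpDr// ltr_wpDl.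
move=> K g uT M K0 FK LuT cuT Lg ig Hg HM _ [su _] n d W P sigma eps xi U n1 sV eN xB ind rU t tT.
have /andP[M0 Mn] := HM n n1.
have HS2 s : s \in `[0, T] -> forall N, \sum_(1 <= q < N) (q%:R ^+ 2 * coef q (g s) ^+ 2) <= E2.
  move=> sT N; have := sup_series_le (m := 0) (a := fun s p => p%:R `^ (2 * gamma) * coef p (g s) ^+ 2)
    _ Hg sT N.
  have a0 r p : 0 <= p%:R `^ (2 * gamma) * coef p (g r) ^+ 2 by rewrite mulr_ge0 ?powR_ge0 ?sqr_ge0.
  move=> /(_ a0); apply: le_trans.
  have [N1|N1] := leqP N 1; first by rewrite big_geq// sumr_ge0.
  rewrite (@big_cat_nat _ _ _ 1 0)//= ?(ltnW N1)// -[leLHS]add0r lerD ?sumr_ge0//.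
  apply: ler_sum_nat => q /andP[q0 _]; rewrite ler_wpM2r ?sqr_ge0//.
  exact: sqr_le_powR (ltW gamma_gt1) q0.
have HS1 N : \sum_(1 <= q < N) (q%:R ^+ 2 * coef q uT ^+ 2) <= B / T ^+ 2.
  apply: le_trans (_ : (\sum_(1 <= p < N) (expR (2 * p%:R `^ (2 * beta) * T) * coef p (u T) ^+ 2)) / T ^+ 2 <= _).
    rewrite big_distrl/=; apply: ler_sum_nat => q /andP[q0 _].
    rewrite (su.2 q).2 [leRHS]mulrAC ler_wpM2r ?sqr_ge0//.
    exact: sqr_le_expR_lam T_gt0 (ltW beta_gt) q0.
  by rewrite ler_wpM2r ?invr_ge0 ?sqr_ge0//; exact: HB.
have main Q HQ := expected_error (Q := Q) T_gt0 beta0 K0 Mn FK LuT cuT Lg ig HS1 HS2 HQ su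
  sV eN xB ind rU tT.
have lamM p : (M n < p)%N -> lam beta (M n) <= lam beta p.
  by move=> Mp; apply: lam_le (ltW beta0) (ltnW Mp).
have expM s p : s \in `[0, T] -> (M n < p)%N ->
    expR (2 * lam beta (M n) * s) <= expR (2 * p%:R `^ (2 * beta) * s).
  rewrite in_itv/= => /andP[s0 _] Mp; rewrite ler_expR ler_wpM2r// ler_wpM2l//; exact: lamM.
split=> [P1 HP|alpha P2 a0 HP].
  apply: (main P1) => s sT; rewrite expRN; apply: (@tail_sum_le _ (fun p => expR (2 * p%:R `^ (2 * beta) * s))).
  - exact: expR_gt0.
  - by move=> p; exact: sqr_ge0.
  - by move=> p; exact: expR_ge0.
  - by move=> p; exact: expM.
  - exact: series1.
have M0' : (0 : R) < (M n)%:R by rewrite ltr0n.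
apply: (main ((M n)%:R `^ (- (2 * beta * alpha)) * P2)) => s sT.
(* The product of decays is the inverse of the weight at p = M, the least value of the weight on the
   tail. *)
rewrite expRN powRN mulrA -invfM [X in X^-1]mulrC.
apply: (@tail_sum_le _ (fun p => p%:R `^ (2 * beta * alpha) * expR (2 * p%:R `^ (2 * beta) * s))).
- by rewrite mulr_gt0 ?powR_gt0 ?expR_gt0.
- by move=> p; exact: sqr_ge0.
- by move=> p; rewrite mulr_ge0 ?powR_ge0 ?expR_ge0.
- move=> p Mp; apply: ler_pM; rewrite ?powR_ge0 ?expR_ge0//; last exact: expM.
  by apply: ge0_ler_powR; rewrite ?nnegrE ?ler_nat ?(ltnW Mp)// !mulr_ge0 ?(ltW beta0) ?(ltW a0).
- exact: series2.
Qed.
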